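(* Let $k$ be an $F$-finite field of characteristic $p>0$, and let $R=\bigoplus_{n\ge 0}R_n$ be a reduced Noetherian $\mathbf{N}$-graded ring with $R_0=k$ and irrelevant ideal $\mathfrak m=\bigoplus_{n>0}R_n$. Then the local ring $R_{\mathfrak m}$ satisfies Condition (B), and hence the $F$-signature of $R_{\mathfrak m}$ exists.
   Context: Throughout, $q=p^e$ with $e\ge 0$. A ring of characteristic $p$ is $F$-finite if it is a finite module over itself via the Frobenius map. $F$-signature: let $(S,\mathfrak n,\kappa)$ be a reduced Noetherian $F$-finite local ring of characteristic $p>0$ and Krull dimension $d$, and put $\alpha(S)=\log_p[\kappa:\kappa^p]$. For each $q=p^e$ write $S^{1/q}\cong S^{a_q}\oplus M_q$ as $S$-modules, where $M_q$ has no nonzero free direct summand. The $F$-signature of $S$ is $s(S)=\lim_{q\to\infty} a_q/q^{d+\alpha(S)}$, if this limit exists. Condition (B): let $E$ be the injective hull of $\kappa$ over $S$, let $u\in E$ be a generator of its socle, and identify $\kappa=Su\subseteq E$. Let $S^{(e)}$ denote the $S$-bimodule whose underlying abelian group is $S$ and whose left and right multiplications are given by $a\cdot r * b=a\,r\,b^q$ for $a,b\in S$, $r\in S^{(e)}$ (with $q=p^e$). Tensor products $S^{(e)}\otimes_S -$ are formed using the right structure, and are regarded as $S$-modules (and lengths taken) via the left structure. Let $\phi_e: S^{(e)}\otimes_S E\to S^{(e)}\otimes_S (E/\kappa)$ be the natural map. $S$ satisfies Condition (B) if there is a finite length submodule $E'\subseteq E$ containing $\kappa=Su$ such that, with $\psi_e: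 S^{(e)}\otimes_S E'\to S^{(e)}\otimes_S(E'/\kappa)$ the natural map, $\operatorname{length}(\ker\phi_e)=\operatorname{length}(\ker\psi_e)$ for all $e$. *)

(* Defs.v *)
From HB Require Import structures.
From mathcomp Require Import all_boot all_order all_algebra generic_quotient ring_quotient.
From mathcomp Require Import all_classical all_reals all_analysis.

Set Implicit Arguments.
Unset Strict Implicit.
Unset Printing Implicit Defensive.

Import Order.TTheory GRing.Theory Num.Theory.
Import numFieldNormedType.Exports.

Local Open Scope ring_scope.
Local Open Scope quotient_scope.

Record submodule (A : comNzRingType) (M : lmodType A) := Submodule {
  submod_pred :> {pred M};
  submodP : submod_closed submod_pred
}.

HB.instance Definition _ (A : comNzRingType) (M : lmodType A)
    (N : submodule M) :=
  GRing.isSubmodClosed.Build A M (submod_pred N) (submodP N).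

Definition submod_type (A : comNzRingType) (M : lmodType A)
  (N : submodule M) : Type := {x : M | x \in submod_pred N}.

HB.instance Definition _ A M N := SubChoice.on (@submod_type A M N).
HB.instance Definition _ A M N :=
  [SubChoice_isSubLmodule of @submod_type A M N by <:].

Definition submod_incl (A : comNzRingType) (M : lmodType A)
  (N : submodule M) : submod_type N -> M := val.

HB.instance Definition _ A M N := GRing.Linear.on (@submod_incl A M N).

Definition ideal (A : comNzRingType) := submodule A^o.

Section SubmoduleOperations.
Variables (A : comNzRingType) (M M' : lmodType A).

Lemma ker_closed (f : {linear M -> M'}) : submod_closed [pred x | f x == 0].
Proof.
split=> [|a x y]; rewrite !inE ?linear0 // => /eqP fx /eqP fy.
by rewrite linearP fx fy scaler0 addr0.
Qed.
Definition ker_submod f := Submodule (ker_closed f).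

Lemma line_closed (u : M) :
  submod_closed [pred x | `[< exists a : A, x = a *: u >]].
Proof.
split=> [|a x y]; first by apply/asboolP; exists 0; rewrite scale0r.
move=> /asboolP[b ->] /asboolP[c ->]; apply/asboolP; exists (a * b + c).
by rewrite scalerA scalerDl.
Qed.
Definition line (u : M) := Submodule (line_closed u).

Lemma preim_closed (f : {linear M -> M'}) (N : submodule M') :
  submod_closed [pred x | f x \in N].
Proof.
split=> [|a x y]; rewrite !inE ?linear0 ?rpred0 // => fx fy.
by rewrite linearP rpredD ?rpredZ.
Qed.
Definition preim_submod f N := Submodule (@preim_closed f N).

End SubmoduleOperations.

Section QuotientModule.
Variables (A : comNzRingType) (M : lmodType A) (N : submodule M).

Definition quot_module : Type := Quotient.quot (submod_pred N).
HB.instance Definition _ := GRing.Zmodule.on quot_module.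

Definition quot_proj (x : M) : quot_module :=
  \pi_(Quotient.quot (submod_pred N)) x.

Definition quot_repr (t : quot_module) : M :=
  @repr _ (Quotient.quot (submod_pred N)) t.

Lemma quot_reprK t : quot_proj (quot_repr t) = t.
Proof. exact: (@reprK _ (Quotient.quot (submod_pred N))). Qed.

Lemma quot_projP x y : quot_proj x = quot_proj y <-> x - y \in submod_pred N.
Proof. by rewrite Quotient.idealrBE; split=> [/eqP|/eqP]. Qed.

Lemma quot_projD x y : quot_proj (x + y) = quot_proj x + quot_proj y.
Proof. exact: (raddfD (\pi_(Quotient.quot (submod_pred N)))). Qed.

Definition quot_scale (a : A) (t : quot_module) : quot_module :=
  quot_proj (a *: quot_repr t).

Lemma quot_scaleE a x : quot_scale a (quot_proj x) = quot_proj (a *: x).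
Proof.
by apply/quot_projP; rewrite -scalerBr rpredZ //; apply/quot_projP/quot_reprK.
Qed.

Lemma quot_scaleA a b t :
  quot_scale a (quot_scale b t) = quot_scale (a * b) t.
Proof. by rewrite -[t]quot_reprK !quot_scaleE scalerA. Qed.

Lemma quot_scale1 : left_id 1 quot_scale.
Proof. by move=> t; rewrite -[t]quot_reprK quot_scaleE scale1r. Qed.

Lemma quot_scaleDr : right_distributive quot_scale +%R.
Proof.
move=> a s t; rewrite -[s]quot_reprK -[t]quot_reprK.
by rewrite -quot_projD !quot_scaleE scalerDr quot_projD.
Qed.

Lemma quot_scaleDl t : {morph quot_scale^~ t : a b / a + b}.
Proof.
by move=> a b; rewrite -[t]quot_reprK !quot_scaleE scalerDl quot_projD.
Qed.

HB.instance Definition _ := GRing.Zmodule_isLmodule.Build A quot_module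
  quot_scaleA quot_scale1 quot_scaleDr quot_scaleDl.

Lemma quot_proj_linear : linear quot_proj.
Proof. by move=> a x y; rewrite quot_projD -quot_scaleE. Qed.

HB.instance Definition _ :=
  GRing.isLinear.Build A M quot_module *:%R quot_proj quot_proj_linear.

End QuotientModule.

Definition composition_series (A : comNzRingType) (M : lmodType A) (n : nat)
    (C : nat -> submodule M) : Prop :=
  [/\ forall x, (x \in C 0%N) = (x == 0),
      forall x, x \in C n
    & forall i, (i < n)%N ->
        [/\ {subset C i <= C i.+1}, ~ C i =i C i.+1
          & forall B : submodule M,
              {subset C i <= B} -> {subset B <= C i.+1} ->
              B =i C i \/ B =i C i.+1]].

Definition has_length (A : comNzRingType) (M : lmodType A) (n : nat) : Prop :=
  exists C : nat -> submodule M, composition_series n C.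

Definition finite_length (A : comNzRingType) (M : lmodType A) : Prop :=
  exists n, has_length M n.

(* [None] stands for infinite length. *)
Definition module_length (A : comNzRingType) (M : lmodType A) : option nat :=
  if pselect (finite_length M) is left fl then Some (projT1 (cid fl)) else None.

Definition injective_module (A : comNzRingType) (E : lmodType A) : Prop :=
  forall (M N : lmodType A) (i : {linear M -> N}) (g : {linear M -> E}),
    injective i -> exists h : {linear N -> E}, forall x, h (i x) = g x.

Definition injective_hull (A : comNzRingType) (K E : lmodType A)
    (j : {linear K -> E}) : Prop :=
  [/\ injective j, injective_module E
    & forall N : submodule E, (exists2 x, x \in N & x != 0) ->
        exists2 y, j y \in N & j y != 0].

Section FrobeniusTensor.
Variables (A : comNzRingType) (q : nat) (N : lmodType A).

(* A list [:: (r1, x1); ...; (rn, xn)] stands for the sum of the elementary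
   tensors ri (x) xi.  The relation is the congruence presenting the tensor
   product over the right structure r * b = r b^q. *)
Inductive frob_rel : seq (A * N) -> seq (A * N) -> Prop :=
| frob_refl s : frob_rel s s
| frob_sym s t : frob_rel s t -> frob_rel t s
| frob_trans s t u : frob_rel s t -> frob_rel t u -> frob_rel s u
| frob_cat s s' t t' :
    frob_rel s s' -> frob_rel t t' -> frob_rel (s ++ t) (s' ++ t')
| frob_catC s t : frob_rel (s ++ t) (t ++ s)
| frob_zero x : frob_rel [:: (0, x)] [::]
| frob_addl r r' x : frob_rel [:: (r + r', x)] [:: (r, x); (r', x)]
| frob_addr r x x' : frob_rel [:: (r, x + x')] [:: (r, x); (r, x')]
| frob_bal r b x : frob_rel [:: (r * b ^+ q, x)] [:: (r, b *: x)].

Definition frob_eq (s t : seq (A * N)) : bool := `[< frob_rel s t >].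

Lemma frob_eq_equiv : equiv_class_of frob_eq.
Proof.
split=> [s|s t|s t u].
- exact/asboolP/frob_refl.
- by apply/asboolP/asboolP; apply: frob_sym.
- by move=> /asboolP ts /asboolP su; apply/asboolP; apply: frob_trans ts su.
Qed.

Canonical frob_eq_equivrel := EquivRelPack frob_eq_equiv.
Canonical frob_eq_encmod := defaultEncModRel frob_eq.

Definition frob_tensor : Type := {eq_quot frob_eq}.
HB.instance Definition _ := Choice.on frob_tensor.

Definition tens (s : seq (A * N)) : frob_tensor := \pi_{eq_quot frob_eq} s.
Definition tens_repr (t : frob_tensor) : seq (A * N) :=
  @repr _ {eq_quot frob_eq} t.

Lemma tens_reprK t : tens (tens_repr t) = t.
Proof. exact: (@reprK _ {eq_quot frob_eq}). Qed.

Lemma tensP s t : tens s = tens t <-> frob_rel s t.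
Proof.
split=> [/eqP|st]; first by rewrite [_ == _]piE => /asboolP.
by apply/eqP; rewrite [_ == _]piE; apply/asboolP.
Qed.

Definition tens_mul (a : A) (s : seq (A * N)) : seq (A * N) :=
  [seq (a * rx.1, rx.2) | rx <- s].

Definition tens_zero : frob_tensor := tens [::].
Definition tens_add (s t : frob_tensor) : frob_tensor :=
  tens (tens_repr s ++ tens_repr t).
Definition tens_scale (a : A) (t : frob_tensor) : frob_tensor :=
  tens (tens_mul a (tens_repr t)).
Definition tens_opp (t : frob_tensor) : frob_tensor := tens_scale (- 1) t.

Lemma tens_mul_rel a s t : frob_rel s t -> frob_rel (tens_mul a s) (tens_mul a t).
Proof.
elim=> {s t} [s|s t _|s t u _ st _ tu|s s' t t' _ ss _ tt|s t|x|r r' x|r x x'|r b x].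
- exact: frob_refl.
- exact: frob_sym.
- exact: frob_trans st tu.
- by rewrite /tens_mul !map_cat; apply: frob_cat.
- by rewrite /tens_mul !map_cat; apply: frob_catC.
- by rewrite /= mulr0; apply: frob_zero.
- by rewrite /= mulrDr; apply: frob_addl.
- exact: frob_addr.
- by rewrite /= mulrA; apply: frob_bal.
Qed.

Lemma tens_addE s t : tens_add (tens s) (tens t) = tens (s ++ t).
Proof. by apply/tensP/frob_cat; apply/tensP; rewrite tens_reprK. Qed.

Lemma tens_scaleE a s : tens_scale a (tens s) = tens (tens_mul a s).
Proof. by apply/tensP/tens_mul_rel; apply/tensP; rewrite tens_reprK. Qed.

Lemma tens_addA : associative tens_add.
Proof.
move=> s t u; rewrite -[s]tens_reprK -[t]tens_reprK -[u]tens_reprK.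
by rewrite !tens_addE catA.
Qed.

Lemma tens_addC : commutative tens_add.
Proof.
move=> s t; rewrite -[s]tens_reprK -[t]tens_reprK !tens_addE.
exact/tensP/frob_catC.
Qed.

Lemma tens_add0 : left_id tens_zero tens_add.
Proof. by move=> t; rewrite -[t]tens_reprK tens_addE. Qed.

Lemma tens_scaleDl_subproof t :
  {morph tens_scale^~ t : a b / a + b >-> tens_add a b}.
Proof.
move=> a b; rewrite -[t]tens_reprK !tens_scaleE tens_addE; apply/tensP.
elim: (tens_repr t) => [|[r x] s IHs] /=; first exact: frob_refl.
rewrite mulrDl -cat1s.
apply: frob_trans (frob_cat (frob_addl _ _ _) IHs) _ => /=.
rewrite -cat1s -[X in frob_rel _ X]cat1s; apply/frob_cat; first exact: frob_refl.
rewrite -cat1s -[X in frob_rel _ (_ ++ X)]cat1s !catA.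
by apply/frob_cat/frob_refl/frob_catC.
Qed.

Lemma tens_scale0 t : tens_scale 0 t = tens_zero.
Proof.
rewrite -[t]tens_reprK tens_scaleE; apply/tensP.
elim: (tens_repr t) => [|[r x] s IHs] /=; first exact: frob_refl.
by rewrite mul0r -cat1s; apply: (frob_cat (frob_zero x) IHs).
Qed.

Lemma tens_scale1 : left_id 1 tens_scale.
Proof.
move=> t; rewrite -[t]tens_reprK tens_scaleE; congr tens.
by rewrite -[RHS]map_id; apply: eq_map => -[r x]; rewrite /= mul1r.
Qed.

Lemma tens_addN : left_inverse tens_zero tens_opp tens_add.
Proof.
move=> t; rewrite -{2}[t]tens_scale1 -tens_scaleDl_subproof.
by rewrite addNr tens_scale0.
Qed.

HB.instance Definition _ := GRing.isZmodule.Build frob_tensor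
  tens_addA tens_addC tens_add0 tens_addN.

Lemma tensD s t : tens (s ++ t) = tens s + tens t.
Proof. by rewrite -tens_addE. Qed.

Lemma tens_scaleA a b t : tens_scale a (tens_scale b t) = tens_scale (a * b) t.
Proof.
rewrite -[t]tens_reprK !tens_scaleE; congr tens; rewrite /tens_mul -map_comp.
by apply: eq_map => -[r x]; rewrite /= mulrA.
Qed.

Lemma tens_scaleDr : right_distributive tens_scale +%R.
Proof.
move=> a s t; rewrite -[s]tens_reprK -[t]tens_reprK -tensD !tens_scaleE.
by rewrite /tens_mul map_cat tensD.
Qed.

Lemma tens_scaleDl t : {morph tens_scale^~ t : a b / a + b}.
Proof. exact: tens_scaleDl_subproof. Qed.

(* The left structure a (r (x) x) = (a r) (x) x. *)
HB.instance Definition _ := GRing.Zmodule_isLmodule.Build A frob_tensor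
  tens_scaleA tens_scale1 tens_scaleDr tens_scaleDl.

Lemma tensZ a s : a *: tens s = tens (tens_mul a s).
Proof. exact: tens_scaleE. Qed.

End FrobeniusTensor.

Section FrobeniusTensorMap.
Variables (A : comNzRingType) (q : nat) (N N' : lmodType A).
Variable f : {linear N -> N'}.

Definition tens_map (s : seq (A * N)) : seq (A * N') :=
  [seq (rx.1, f rx.2) | rx <- s].

Lemma tens_map_rel s t :
  frob_rel q s t -> frob_rel q (tens_map s) (tens_map t).
Proof.
elim=> {s t} [s|s t _|s t u _ st _ tu|s s' t t' _ ss _ tt|s t|x|r r' x|r x x'|r b x].
- exact: frob_refl.
- exact: frob_sym.
- exact: frob_trans st tu.
- by rewrite /tens_map !map_cat; apply: frob_cat.
- by rewrite /tens_map !map_cat; apply: frob_catC.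
- exact: frob_zero.
- exact: frob_addl.
- by rewrite /= linearD; apply: frob_addr.
- by rewrite /= linearZ; apply: frob_bal.
Qed.

Definition frob_tensor_map (t : frob_tensor q N) : frob_tensor q N' :=
  tens q (tens_map (tens_repr t)).

Lemma frob_tensor_mapE s : frob_tensor_map (tens q s) = tens q (tens_map s).
Proof. by apply/tensP/tens_map_rel; apply/tensP; rewrite tens_reprK. Qed.

Lemma frob_tensor_map_linear : linear frob_tensor_map.
Proof.
move=> a s t; rewrite -[s]tens_reprK -[t]tens_reprK.
rewrite tensZ -tensD !frob_tensor_mapE tensZ -tensD; congr tens.
by rewrite /tens_map /tens_mul map_cat -!map_comp.
Qed.

HB.instance Definition _ := GRing.isLinear.Build A (frob_tensor q N)
  (frob_tensor q N') *:%R frob_tensor_map frob_tensor_map_linear.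

End FrobeniusTensorMap.
Arguments frob_tensor_map {A} q {N N'} f t.

(* The maximal ideal is the kernel of [res]; [res_local] says that it
   consists of all the nonunits. *)
Record localRing := LocalRing {
  local_ring :> comNzRingType;
  residue : fieldType;
  res : {rmorphism local_ring -> residue};
  res_surj : forall y, exists x, res x = y;
  res_local : forall x, res x != 0 -> exists y, x * y = 1
}.

Section ResidueModule.
Variable S : localRing.

Definition residue_module : Type := residue S.
HB.instance Definition _ := GRing.Zmodule.on residue_module.

Definition residue_scale (a : S) (x : residue_module) : residue_module :=
  (res S a * x : residue S).

Fact residue_scaleA a b x :
  residue_scale a (residue_scale b x) = residue_scale (a * b) x.
Proof. by rewrite /residue_scale rmorphM mulrA. Qed.
Fact residue_scale1 : left_id 1 residue_scale.
Proof. by move=> x; rewrite /residue_scale rmorph1 mul1r. Qed.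
Fact residue_scaleDr : right_distributive residue_scale +%R.
Proof. by move=> a x y; apply: mulrDr. Qed.
Fact residue_scaleDl x : {morph residue_scale^~ x : a b / a + b}.
Proof. by move=> a b; rewrite /residue_scale rmorphD mulrDl. Qed.

HB.instance Definition _ := GRing.Zmodule_isLmodule.Build S residue_module
  residue_scaleA residue_scale1 residue_scaleDr residue_scaleDl.

(* Over a local ring the socle of E is the annihilator in E of the maximal
   ideal. *)
Definition socle (E : lmodType S) : set E :=
  [set x | forall a : S, res S a = 0 -> a *: x = 0].

End ResidueModule.
Arguments socle {S} E _.

Definition phi_map (S : localRing) (q : nat) (E : lmodType S) (u : E) :
    {linear frob_tensor q E -> frob_tensor q (quot_module (line u))} :=
  frob_tensor_map q (quot_proj (line u)).

(* [preim_submod (submod_incl E') (line u)] is S u viewed inside E'. *)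
Definition psi_map (S : localRing) (q : nat) (E : lmodType S) (u : E)
    (E' : submodule E) :
    {linear frob_tensor q (submod_type E') ->
       frob_tensor q
         (quot_module (preim_submod (submod_incl (N := E')) (line u)))} :=
  frob_tensor_map q
    (quot_proj (preim_submod (submod_incl (N := E')) (line u))).

(* E is an injective hull of the residue field along j, and u generates the
   socle of E, so that S u is the copy of the residue field in E. *)
Definition condition_B (p : nat) (S : localRing) : Prop :=
  forall (E : lmodType S) (j : {linear residue_module S -> E}) (u : E),
    injective_hull j ->
    (forall x, socle E x <-> x \in line u) ->
    exists E' : submodule E,
      [/\ finite_length (submod_type E'), u \in E'
        & forall e : nat,
            module_length (submod_type (ker_submod (phi_map (p ^ e) u))) =
            module_length (submod_type (ker_submod (psi_map (p ^ e) u E')))].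

(* A with the A-module structure a . r = a^(p^e) r.  For A reduced this is
   the A-module A^(1/p^e), the element r standing for r^(1/p^e). *)
Definition frob_push (p : nat) (A : comNzRingType) (chA : p \in [pchar A])
  (e : nat) : Type := A.

Section FrobeniusPushforward.
Variables (p : nat) (A : comNzRingType) (chA : p \in [pchar A]) (e : nat).

Local Notation F := (frob_push chA e).
HB.instance Definition _ := GRing.Zmodule.on F.

Definition frob_push_scale (a : A) (r : F) : F := (a ^+ (p ^ e) * (r : A)).

Fact frob_push_scaleA a b r :
  frob_push_scale a (frob_push_scale b r) = frob_push_scale (a * b) r.
Proof. by rewrite /frob_push_scale exprMn mulrA. Qed.
Fact frob_push_scale1 : left_id 1 frob_push_scale.
Proof. by move=> r; rewrite /frob_push_scale expr1n mul1r. Qed.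
Fact frob_push_scaleDr : right_distributive frob_push_scale +%R.
Proof. by move=> a r s; apply: mulrDr. Qed.
Fact frob_push_scaleDl r : {morph frob_push_scale^~ r : a b / a + b}.
Proof.
move=> a b; rewrite /frob_push_scale exprDn_pchar ?mulrDl //.
by rewrite pnatX pnatE ?chA // (pcharf_prime chA).
Qed.

HB.instance Definition _ := GRing.Zmodule_isLmodule.Build A F
  frob_push_scaleA frob_push_scale1 frob_push_scaleDr frob_push_scaleDl.

End FrobeniusPushforward.

Definition finite_module (A : comNzRingType) (M : lmodType A) : Prop :=
  exists (n : nat) (g : 'I_n -> M),
    forall x, exists c : 'I_n -> A, x = \sum_i c i *: g i.

Definition F_finite (p : nat) (A : comNzRingType) (chA : p \in [pchar A]) :
    Prop :=
  finite_module (frob_push chA 1).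

Definition isomorphic (A : comNzRingType) (M N : lmodType A) : Prop :=
  exists f : {linear M -> N}, bijective f.

Definition no_free_summand (A : comNzRingType) (M : lmodType A) : Prop :=
  forall (n : nat) (N : lmodType A),
    isomorphic M ('rV[A]_n * N)%type -> n = 0%N.

Definition free_rank (A : comNzRingType) (M : lmodType A) (a : nat) : Prop :=
  exists2 N : lmodType A,
    isomorphic M ('rV[A]_a * N)%type & no_free_summand N.

(* [K : K^p] = m: g is a basis of K over its subfield K^p. *)
Definition degree_over_pth_powers (p : nat) (K : fieldType) (m : nat) : Prop :=
  exists g : 'I_m -> K, forall x, exists! c : {ffun 'I_m -> K},
    (forall i, exists y, c i = y ^+ p) /\ x = \sum_i c i * g i.

Definition prime_ideal (A : comNzRingType) (P : ideal A) : Prop :=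
  (1 : A) \notin P /\
  forall x y : A, x * y \in P -> x \in P \/ y \in P.

Definition prime_chain (A : comNzRingType) (d : nat) (P : nat -> ideal A) :
    Prop :=
  (forall i, (i <= d)%N -> prime_ideal (P i)) /\
  forall i, (i < d)%N -> {subset P i <= P i.+1} /\ ~ P i =i P i.+1.

Definition krull_dim (A : comNzRingType) (d : nat) : Prop :=
  (exists P, @prime_chain A d P) /\
  forall d' P, @prime_chain A d' P -> (d' <= d)%N.

Definition is_F_signature (RR : realType) (p : nat) (S : localRing) (s : RR) :
    Prop :=
  exists (chS : p \in [pchar S]) (d m : nat) (a : nat -> nat),
    [/\ krull_dim S d,
        degree_over_pth_powers p (residue S) m,
        forall e, free_rank (frob_push chS e) (a e)
      & let alpha := ln (m%:R : RR) / ln p%:R in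
        ((fun e => (a e)%:R / (p ^ e)%:R `^ (d%:R + alpha)) @ \oo --> s)%classic].

Definition reduced (A : comNzRingType) : Prop :=
  forall (x : A) (n : nat), x ^+ n = 0 -> x = 0.

Definition noetherian (A : comNzRingType) : Prop :=
  forall I : ideal A, finite_module (submod_type I).

Definition graded_ring (A : comNzRingType) (A_ : nat -> {pred A}) : Prop :=
  [/\ forall n, zmod_closed (A_ n),
      1 \in A_ 0%N,
      forall m n x y, x \in A_ m -> y \in A_ n -> x * y \in A_ (m + n)%N,
      forall x, exists (n : nat) (c : nat -> A),
        (forall i, c i \in A_ i) /\ x = \sum_(i < n) c i
    & forall (n : nat) (c : nat -> A),
        (forall i, c i \in A_ i) -> \sum_(i < n) c i = 0 ->
        forall i, (i < n)%N -> c i = 0].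

Definition irrelevant (A : comNzRingType) (A_ : nat -> {pred A}) : set A :=
  [set x | exists (n : nat) (c : nat -> A),
     (forall i, c i \in A_ i.+1) /\ x = \sum_(i < n) c i].

(* f identifies B with the localization of A at the prime ideal m. *)
Definition is_localization_at (A B : comNzRingType) (m : set A)
    (f : {rmorphism A -> B}) : Prop :=
  [/\ forall s, ~ m s -> exists y, f s * y = 1,
      forall b, exists a s, ~ m s /\ b * f s = f a
    & forall a, f a = 0 -> exists2 s, ~ m s & s * a = 0].

(* Main.v *)
Require Import Defs.
From HB Require Import structures.
From mathcomp Require Import all_boot all_order all_algebra.
From mathcomp Require Import all_classical all_reals all_analysis.

From mathcomp Require Import ring zify.

Set Implicit Arguments.
Unset Strict Implicit.
Unset Printing Implicit Defensive.

Import Order.TTheory GRing.Theory Num.Theory.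

Local Open Scope ring_scope.

(** For the F-signature, let I_e be the ideal of the elements of R_m whose
p^e-th root generates no free summand.  The free rank a_e of the e-th Frobenius
pushforward is the dimension of R_m / I_e for the action of k through p^e-th
powers, and p-th powers carry I_e into I_(e+1).  A generic presentation of R
over R^p by m p^d elements, m = [k : k^p] and d = dim R_m, then gives
a_(e+1) <= m p^d a_e + O(m^e p^(e(d-1))), so that a_e / (m p^d)^e is
nonincreasing up to a summable error.  That m p^d elements suffice is a count:
r elements independent over p-th powers give r^j elements of degree O(p^j)
independent over p^j-th powers, while the elements of degree at most n span a
space of dimension O(n^d).

For Condition (B), take E' to be the annihilator in E of the elements of degree
greater than N.  Both kernels are generated by 1 (x) u, so it suffices that
s (x) u vanishes in F^e(E') as soon as it vanishes in F^e(E).  By Matlis duality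
a functional on F^e(E') which does not kill s (x) u is a p^e-linear map from R
to R / R_(>N); a homogeneous part of it lifts to a p^e-linear map R -> R, which
detects s (x) u in F^e(E).  The lift exists for N independent of e because R,
being a finitely presented quotient of a polynomial ring P over k, has
relations over P^(p^e) in degrees O(p^e), while P is free over P^(p^e). *)

(** * Ideals and noetherian induction *)

(** R may fail to be a domain or equidimensional. The generic rank is therefore bounded modulo each
    prime of an irredundant family of homogeneous primes with zero intersection, which is where
    reducedness enters. Dimension is measured by chains of homogeneous primes: they localize to
    chains in R_m, and prime avoidance turns the bound on them into d homogeneous parameters, whence
    the growth O(n^d). The generic presentation fails only modulo an ideal J; a homogeneous prime
    over J lies strictly above some prime of the family, so R / J needs one parameter fewer. This is
    the exponent d - 1 of the error.

    In Condition (B) the obstacle is uniformity in e. Put q = p^e. Relations of P generated in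
    weight at most delta are generated over P^q by their multiples by monomials with exponents below
    q, hence in weight at most q (sum of the degrees of the generators + delta). A map known modulo
    R_(>N) has a homogeneous part that is exactly q-linear in degrees up to q N, so N = sum of
    degrees + delta serves every e. P itself is encoded by inductive relations pairing the value in
    R of a formal combination of monomials with the value of the lift. *)

Section Ideals.
Variable A : comNzRingType.

Definition is_ideal (I : set A) : Prop :=
  [/\ I 0, forall x y, I x -> I y -> I (x + y) & forall a x, I x -> I (a * x)].

Lemma is_ideal_sum (I : set A) (T : finType) (P : pred T) (F : T -> A) :
  is_ideal I -> (forall t, P t -> I (F t)) -> I (\sum_(t | P t) F t).
Proof. by case=> I0 ID _ IF; exact: (big_ind I I0 ID IF). Qed.

Lemma is_idealN (I : set A) x : is_ideal I -> I x -> I (- x).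
Proof. by case=> _ _ IM Ix; rewrite -mulN1r; apply: IM. Qed.

Lemma is_idealB (I : set A) x y : is_ideal I -> I x -> I y -> I (x - y).
Proof. by move=> idI Ix Iy; case: (idI) => _ ID _; apply: ID => //; apply: is_idealN. Qed.

Lemma is_idealMr (I : set A) x a : is_ideal I -> I x -> I (x * a).
Proof. by case=> _ _ IM Ix; rewrite mulrC; apply: IM. Qed.

Lemma is_ideal1 (I : set A) : is_ideal I -> I 1 -> forall x, I x.
Proof. by case=> _ _ IM I1 x; rewrite -[x]mulr1; apply: IM. Qed.

Definition is_prime (P : set A) : Prop :=
  [/\ is_ideal P, ~ P 1 & forall x y, P (x * y) -> P x \/ P y].

Lemma is_primeX (P : set A) x n : is_prime P -> P (x ^+ n) -> P x.
Proof.
case=> _ P1 PM; elim: n => [|n IHn]; first by rewrite expr0.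
by rewrite exprS => /PM[].
Qed.

Lemma is_primeNM (P : set A) x y : is_prime P -> ~ P x -> ~ P y -> ~ P (x * y).
Proof. by case=> _ _ PM Px Py /PM[]. Qed.

Lemma is_prime_prod (P : set A) (T : finType) (F : T -> A) :
  is_prime P -> (forall t, ~ P (F t)) -> ~ P (\prod_t F t).
Proof.
move=> pP PF; apply: (big_ind (fun x => ~ P x)) => //; first by case: pP.
by move=> x y; apply: is_primeNM.
Qed.

Lemma ideal_submod_closed (I : set A) :
  is_ideal I -> submod_closed (fun x : A^o => `[< I x >]).
Proof.
case=> I0 ID IM; split=> [|a x y]; first exact/asboolP.
by move=> /asboolP Ix /asboolP Iy; apply/asboolP/ID => //; apply: IM.
Qed.

Definition ideal_of (I : set A) (idI : is_ideal I) : ideal A :=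
  Submodule (ideal_submod_closed idI).

Lemma ideal_ofE (I : set A) (idI : is_ideal I) x : (x \in ideal_of idI) <-> I x.
Proof. by split=> /asboolP. Qed.

Definition is_fg (I : set A) : Prop :=
  exists (T : finType) (g : T -> A), (forall t, I (g t)) /\
    forall x, I x -> exists c : T -> A, x = \sum_t c t * g t.

Hypothesis noethA : noetherian A.

Lemma noetherian_fg (I : set A) : is_ideal I -> is_fg I.
Proof.
move=> idI; have [n [g gP]] := noethA (ideal_of idI).
exists 'I_n, (fun i => val (g i) : A); split=> [t|x Ix].
  exact/ideal_ofE/(valP (g t)).
have Ix' : (x : A^o) \in ideal_of idI by apply/ideal_ofE.
have [c cP] := gP (exist _ (x : A^o) Ix'); exists c.
move/(congr1 (submod_incl (N := ideal_of idI))): cP.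
rewrite linear_sum {1}/submod_incl /= => ->.
by apply: eq_bigr => i _; rewrite linearZ.
Qed.

(** A counterexample would have a strictly larger one, and so on forever; the union of this chain is
    finitely generated, hence equal to one of its members. *)
Lemma noetherian_ind (Q : set A -> Prop) :
  (forall J, is_ideal J ->
     (forall J', is_ideal J' -> (J `<=` J')%classic -> ~ (J' `<=` J)%classic ->
        Q J') -> Q J) ->
  forall J, is_ideal J -> Q J.
Proof.
move=> QJ J0 idJ0; apply: contrapT => QJ0.
pose B := {J : set A | is_ideal J /\ ~ Q J}.
have step (b : B) : exists b' : B,
    (sval b `<=` sval b')%classic /\ ~ (sval b' `<=` sval b)%classic.
  case: b => J [idJ nQ] /=; apply: contrapT => H; apply: nQ; apply: QJ => // J' idJ' JJ' J'J.
  by apply: contrapT => nQ'; apply: H; exists (exist _ J' (conj idJ' nQ')).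
pose nx b := sval (cid (step b)).
pose C n := sval (iter n nx (exist _ J0 (conj idJ0 QJ0))).
have Cid n : is_ideal (C n) by rewrite /C; case: (iter _ _ _) => J [].
have CS n : (C n `<=` C n.+1)%classic /\ ~ (C n.+1 `<=` C n)%classic.
  by rewrite /C /= /nx; case: (cid _).
have Cle m n : (m <= n)%N -> (C m `<=` C n)%classic.
  elim: n => [|n IHn]; first by rewrite leqn0 => /eqP->.
  rewrite leq_eqVlt => /orP[/eqP-> //|/IHn H x /H]; exact: (CS n).1.
pose U : set A := fun x => exists n, C n x.
have idU : is_ideal U.
  split; first by exists 0%N; case: (Cid 0%N).
  - move=> x y [m Cx] [n Cy]; exists (maxn m n).
    case: (Cid (maxn m n)) => _ + _; apply.
      by apply: Cle Cx; rewrite leq_maxl.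
    by apply: Cle Cy; rewrite leq_maxr.
  - by move=> a x [n Cx]; exists n; case: (Cid n) => _ _; apply.
have [T [g [Ug gP]]] := noetherian_fg idU.
pose N := \max_t sval (cid (Ug t)).
case: (CS N) => _; apply=> x Cx.
have [|c ->] := gP x; first by exists N.+1.
apply: is_ideal_sum => // t _; case: (Cid N) => _ _; apply.
by apply: (Cle _ _ (leq_bigmax t)); apply: (svalP (cid (Ug t))).
Qed.

(** Induction on n: the first coordinates of Z form a finitely generated ideal, and subtracting
    lifts of its generators leaves vectors of Z with first coordinate zero. *)
Lemma noetherian_fg_submodule (n : nat) (Z : set ('I_n -> A)) :
  Z (fun=> 0) -> (forall v w, Z v -> Z w -> Z (fun i => v i + w i)) ->
  (forall a v, Z v -> Z (fun i => a * v i)) ->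
  exists (T : finType) (g : T -> 'I_n -> A), (forall t, Z (g t)) /\
    forall v, Z v -> exists c : T -> A, forall i, v i = \sum_t c t * g t i.
Proof.
elim: n Z => [|n IHn] Z Z0 ZD ZM.
  exists unit, (fun _ _ => 0); split=> //.
  by move=> v _; exists (fun=> 0); case.
pose I : set A := fun x => exists2 v, Z v & v ord0 = x.
have idI : is_ideal I.
  split; first by exists (fun=> 0).
  - by move=> x y [v Zv <-] [w Zw <-]; exists (fun i => v i + w i) => //; apply: ZD.
  - by move=> a x [v Zv <-]; exists (fun i => a * v i) => //; apply: ZM.
have [T [g [Ig gP]]] := noetherian_fg idI.
pose z t := s2val (cid2 (Ig t)).
have Zz t : Z (z t) by rewrite /z; case: (cid2 _).
have z0 t : z t ord0 = g t by rewrite /z; case: (cid2 _).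
pose ext (w : 'I_n -> A) (i : 'I_n.+1) := if unlift ord0 i is Some j then w j else 0.
have [||a v|T' [g' [Zg' gP']]] := IHn (fun w => Z (ext w)).
- suff -> : ext (fun=> 0) = fun=> 0 by [].
  by apply: funext => i; rewrite /ext; case: unlift.
- move=> v w /ZD H /H; congr Z.
  by apply: funext => i; rewrite /ext; case: unlift => //; rewrite addr0.
- move=> /(ZM a); congr Z.
  by apply: funext => i; rewrite /ext; case: unlift => //; rewrite mulr0.
have Zsum (S : finType) (c : S -> A) (h : S -> 'I_n.+1 -> A) :
    (forall s, Z (h s)) -> Z (fun i => \sum_s c s * h s i).
  move=> Zh; elim: (index_enum S) => [|s l IHl].
    by move: Z0; congr Z; apply: funext => i; rewrite big_nil.
  have := ZD _ _ (ZM (c s) _ (Zh s)) IHl; congr Z.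
  by apply: funext => i; rewrite big_cons.
exists (T + T')%type, (fun s => match s with inl t => z t | inr t => ext (g' t) end).
split; first by case.
move=> v Zv; have [|c cP] := gP (v ord0); first by exists v.
pose w i := v i - \sum_t c t * z t i.
have Zw : Z w.
  have := ZD _ _ Zv (ZM (-1) _ (Zsum _ c z Zz)); congr Z.
  by apply: funext => i; rewrite mulN1r.
have [|c' c'P] := gP' (fun j => w (lift ord0 j)).
  move: Zw; congr Z; apply: funext => i; rewrite /ext.
  case: unliftP => [j -> //|->]; rewrite /w cP; apply/eqP; rewrite subr_eq0.
  by apply/eqP/eq_bigr => t _; rewrite z0.
exists (fun s => match s with inl t => c t | inr t => c' t end) => i.
rewrite big_sumType /=.
have -> : \sum_t c' t * ext (g' t) i = w i.
  rewrite /ext; case: unliftP => [j ->|->]; first by rewrite c'P.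
  rewrite big1 => [|t _]; last by rewrite mulr0.
  by rewrite /w cP; apply/esym/eqP; rewrite subr_eq0; apply/eqP/eq_bigr => t _; rewrite z0.
by rewrite /w addrC subrK.
Qed.
End Ideals.

(** * Graded rings and homogeneous primes *)

Section Graded.
Variables (R : comNzRingType) (R_ : nat -> {pred R}).

(* The family of homogeneous components of an element, chosen independently of
   the proof that the family [R_] is a grading. *)
Definition hc_family (x : R) : nat -> R :=
  xget (fun=> 0) [set c : nat -> R | (forall i, c i \in R_ i) /\
    exists n, x = \sum_(i < n) c i /\ forall i, (n <= i)%N -> c i = 0].

Definition hc (i : nat) (x : R) : R := hc_family x i.

Hypothesis gradedR : graded_ring R_.

Lemma graded0 i : 0 \in R_ i.
Proof. by case: gradedR => /(_ i)[]. Qed.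

Lemma gradedB i x y : x \in R_ i -> y \in R_ i -> x - y \in R_ i.
Proof. by case: gradedR => /(_ i)[_ +] _ _ _ _; apply. Qed.

Lemma gradedN i x : x \in R_ i -> - x \in R_ i.
Proof. by move=> Rx; rewrite -sub0r; apply: gradedB => //; apply: graded0. Qed.

Lemma gradedD i x y : x \in R_ i -> y \in R_ i -> x + y \in R_ i.
Proof. by move=> Rx Ry; rewrite -[y]opprK; apply: gradedB => //; apply: gradedN. Qed.

Lemma gradedM i j x y : x \in R_ i -> y \in R_ j -> x * y \in R_ (i + j)%N.
Proof. by case: gradedR => _ _ + _ _; apply. Qed.

Lemma graded1 : 1 \in R_ 0%N.
Proof. by case: gradedR. Qed.

Lemma gradedX i x n : x \in R_ i -> x ^+ n \in R_ (i * n)%N.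
Proof.
move=> Rx; elim: n => [|n IHn]; first by rewrite muln0 expr0 graded1.
by rewrite mulnS exprS; apply: gradedM.
Qed.

Lemma sum_wide n N (c : nat -> R) : (n <= N)%N ->
  (forall i, (n <= i)%N -> c i = 0) -> \sum_(i < n) c i = \sum_(i < N) c i.
Proof.
move=> nN c0; rewrite -!(big_mkord xpredT) [RHS](big_cat_nat (n := n)) //=.
rewrite [X in _ = _ + X]big1_seq ?addr0 // => i.
by rewrite mem_index_iota => /andP[_ /andP[/c0]].
Qed.

Lemma hc_subproof x : (forall i, hc i x \in R_ i) /\
  exists n, x = \sum_(i < n) hc i x /\ forall i, (n <= i)%N -> hc i x = 0.
Proof.
rewrite /hc /hc_family; case: xgetP => [c _ //|noc]; exfalso.
case: gradedR => _ _ _ /(_ x)[n [c [Rc xE]]] _.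
apply: (noc (fun i => if (i < n)%N then c i else 0)); split.
  by move=> i; case: ifP => // _; apply: graded0.
exists n; split; first by rewrite xE; apply: eq_bigr => i _; rewrite ltn_ord.
by move=> i; rewrite leqNgt => /negbTE->.
Qed.

Lemma hc_in i x : hc i x \in R_ i.
Proof. exact: (hc_subproof x).1. Qed.

Lemma hc_bound x : exists n, forall N, (n <= N)%N ->
  x = \sum_(i < N) hc i x /\ forall i, (N <= i)%N -> hc i x = 0.
Proof.
case: (hc_subproof x) => _ [n [xE x0]]; exists n => N nN; split.
  by rewrite {1}xE; apply: (sum_wide (c := fun i => hc i x)).
by move=> i Ni; apply: x0; apply: leq_trans nN Ni.
Qed.

Lemma hc_uniq x (c : nat -> R) n : (forall i, c i \in R_ i) ->
  x = \sum_(i < n) c i -> forall i, hc i x = if (i < n)%N then c i else 0.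
Proof.
move=> Rc xE i; have [n' /(_ (maxn n' n) (leq_maxl _ _)) [xE' x0]] := hc_bound x.
pose c' i := if (i < n)%N then c i else 0.
have xc' : x = \sum_(i < maxn n' n) c' i.
  rewrite xE -(sum_wide (n := n)) ?leq_maxr //.
    by apply: eq_bigr => j _; rewrite /c' ltn_ord.
  by move=> j; rewrite /c' leqNgt => /negbTE->.
have [iN|Ni] := ltnP i (maxn n' n); last first.
  by rewrite x0 // ltnNge (leq_trans (leq_maxr _ _) Ni).
case: gradedR => _ _ _ _ uniq; apply/eqP; rewrite -subr_eq0; apply/eqP.
apply: (uniq (maxn n' n) (fun i => hc i x - c' i)) => //.
  move=> j; apply: gradedB; first exact: hc_in.
  by rewrite /c'; case: ifP => // _; apply: graded0.
by rewrite sumrB -xE' -xc' subrr.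
Qed.

Lemma hcD i x y : hc i (x + y) = hc i x + hc i y.
Proof.
have [n nP] := hc_bound x; have [n' n'P] := hc_bound y.
have [xE x0] := nP _ (leq_maxl n n'); have [yE y0] := n'P _ (leq_maxr n n').
rewrite (@hc_uniq (x + y) (fun i => hc i x + hc i y) (maxn n n')).
- by case: ltnP => // Ni; rewrite x0 // y0 // addr0.
- by move=> j; apply/gradedD; apply: hc_in.
- by rewrite big_split /= -xE -yE.
Qed.

Lemma hc0 i : hc i 0 = 0.
Proof. by apply: (addrI (hc i 0)); rewrite -hcD !addr0. Qed.

Lemma hcN i x : hc i (- x) = - hc i x.
Proof. by apply: (addrI (hc i x)); rewrite -hcD !subrr hc0. Qed.

Lemma hcB i x y : hc i (x - y) = hc i x - hc i y.
Proof. by rewrite hcD hcN. Qed.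

Lemma hc_sum i (T : Type) (s : seq T) (P : pred T) (F : T -> R) :
  hc i (\sum_(t <- s | P t) F t) = \sum_(t <- s | P t) hc i (F t).
Proof. by apply: (big_morph (hc i)) => [x y|]; rewrite ?hcD ?hc0. Qed.

Lemma hc_hom i j x : x \in R_ j -> hc i x = if i == j then x else 0.
Proof.
move=> Rx; pose c l := if l == j then x else 0.
rewrite (@hc_uniq x c j.+1).
- by rewrite /c; case: eqP => [->|_]; rewrite ?leqnn // if_same.
- by move=> l; rewrite /c; case: eqP => [->|_] //; apply: graded0.
- by rewrite big_ord_recr /= {2}/c eqxx big1 ?add0r // => l _; rewrite /c ltn_eqF.
Qed.

Lemma hc_eq0 x : (forall i, hc i x = 0) -> x = 0.
Proof.
by move=> x0; have [n /(_ n (leqnn _))[-> _]] := hc_bound x; rewrite big1.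
Qed.

Lemma hc_Ml i a l x : a \in R_ i ->
  hc l (a * x) = if (i <= l)%N then a * hc (l - i) x else 0.
Proof.
move=> Ra; have [n /(_ n (leqnn _))[xE x0]] := hc_bound x.
pose c l := if (i <= l)%N then a * hc (l - i) x else 0.
rewrite (@hc_uniq (a * x) c (i + n)%N).
- rewrite /c; case: (leqP i l) => il; last by rewrite if_same.
  by case: ltnP => // inl; rewrite x0 ?mulr0 // leq_subRL.
- move=> j; rewrite /c; case: leqP => [ij|_]; last exact: graded0.
  by rewrite -{2}(subnKC ij); apply: gradedM => //; apply: hc_in.
- rewrite {1}xE mulr_sumr big_split_ord /= [X in _ = X + _]big1 ?add0r.
    by apply: eq_bigr => j _; rewrite /c leq_addr addKn.
  by move=> j _; rewrite /c leqNgt ltn_ord.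
Qed.

Lemma hc_Mr i a l x : a \in R_ i ->
  hc l (x * a) = if (i <= l)%N then hc (l - i) x * a else 0.
Proof. by move=> Ra; rewrite mulrC (hc_Ml _ _ Ra); case: ifP => // _; rewrite mulrC. Qed.

Lemma hcM n x y : hc n (x * y) = \sum_(i < n.+1) hc i x * hc (n - i) y.
Proof.
have [N /(_ (maxn N n.+1) (leq_maxl _ _))[xE x0]] := hc_bound x.
rewrite {1}xE mulr_suml hc_sum.
rewrite [RHS](eq_bigr (fun i : 'I_n.+1 => hc n (hc i x * y))); last first.
  by move=> i _; rewrite (hc_Ml _ _ (hc_in i x)) -ltnS ltn_ord.
apply/esym/(sum_wide (c := fun i => hc n (hc i x * y))); first exact: leq_maxr.
by move=> i ni; rewrite (hc_Ml _ _ (hc_in i x)) leqNgt ni.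
Qed.

Lemma hc0M x y : hc 0 (x * y) = hc 0 x * hc 0 y.
Proof. by rewrite hcM big_ord1. Qed.

Lemma hc01 : hc 0 1 = 1.
Proof. by rewrite (hc_hom _ graded1). Qed.

Lemma hc0X x n : hc 0 (x ^+ n) = hc 0 x ^+ n.
Proof. by elim: n => [|n IHn]; rewrite ?expr0 ?hc01 // !exprS hc0M IHn. Qed.

Definition hideal (J : set R) : Prop :=
  is_ideal J /\ forall x i, J x -> J (hc i x).

Definition hprime (P : set R) : Prop :=
  is_prime P /\ forall x i, P x -> P (hc i x).

Lemma hideal_all (J : set R) x : is_ideal J -> (forall i, J (hc i x)) -> J x.
Proof.
move=> idJ Jx; have [n /(_ n (leqnn _))[-> _]] := hc_bound x.
by apply: is_ideal_sum.
Qed.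

Lemma hideal_notin (J : set R) x : is_ideal J -> ~ J x ->
  exists i, ~ J (hc i x).
Proof.
by move=> idJ Jx; apply: contrapT => /forallNP H; apply: Jx; apply: hideal_all => // i; apply: contrapT; apply: H.
Qed.

(** For x and y outside J take the components of least degree i and j outside J. In degree i + j of
    [x * y], every term other than their product has a factor of smaller degree, which lies in J. *)
Lemma hideal_prime (J : set R) : hideal J -> ~ J 1 ->
  (forall i j x y, x \in R_ i -> y \in R_ j -> J (x * y) -> J x \/ J y) ->
  hprime J.
Proof.
move=> [idJ hJ] J1 JM; split=> //; split=> // x y Jxy; apply: contrapT => /not_orP[Jx Jy].
have lowest z : ~ J z -> exists i, ~ J (hc i z) /\ forall j, (j < i)%N -> J (hc j z).
  move=> /(hideal_notin idJ) ex; have [|i /asboolP Pi iP] := @ex_minnP (fun i => `[< ~ J (hc i z) >]).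
    by case: ex => i Pi; exists i; apply/asboolP.
  exists i; split=> // j ji; apply: contrapT => Pj.
  have Pj' : `[< ~ J (hc j z) >] by apply/asboolP.
  by have := iP j Pj'; rewrite leqNgt ji.
have [i [Ji Jlti]] := lowest x Jx; have [j [Jj Jltj]] := lowest y Jy.
have := hJ _ (i + j)%N Jxy; rewrite hcM (bigD1 (inord i)) //=.
rewrite !inordK ?ltnS ?leq_addr // addKn => Jsum.
suff Jij : J (hc i x * hc j y) by case: (JM _ _ _ _ (hc_in i x) (hc_in j y) Jij).
rewrite -[X in J X](addrK (\sum_(l < (i + j).+1 | l != inord i) hc l x * hc (i + j - l) y)).
apply: is_idealB => //; apply: is_ideal_sum => // l neq.
have [li|il] := ltnP l i; first by apply: is_idealMr => //; apply: Jlti.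
case: (idJ) => _ _ IM; apply/IM/Jltj.
have : (i < l)%N.
  rewrite ltn_neqAle il andbT; apply: contra neq => /eqP E.
  by apply/eqP/val_inj; rewrite /= inordK ?ltnS ?leq_addr.
by move: (ltn_ord l); lia.
Qed.

(** The ideal J + R a. *)
Definition addI (J : set R) (a : R) : set R := [set x | exists r, J (x - r * a)].

Lemma addI_ideal J a : is_ideal J -> is_ideal (addI J a).
Proof.
move=> idJ; case: (idJ) => J0 JD JM; split.
- by exists 0; rewrite mul0r subr0.
- move=> x y [r Jx] [r' Jy]; exists (r + r'); rewrite mulrDl opprD addrACA.
  exact: JD.
- by move=> b x [r Jx]; exists (b * r); rewrite -mulrA -mulrBr; apply: JM.
Qed.

Lemma addI_hideal J a n : hideal J -> a \in R_ n -> hideal (addI J a).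
Proof.
move=> [idJ hJ] Ra; split; first exact: addI_ideal.
move=> x i [r Jx]; exists (if (n <= i)%N then hc (i - n) r else 0).
have := hJ _ i Jx; rewrite hcB (hc_Mr _ _ Ra).
by case: ifP => // _; rewrite mul0r.
Qed.

Lemma addI_sub J a : is_ideal J -> (J `<=` addI J a)%classic.
Proof. by move=> idJ x Jx; exists 0; rewrite mul0r subr0. Qed.

Lemma addI_gen J a : is_ideal J -> addI J a a.
Proof. by case=> J0 _ _; exists 1; rewrite mul1r subrr. Qed.

Hypothesis noethR : noetherian R.

(** If J is not prime, homogeneous a, b outside J with a b in J give (J + R a)(J + R b) inside J,
    and the two decompositions are concatenated. Products over a family with possible repetitions
    take the place of radicals and multiplicities. *)
Lemma hprime_decomposition J : hideal J ->
  exists (T : finType) (Q : T -> set R),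
    (forall t, hprime (Q t) /\ (J `<=` Q t)%classic) /\
    forall x : T -> R, (forall t, Q t (x t)) -> J (\prod_t x t).
Proof.
case=> idJ; move: J idJ; apply: (noetherian_ind noethR) => J idJ IH hJ.
have [J1|J1] := EM (J 1).
  by exists void, (fun=> J); split=> [[]|x _]; apply: is_ideal1.
have [pJ|npJ] := EM (hprime J).
  exists unit, (fun=> J); split=> [t|x Jx]; first by split.
  by rewrite (bigD1 tt) //= big1 ?mulr1 // => -[].
have [i [j [a [b [Ra Rb Jab Ja Jb]]]]] : exists i j a b,
    [/\ a \in R_ i, b \in R_ j, J (a * b), ~ J a & ~ J b].
  apply: contrapT => H; apply: npJ; apply: hideal_prime => // i j a b Ra Rb Jab.
  by apply: contrapT => /not_orP[Ja Jb]; apply: H; exists i, j, a, b; split.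
have sub c n : c \in R_ n -> ~ J c -> exists (T : finType) (Q : T -> set R),
    (forall t, hprime (Q t) /\ (addI J c `<=` Q t)%classic) /\
    forall x : T -> R, (forall t, Q t (x t)) -> addI J c (\prod_t x t).
  move=> Rc Jc; have [idJc hJc] := addI_hideal (conj idJ hJ) Rc.
  apply: IH => //; first exact: addI_sub.
  by move/(_ c (addI_gen c idJ)).
have [T [Q [QP QJ]]] := sub a i Ra Ja; have [T' [Q' [QP' QJ']]] := sub b j Rb Jb.
exists (T + T')%type, (fun s => match s with inl t => Q t | inr t => Q' t end); split.
  by case=> t; [have [? H] := QP t | have [? H] := QP' t]; split=> //;
    apply: subset_trans H; apply: addI_sub.
move=> x Qx; rewrite big_sumType /=.
have [r Jr] := QJ (fun t => x (inl t)) (fun t => Qx (inl t)).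
have [r' Jr'] := QJ' (fun t => x (inr t)) (fun t => Qx (inr t)).
set u := \prod_t _ in Jr *; set v := \prod_t _ in Jr' *.
have -> : u * v = v * (u - r * a) + r * a * (v - r' * b) + r * r' * (a * b) by ring.
case: (idJ) => _ JD JM.
exact: (JD _ _ (JD _ _ (JM _ _ Jr) (JM _ _ Jr')) (JM _ _ Jab)).
Qed.

End Graded.

(** * Homogeneous systems of parameters *)

Section HomogeneousParams.
Variables (R : comNzRingType) (R_ : nat -> {pred R}).
Hypotheses (gr : graded_ring R_) (noethR : noetherian R).
Hypothesis R0_unit : forall x, x \in R_ 0%N -> x != 0 -> exists y, x * y = 1.

Local Notation hc := (hc R_).

Definition irr : set R := [set x | hc 0 x = 0].

Definition zeroI : set R := [set x | x = 0].

Lemma zeroI_hideal : hideal R_ zeroI.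
Proof.
split; first split=> //.
- by move=> x y -> ->; rewrite /zeroI /= addr0.
- by move=> a x ->; rewrite /zeroI /= mulr0.
- by move=> x i ->; rewrite /zeroI /= (hc0 gr).
Qed.

Lemma irr_hprime : hprime R_ irr.
Proof.
apply: hideal_prime => //.
- split; first split.
  + by rewrite /irr /= (hc0 gr).
  + by move=> x y; rewrite /irr /= (hcD gr) => -> ->; rewrite addr0.
  + by move=> a x; rewrite /irr /= (hc0M gr) => ->; rewrite mulr0.
  + move=> x i; rewrite /irr /= (hc_hom gr _ (hc_in gr i x)).
    by case: eqP => [<-|].
- by rewrite /irr /= (hc01 gr); apply/eqP; rewrite oner_eq0.
- move=> i j x y _ _; rewrite /irr /= (hc0M gr).
  have [->|x0] := eqVneq (hc 0 x) 0; first by left.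
  have [u xu] := R0_unit (hc_in gr 0 x) x0; move=> xy0; right.
  by rewrite -[hc 0 y]mul1r -xu mulrAC xy0 mul0r.
Qed.

Lemma irr_ideal : is_ideal irr.
Proof. by case: irr_hprime => -[]. Qed.

Lemma irr_hom i x : (0 < i)%N -> x \in R_ i -> irr x.
Proof. by move=> i0 Rx; rewrite /irr /= (hc_hom gr _ Rx) ltn_eqF. Qed.

Lemma hprime_sub_irr P : hprime R_ P -> (P `<=` irr)%classic.
Proof.
move=> [[idP P1 _] hP] x Px; rewrite /irr /=; apply/eqP/negP => /negP x0.
have [u xu] := R0_unit (hc_in gr 0 x) x0.
by apply: P1; rewrite -xu; apply: is_idealMr => //; apply: hP.
Qed.

Lemma prime_over_decomposition (T : finType) (Q : T -> set R) (J P : set R) :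
  (forall x : T -> R, (forall t, Q t (x t)) -> J (\prod_t x t)) ->
  is_prime P -> (J `<=` P)%classic -> exists t, (Q t `<=` P)%classic.
Proof.
move=> QJ pP JP; apply: contrapT => /forallNP H.
have ex t : exists x, Q t x /\ ~ P x.
  by apply: contrapT => /forallNP H'; apply: (H t) => x Qx; apply: contrapT => Px; apply: (H' x).
apply: (is_prime_prod (F := fun t => sval (cid (ex t)))) pP _ _ => [t|].
  by case: (cid (ex t)) => x [].
by apply/JP/QJ => t; case: (cid (ex t)) => x [].
Qed.

Lemma hom_prod (T : finType) (F : T -> R) (dg : T -> nat) (B : {pred T}) :
  (forall t, t \in B -> F t \in R_ (dg t)) ->
  \prod_(t in B) F t \in R_ (\sum_(t in B) dg t)%N.
Proof.
move=> FR; apply: (big_rec2 (fun n x => x \in R_ n)); first exact: graded1.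
by move=> t n x tB Rx; apply: gradedM => //; apply: FR.
Qed.

(** Induction on a set of indices, first discarding primes contained in others. If x avoids all the
    primes but [Q t0], add an element w outside [Q t0] lying in all the others; the exponents in
    [x ^+ c + w ^+ a] equalize the degrees. *)
Lemma hprime_avoidance (T : finType) (Q : T -> set R) :
  (forall t, hprime R_ (Q t)) -> (forall t, ~ (irr `<=` Q t)%classic) ->
  exists n x, [/\ (0 < n)%N, x \in R_ n & forall t, ~ Q t x].
Proof.
move=> hQ nQ.
have pos t : exists n x, [/\ (0 < n)%N, x \in R_ n & ~ Q t x].
  apply: contrapT => H; apply: (nQ t) => x; rewrite /irr /= => x0.
  apply: (hideal_all gr); first by case: (hQ t) => -[].
  case=> [|i]; first by rewrite x0; case: (hQ t) => -[[]].
  by apply: contrapT => Qx; apply: H; exists i.+1, (hc i.+1 x); split=> //; apply: hc_in.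
suff H (B : {set T}) : exists n x, [/\ (0 < n)%N, x \in R_ n & forall t, t \in B -> ~ Q t x].
  have [n [x [n0 Rx xP]]] := H finset.setT; exists n, x; split=> // t; exact: xP.
have [m] := ubnP #|B|; elim: m B => // m IHm B Bm.
have [[t [t' [tB t'B tt' Qtt']]]|noincl] := EM (exists t t', [/\ t \in B, t' \in B,
    t != t' & (Q t `<=` Q t')%classic]).
  have [|n [x [n0 Rx xP]]] := IHm (B :\ t)%SET.
    by move: Bm; rewrite (cardsD1 t) tB.
  exists n, x; split=> // s sB; have [->|st] := eqVneq s t.
    by move=> /Qtt'; apply: xP; rewrite !inE eq_sym tt'.
  by apply: xP; rewrite !inE st.
have [->|[t0 t0B]] := set_0Vmem B.
  by exists 1%N, 0; split=> //; [exact: graded0|move=> t; rewrite inE].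
have [|a [x [a0 Rx xP]]] := IHm (B :\ t0)%SET.
  by move: Bm; rewrite (cardsD1 t0) t0B.
have [Qx|Qx] := EM (Q t0 x); last first.
  exists a, x; split=> // s sB; have [->//|st] := eqVneq s t0.
  by apply: xP; rewrite !inE st.
have [b0 [z [b00 Rz Qz]]] := pos t0.
have ex t : exists b y, t \in (B :\ t0)%SET -> [/\ y \in R_ b, Q t y & ~ Q t0 y].
  have [tB|tB] := boolP (t \in (B :\ t0)%SET); last by exists 0%N, 0.
  have [y [Qy nQy]] : exists y, Q t y /\ ~ Q t0 y.
    apply: contrapT => /forallNP H; apply: noincl; exists t, t0.
    move: tB; rewrite !inE => /andP[-> ->]; split=> // y Qy.
    by apply: contrapT => nQy; apply: (H y).
  have [|i nQi] := hideal_notin gr _ nQy; first by case: (hQ t0) => -[].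
  by exists i, (hc i y) => _; split=> //; [exact: hc_in|apply: (hQ t).2].
pose b t := sval (cid (ex t)); pose y t := sval (cid (svalP (cid (ex t)))).
have yP t : t \in (B :\ t0)%SET -> [/\ y t \in R_ (b t), Q t (y t) & ~ Q t0 (y t)].
  exact: (svalP (cid (svalP (cid (ex t))))).
pose w := z * \prod_(t in (B :\ t0)%SET) y t.
pose c := (b0 + \sum_(t in (B :\ t0)%SET) b t)%N.
have Rw : w \in R_ c.
  by apply: gradedM => //; apply: hom_prod => t /yP[].
have c0 : (0 < c)%N by rewrite addn_gt0 b00.
have nQw : ~ Q t0 w.
  apply: is_primeNM => //; first by case: (hQ t0).
  apply: (big_ind (fun x => ~ Q t0 x)); first by case: (hQ t0) => -[].
    by move=> u v; apply: is_primeNM; case: (hQ t0).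
  by move=> t /yP[].
have Qw t : t \in (B :\ t0)%SET -> Q t w.
  move=> tB; rewrite /w (bigD1 t) //= mulrCA.
  by apply: is_idealMr; [case: (hQ t) => -[]|case: (yP t tB)].
exists (a * c)%N, (x ^+ c + w ^+ a); split; first by rewrite muln_gt0 a0.
  by apply: gradedD => //; [exact: gradedX|rewrite mulnC; apply: gradedX].
move=> t tB; have [->|tt0] := eqVneq t t0 => Qs.
  apply: nQw; apply: (is_primeX (n := a)); first by case: (hQ t0).
  have idQ : is_ideal (Q t0) by case: (hQ t0) => -[].
  rewrite -[w ^+ a](addKr (x ^+ c)) addrC; apply: is_idealB => //.
  by rewrite -(prednK c0) exprS; apply: is_idealMr.
have tB0 : t \in (B :\ t0)%SET by rewrite !inE tt0.
apply: (xP t tB0); apply: (is_primeX (n := c)); first by case: (hQ t).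
have idQ : is_ideal (Q t) by case: (hQ t) => -[].
rewrite -[x ^+ c](addrK (w ^+ a)); apply: is_idealB => //.
by rewrite -(prednK a0) exprS; apply: is_idealMr => //; apply: Qw.
Qed.

(** For J zero and M = 1 these are homogeneous algebra generators over the degree zero part. For
    general M they generate, modulo J, an ideal containing all large degrees, as homogeneous
    parameters of R / J do. *)
Definition hom_gens (S : finType) (y : S -> R) (dg : S -> nat) (J : set R) (M : nat) :=
  (forall s, (0 < dg s)%N /\ y s \in R_ (dg s)) /\
  forall j r, (M <= j)%N -> r \in R_ j -> exists c : S -> R, J (r - \sum_s c s * y s).

Lemma hom_gens_coef (S : finType) (y : S -> R) dg J M : hideal R_ J ->
  hom_gens y dg J M -> forall j r, (M <= j)%N -> r \in R_ j ->
  exists c : S -> R, [/\ forall s, (dg s <= j)%N -> c s \in R_ (j - dg s)%N,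
    forall s, (j < dg s)%N -> c s = 0 & J (r - \sum_s c s * y s)].
Proof.
move=> [idJ hJ] [yP yJ] j r Mj Rr; have [c Jc] := yJ j r Mj Rr.
exists (fun s => if (dg s <= j)%N then hc (j - dg s) (c s) else 0); split.
- by move=> s ->; apply: hc_in.
- by move=> s; rewrite ltnNge => /negbTE->.
- have := hJ _ j Jc; rewrite (hcB gr) (hc_hom gr _ Rr) eqxx (hc_sum gr).
  congr (J (_ - _)); apply: eq_bigr => s _.
  by rewrite (hc_Mr gr _ _ (yP s).2); case: ifP => //; rewrite mul0r.
Qed.

Lemma exists_algebra_gens : exists (S : finType) (y : S -> R) (dg : S -> nat),
  hom_gens y dg zeroI 1.
Proof.
have [T [g [Ig gP]]] := noetherian_fg noethR irr_ideal.
pose bd t := sval (cid (hc_bound gr (g t))).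
pose D := \max_t bd t.
exists (T * 'I_D)%type, (fun ti : T * 'I_D => hc ti.2.+1 (g ti.1)),
  (fun ti : T * 'I_D => ti.2.+1).
split=> [s|j r j0 Rr]; first by split=> //; apply: hc_in.
have [c cP] := gP r (irr_hom j0 Rr); exists (fun ti : T * 'I_D => c ti.1); rewrite /zeroI /=.
apply/eqP; rewrite subr_eq0 cP; apply/eqP.
rewrite -(pair_bigA _ (fun t (i : 'I_D) => c t * hc i.+1 (g t))) /=; apply: eq_bigr => t _.
rewrite -mulr_sumr; congr (_ * _).
have [|gE _] := svalP (cid (hc_bound gr (g t))) D.+1.
  by apply: leqW; apply: (leq_bigmax t).
rewrite {1}gE big_ord_recl /=; have := Ig t; rewrite /irr /= => ->.
by rewrite add0r; apply: eq_bigr.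
Qed.

(* Homogeneous elements of large degree are sums of products of [c] elements of
   the irrelevant ideal. *)
Lemma deep_in_ideal (S : finType) (y : S -> R) dg c : hom_gens y dg zeroI 1 ->
  exists M, forall (J : set R) j r z, is_ideal J -> (M <= j)%N -> r \in R_ j ->
    (forall u : seq R, size u = c -> (forall x, x \in u -> irr x) ->
       J (z * \prod_(x <- u) x)) -> J (z * r).
Proof.
move=> yP; elim: c => [|c [M IHc]].
  exists 0%N => J j r z idJ _ _ /(_ [::]) Jz; apply: is_idealMr => //.
  by have := Jz erefl; rewrite big_nil mulr1; apply.
exists (M + \max_s dg s).+1 => J j r z idJ Mj Rr Jz.
have [|a [aR _ aE]] := hom_gens_coef zeroI_hideal yP _ Rr; first by apply: leq_trans Mj.
have -> : r = \sum_s a s * y s.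
  by apply/eqP; rewrite -subr_eq0; apply/eqP/aE.
rewrite mulr_sumr; apply: is_ideal_sum => // s _.
have dgj : (M + dg s <= j)%N.
  by apply: leq_trans (ltnW Mj); rewrite leq_add2l; apply: (leq_bigmax s).
rewrite [a s * _]mulrC mulrA; apply: (IHc J (j - dg s)%N) => //.
- by rewrite leq_subRL 1?addnC // (leq_trans _ dgj) // leq_addl.
- by apply: aR; apply: leq_trans dgj; rewrite leq_addl.
- move=> u uc ui; have := Jz (y s :: u); rewrite big_cons mulrA; apply.
    by rewrite /= uc.
  move=> x; rewrite inE => /orP[/eqP->|]; last exact: ui.
  by have [ds ys] := yP.1 s; apply: irr_hom ys.
Qed.

(** Here l counts the primes and not the inclusions: [~ hchain J d.+1] says that R / J has dimension
    less than d, as far as homogeneous primes can tell. *)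
Definition hchain (J : set R) (l : nat) : Prop := exists Q : nat -> set R,
  (forall i, (i < l)%N -> hprime R_ (Q i) /\ (J `<=` Q i)%classic) /\
  forall i, (i.+1 < l)%N -> (Q i `<=` Q i.+1)%classic /\ ~ (Q i.+1 `<=` Q i)%classic.

Lemma hchain_cons J J' P l : hprime R_ P -> (J' `<=` P)%classic ->
  (exists Q : nat -> set R,
  [/\ forall i, (i < l)%N -> hprime R_ (Q i) /\ (J `<=` Q i)%classic,
      forall i, (i.+1 < l)%N -> (Q i `<=` Q i.+1)%classic /\ ~ (Q i.+1 `<=` Q i)%classic
    & (0 < l)%N -> (P `<=` Q 0%N)%classic /\ ~ (Q 0%N `<=` P)%classic]) ->
  hchain J' l.+1.
Proof.
move=> hP J'P [Q [hQ QS Q0]].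
have PQ i : (i < l)%N -> (P `<=` Q i)%classic.
  elim: i => [|i IHi] il; first by case: Q0.
  apply: subset_trans (IHi (ltnW il)) _; exact: (QS i il).1.
exists (fun i => if i is j.+1 then Q j else P); split.
  case=> [|i] il //; split; first by case: (hQ i).
  exact: subset_trans (PQ i il).
case=> [|i] il; first exact: Q0.
exact: QS.
Qed.

Lemma no_hchain1 J : hideal R_ J -> ~ hchain J 1 -> forall x, J x.
Proof.
move=> hJ nch; have [T [Q [hQ QJ]]] := hprime_decomposition gr noethR hJ.
apply: is_ideal1; first by case: hJ.
have [t0|t0] := pickP T; last by have := QJ (fun=> 1); rewrite big_pred0 //; apply=> t; have := t0 t.
by case: nch; exists (fun=> Q t0).
Qed.

(** A homogeneous x outside every component prime that does not contain the irrelevant ideal lowers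
    the dimension. In dimension 0 all components contain the irrelevant ideal, so products of [#|T|]
    of its elements lie in J, and by [deep_in_ideal] so does everything of large degree. *)
Lemma exists_params n J : hideal R_ J -> ~ hchain J n.+2 ->
  exists (x : 'I_n -> R) (dg : 'I_n -> nat) (M : nat), hom_gens x dg J M.
Proof.
elim: n J => [|n IHn] J hJ nch; have [T [Q [hQ QJ]]] := hprime_decomposition gr noethR hJ.
  have irrQ t : (irr `<=` Q t)%classic.
    apply: contrapT => nQ; apply: nch; apply: (hchain_cons (J := irr)) (hQ t).1 (hQ t).2 _.
    exists (fun=> irr); split=> // [i _|_]; first by split=> //; exact: irr_hprime.
    by split=> //; apply: hprime_sub_irr; exact: (hQ t).1.
  have [S [y [dg yP]]] := exists_algebra_gens.
  have [M MP] := deep_in_ideal #|T| yP.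
  exists (fun=> 0), (fun=> 1%N), M; split=> [[]//|j r Mj Rr]; exists (fun=> 0).
  rewrite big_ord0 subr0 -[r]mul1r; apply: (MP _ j) => // [|u uT ui]; first by case: hJ.
  rewrite mul1r (big_nth 0) big_mkord uT.
  rewrite (reindex (fun t : T => enum_rank t)) /=; last first.
    by exists enum_val => i _; rewrite ?enum_rankK ?enum_valK.
  by apply: QJ => t; apply/irrQ/ui/mem_nth; rewrite uT.
pose B := [pred t | `[< ~ (irr `<=` Q t)%classic >]].
have [|| a [x [a0 Rx xP]]] := @hprime_avoidance {t | B t} (fun t => Q (val t)).
- by case=> t tB /=; case: (hQ t).
- by case=> t /= /asboolP.
have [|[Q' [hQ' Q'S]]|x' [dg [M [x'P x'J]]]] := IHn (addI J x).
- exact: addI_hideal Rx.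
- have idJ := hJ.1.
  have JQ0 : (J `<=` Q' 0%N)%classic.
    by apply: subset_trans (hQ' 0%N _).2 => //; apply: addI_sub.
  have [t QtQ'] : exists t, (Q t `<=` Q' 0%N)%classic.
    by apply: (prime_over_decomposition QJ) JQ0; case: (hQ' 0%N isT) => -[].
  (* Otherwise [Q' 0] contains the irrelevant ideal, which leaves no room for [Q' 1] strictly above
     it. *)
  have Bt : B t.
    apply/asboolP => irrQ; case: (Q'S 0%N isT) => _; apply.
    apply: subset_trans (subset_trans irrQ QtQ'); apply: hprime_sub_irr.
    by case: (hQ' 1%N isT).
  apply: nch; apply: (hchain_cons (J := addI J x)) (hQ t).1 (hQ t).2 _.
  exists Q'; split=> //.
  move=> _; split=> // H; apply: (xP (exist _ t Bt)); apply: H.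
  by apply: (hQ' 0%N isT).2; apply: addI_gen.
- exists (fun i => if unlift ord0 i is Some j then x' j else x).
  exists (fun i => if unlift ord0 i is Some j then dg j else a), M; split.
    by move=> s; case: unliftP => [j _|_] //; apply: x'P.
  move=> j r Mj Rr; have [c [b Jb]] := x'J j r Mj Rr.
  exists (fun i => if unlift ord0 i is Some j then c j else b).
  rewrite big_ord_recl unlift_none opprD addrA addrAC; move: Jb.
  congr (J (_ - _ - _)); by apply: eq_bigr => i _; rewrite liftK.
Qed.

End HomogeneousParams.

(** * Spans twisted by Frobenius *)

(** Taking powers makes the constant K harmless. The proof uses Bernoulli's inequality (1 + 1/N)^j
    >= 1 + j/N, cleared of denominators, at j = K N. *)
Lemma leq_of_expn_bound K N r : (forall j, r ^ j <= K * N ^ j)%N -> (r <= N)%N.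
Proof.
move=> rK; rewrite leqNgt; apply/negP => Nr.
have rK' j : (N.+1 ^ j <= K * N ^ j)%N.
  by apply: leq_trans (rK j); have [->|j0] := posnP j; rewrite ?expn0 ?leq_exp2r.
have [N0|N0] := posnP N; first by have := rK' 1%N; rewrite N0 !expn1 muln0.
have bern j : (N ^ j * (N + j) <= N * N.+1 ^ j)%N.
  elim: j => [|j IHj]; first by rewrite !expn0 mul1n muln1 addn0.
  rewrite !expnS; move: (N ^ j)%N (N.+1 ^ j)%N IHj => X Y IHj.
  have h1 : (X * (N * (N + j.+1)) <= X * (N.+1 * (N + j)))%N by rewrite leq_mul2l; apply/orP; right; nia.
  have h2 : (N.+1 * (X * (N + j)) <= N.+1 * (N * Y))%N by rewrite leq_mul2l IHj orbT.
  have -> : (N * X * (N + j.+1) = X * (N * (N + j.+1)))%N by ring.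
  have -> : (N * (N.+1 * Y) = N.+1 * (N * Y))%N by ring.
  by apply: leq_trans h1 (leq_trans _ h2); apply: eq_leq; ring.
have := leq_trans (bern (K * N)%N) (leq_mul (leqnn N) (rK' (K * N)%N)).
have -> : (N * (K * N ^ (K * N)) = N ^ (K * N) * (K * N))%N by ring.
by rewrite leq_pmul2l ?expn_gt0 ?N0 //; lia.
Qed.

Lemma leq_of_poly_bound C D s L : (forall n, n ^ L <= C * (D * n).+1 ^ s)%N -> (L <= s)%N.
Proof.
move=> H; rewrite leqNgt; apply/negP => sL.
(* This n exceeds the constant that remains once [n ^ s] is cancelled. *)
pose n := (C * D.+1 ^ s).+1.
have : (n ^ s.+1 <= C * (D.+1 * n) ^ s)%N.
  apply: leq_trans (leq_pexp2l _ sL) (leq_trans (H n) _) => //.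
  have [->|s0] := posnP s; first by rewrite !expn0.
  by rewrite leq_mul2l leq_exp2r // mulSn -add1n leq_add2r orbT.
by rewrite expnMn mulnA expnS leq_pmul2r ?expn_gt0 // ltnn.
Qed.

Section TwistedSpan.
Variables (k : fieldType) (B : comNzRingType) (iota : {rmorphism k -> B}).

(* Linear span for the action of the scalar [a] by multiplication by
   [iota a ^+ q]. *)
Inductive tspan (q : nat) (S : set B) : B -> Prop :=
| tspan0 : tspan q S 0
| tspanD x y : tspan q S x -> tspan q S y -> tspan q S (x + y)
| tspanZ a x : tspan q S x -> tspan q S (iota a ^+ q * x)
| tspanS x : S x -> tspan q S x.

Lemma tspan_sum q S (T : Type) (s : seq T) (P : pred T) (F : T -> B) :
  (forall t, P t -> tspan q S (F t)) -> tspan q S (\sum_(t <- s | P t) F t).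
Proof.
move=> SF; apply: (big_ind (tspan q S)) => //; first exact: tspan0.
by move=> x y; apply: tspanD.
Qed.

Lemma tspan_mul q S S' y x : (forall s, S s -> tspan q S' (y * s)) ->
  tspan q S x -> tspan q S' (y * x).
Proof.
move=> H; elim=> {x} [|x x' _ IH _ IH'|a x _ IH|x /H//].
- by rewrite mulr0; apply: tspan0.
- by rewrite mulrDr; apply: tspanD.
- by rewrite mulrCA; apply: tspanZ.
Qed.

Lemma tspan_trans q S S' x : (forall s, S s -> tspan q S' s) ->
  tspan q S x -> tspan q S' x.
Proof.
move=> H Sx; rewrite -[x]mul1r; apply: tspan_mul Sx => s.
by rewrite mul1r; apply: H.
Qed.

Lemma tspan_mono q S S' x : (S `<=` S')%classic -> tspan q S x -> tspan q S' x.
Proof. by move=> SS'; apply: tspan_trans => s /SS'; apply: tspanS. Qed.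

Lemma tspan_exp p q S x : p \in [pchar B] -> tspan q S x ->
  tspan (p * q) [set s ^+ p | s in S]%classic (x ^+ p).
Proof.
move=> chB; elim=> {x} [|x x' _ IH _ IH'|a x _ IH|x Sx].
- by rewrite expr0n eqn0Ngt prime_gt0 ?(pcharf_prime chB) //; apply: tspan0.
- rewrite exprDn_pchar; first exact: tspanD.
  by rewrite (pnatE _ (pcharf_prime chB)).
- by rewrite exprMn -exprM [(q * p)%N]mulnC; apply: tspanZ.
- by apply: tspanS; exists x.
Qed.

(** Scalars expand in the [b t] over q-th powers. The induction treats all multiples [iota a * x] at
    once, because the twisted span is a priori stable only under q-th powers of scalars. *)
Lemma tspan_refine (T : finType) (b : T -> k) q S x :
  (forall a : k, exists c : T -> k, a = \sum_t c t ^+ q * b t) ->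
  tspan 1 S x ->
  tspan q [set y | exists t s, S s /\ y = iota (b t) * s]%classic x.
Proof.
move=> bP Sx; rewrite -[x]mul1r -(rmorph1 iota); move: 1.
elim: Sx => {x} [|x x' _ IH _ IH'|a' x _ IH|x Sx] a.
- by rewrite mulr0; apply: tspan0.
- by rewrite mulrDr; apply: tspanD.
- by rewrite expr1 mulrA -rmorphM.
- have [c ->] := bP a; rewrite rmorph_sum mulr_suml; apply: tspan_sum => t _.
  rewrite rmorphM rmorphXn -mulrA; apply: tspanZ; apply: tspanS.
  by exists t, x.
Qed.

Lemma tspan_closed q (S Y : set B) x : Y 0 ->
  (forall x y, Y x -> Y y -> Y (x + y)) ->
  (forall a x, Y x -> Y (iota a ^+ q * x)) ->
  (S `<=` Y)%classic -> tspan q S x -> Y x.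
Proof. by move=> Y0 YD YZ SY; elim=> {x} [//|x y _ Yx _ Yy|a x _ Yx|x /SY//]; [exact: YD|exact: YZ]. Qed.

Variables (p : nat) (chk : p \in [pchar k]).

Lemma frobD e (a b : k) : (a + b) ^+ (p ^ e) = a ^+ (p ^ e) + b ^+ (p ^ e).
Proof.
by rewrite exprDn_pchar // pnatX pnatE ?chk // (pcharf_prime chk).
Qed.

Lemma frob0 e : (0 : k) ^+ (p ^ e) = 0.
Proof. by rewrite expr0n expn_eq0 eqn0Ngt prime_gt0 // (pcharf_prime chk). Qed.

Lemma frob_sum e (T : Type) (s : seq T) (P : pred T) (F : T -> k) :
  (\sum_(t <- s | P t) F t) ^+ (p ^ e) = \sum_(t <- s | P t) F t ^+ (p ^ e).
Proof.
by apply: (big_morph (fun a => a ^+ (p ^ e))) => [a b|]; rewrite ?frobD ?frob0.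
Qed.

Lemma tspan_finite e (T : finType) (g : T -> B) (I : set B) x : is_ideal I ->
  tspan (p ^ e) (range g `|` I)%classic x ->
  exists c : T -> k, I (x - \sum_t iota (c t) ^+ (p ^ e) * g t).
Proof.
move=> idI; case: (idI) => I0 ID IM.
have fr0 : iota 0 ^+ (p ^ e) = 0 by rewrite -rmorphXn frob0 rmorph0.
elim=> {x} [|x x' _ [c Ic] _ [c' Ic']|a x _ [c Ic]|x [[t _ <-]|Ix]].
- exists (fun=> 0); rewrite big1 ?subr0 // => t _.
  by rewrite fr0 mul0r.
- exists (fun t => c t + c' t); move: (ID _ _ Ic Ic'); congr I.
  rewrite addrACA -opprD -big_split; congr (_ - _); apply: eq_bigr => t _ /=.
  by rewrite -mulrDl -!rmorphXn -rmorphD frobD.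
- exists (fun t => a * c t); move: (IM (iota a ^+ (p ^ e)) _ Ic); congr I.
  rewrite mulrBr mulr_sumr; congr (_ - _); apply: eq_bigr => t _.
  by rewrite rmorphM exprMn mulrA.
- exists (fun t' => (t' == t)%:R); rewrite (bigD1 t) //= eqxx rmorph1 expr1n mul1r.
  rewrite big1 ?addr0 ?subrr // => t' /negbTE->.
  by rewrite fr0 mul0r.
- exists (fun=> 0); rewrite big1 ?subr0 // => t _.
  by rewrite fr0 mul0r.
Qed.

(** The coefficients of the h t are p^e-th powers of a matrix C with more rows than columns.
    Frobenius is additive, so the p^e-th powers of a left kernel vector of C give the relation. *)
Lemma tspan_dependency e (T T' : finType) (g : T -> B) (h : T' -> B) (I : set B) :
  is_ideal I -> (#|T| < #|T'|)%N ->
  (forall t, tspan (p ^ e) (range g `|` I)%classic (h t)) ->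
  exists c : T' -> k, (exists t, c t != 0) /\
    I (\sum_t iota (c t) ^+ (p ^ e) * h t).
Proof.
move=> idI TT' hP.
have ex t := tspan_finite idI (hP t).
pose C t := sval (cid (ex t)).
have CP t : I (h t - \sum_s iota (C t s) ^+ (p ^ e) * g s) := svalP (cid (ex t)).
pose M := \matrix_(i < #|T'|, j < #|T|) C (enum_val i) (enum_val j).
have : kermx M != 0.
  rewrite -mxrank_eq0 mxrank_ker -lt0n subn_gt0.
  by apply: leq_ltn_trans TT'; apply: rank_leq_col.
case/rowV0Pn => v /sub_kermxP vM v0.
exists (fun t => v 0 (enum_rank t)); split.
  apply: contrapT => /forallNP H; move/eqP: v0; apply; apply/rowP => i; rewrite mxE.
  by apply/eqP/negP => /negP vi; apply: (H (enum_val i)); rewrite enum_valK.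
pose u t := iota (v 0 (enum_rank t)) ^+ (p ^ e).
have E : \sum_t u t * (\sum_s iota (C t s) ^+ (p ^ e) * g s) = 0.
  under eq_bigr do rewrite mulr_sumr.
  rewrite exchange_big big1 //= => s _.
  under eq_bigr do rewrite mulrA -exprMn -rmorphM -rmorphXn.
  rewrite -mulr_suml -rmorph_sum -frob_sum.
  suff -> : \sum_t v 0 (enum_rank t) * C t s = 0 by rewrite frob0 rmorph0 mul0r.
  have /matrixP/(_ 0 (enum_rank s)) := vM; rewrite !mxE => vMs.
  rewrite -[RHS]vMs (reindex (fun i : 'I_#|T'| => enum_val i)) /=; last first.
    by exists enum_rank => t _; rewrite ?enum_valK ?enum_rankK.
  by apply: eq_bigr => i _; rewrite mxE enum_valK enum_rankK.
rewrite -[X in I X]subr0 -[X in I (_ - X)]E -sumrB; apply: is_ideal_sum => // t _; rewrite -mulrBr.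
by case: (idI) => _ _; apply.
Qed.

Lemma frob_basis_iter (T : finType) (b : T -> k) j :
  (forall x : k, exists c : T -> k, x = \sum_t c t ^+ p * b t) ->
  exists (T' : finType) (b' : T' -> k), #|T'| = (#|T| ^ j)%N /\
    forall x : k, exists c : T' -> k, x = \sum_t c t ^+ (p ^ j) * b' t.
Proof.
move=> bP; elim: j => [|j [T' [b' [T'm b'P]]]].
  exists unit, (fun=> 1); rewrite card_unit; split=> // x; exists (fun=> x).
  by rewrite (bigD1 tt) //= big1 ?addr0 ?expr1 ?mulr1 // => -[].
exists (T * T')%type, (fun t => b' t.2 ^+ p * b t.1).
split; first by rewrite card_prod T'm expnS.
move=> x; have [c ->] := bP x.
exists (fun t => sval (cid (b'P (c t.1))) t.2).
rewrite -(pair_bigA _ (fun t t' => sval (cid (b'P (c t))) t' ^+ (p ^ j.+1) * (b' t' ^+ p * b t))) /=.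
apply: eq_bigr => t _; case: (cid (b'P (c t))) => d /= ->.
have := frob_sum 1; rewrite expn1 => ->; rewrite mulr_suml; apply: eq_bigr => t' _.
by rewrite exprMn mulrA -exprM -expnSr.
Qed.

End TwistedSpan.

(** * Growth of graded algebras *)

Lemma sum_pair (V : nmodType) (S T : finType) (F : S * T -> V) :
  \sum_st F st = \sum_s \sum_t F (s, t).
Proof. by rewrite pair_bigA; apply: eq_bigr => -[]. Qed.

Section Growth.
Variables (k : fieldType) (R : comNzRingType) (R_ : nat -> {pred R}).
Variable iota : {rmorphism k -> R}.
Hypotheses (gr : graded_ring R_) (noethR : noetherian R).
Hypothesis R0k : forall x, x \in R_ 0%N <-> exists a, x = iota a.

Local Notation hc := (hc R_).
Local Notation irr := (irr R_).

Lemma graded0_unit x : x \in R_ 0%N -> x != 0 -> exists y, x * y = 1.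
Proof.
move=> /R0k[a ->] a0; exists (iota a^-1).
by rewrite -rmorphM mulfV ?rmorph1 //; apply: contraNneq a0 => ->; rewrite rmorph0.
Qed.

Definition mono (S : finType) (x : S -> R) (mu : S -> nat) : R := \prod_s x s ^+ mu s.

Definition monos (S : finType) (x : S -> R) (n : nat) (W : set R) : set R :=
  [set r | exists mu : S -> nat, (forall s, (mu s <= n)%N) /\
     exists w, W w /\ r = mono x mu * w].

Lemma mono0 (S : finType) (x : S -> R) : mono x (fun=> 0%N) = 1.
Proof. by rewrite /mono big1. Qed.

Lemma monoS (S : finType) (x : S -> R) mu s :
  x s * mono x mu = mono x (fun s' => mu s' + (s' == s))%N.
Proof.
rewrite /mono (bigD1 s) //= [RHS](bigD1 s) //= eqxx addn1 exprS mulrA.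
by congr (_ * _); apply: eq_bigr => s' /negbTE->; rewrite addn0.
Qed.

Lemma monos_mono (S : finType) (x : S -> R) m n W W' : (m <= n)%N ->
  (W `<=` W')%classic -> (monos x m W `<=` monos x n W')%classic.
Proof.
move=> mn WW' r [mu [mum [w [Ww ->]]]]; exists mu; split.
  by move=> s; apply: leq_trans mn.
by exists w; split=> //; apply: WW'.
Qed.

Lemma monos_range (S V : finType) (x : S -> R) n (w : V -> R) :
  (monos x n (range w) `<=` range (fun mv : {ffun S -> 'I_n.+1} * V =>
     mono x (fun s => mv.1 s) * w mv.2))%classic.
Proof.
move=> r [mu [mun [_ [[v _ <-] ->]]]].
exists ([ffun s => Ordinal (mun s : (mu s < n.+1)%N)], v) => //=.
by congr (_ * _); apply: eq_bigr => s _; rewrite ffunE.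
Qed.

(** Modulo J, an element of degree at least M is a combination of the [x s] with coefficients of
    smaller degree. Each variable extracted uses up a positive degree, so the exponents stay at most
    n. *)
Lemma span_hom (S : finType) (x : S -> R) dg J M W : hideal R_ J ->
  hom_gens R_ x dg J M ->
  (forall j r, (j < M)%N -> r \in R_ j -> tspan iota 1 (W `|` J)%classic r) ->
  forall n r, r \in R_ n -> tspan iota 1 (monos x n W `|` J)%classic r.
Proof.
move=> hJ xP Wlow n; have [m] := ubnP n; elim: m n => // m IHm n nm r Rr.
have [nM|Mn] := ltnP n M.
  apply: tspan_trans (Wlow n r nM Rr) => s [Ws|Js]; apply: tspanS; [left|by right].
  by exists (fun=> 0%N); split=> //; exists s; rewrite mono0 mul1r.
have [c [cR c0 Jc]] := hom_gens_coef gr hJ xP Mn Rr.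
rewrite -[r](subrK (\sum_s c s * x s)); apply: tspanD; first by apply: tspanS; right.
apply: tspan_sum => s _; have [sn|ns] := leqP (dg s) n; last first.
  by rewrite c0 // mul0r; apply: tspan0.
have [dg0 _] := xP.1 s; rewrite mulrC.
have lt : (n - dg s < n)%N by rewrite ltn_subrL dg0 (leq_trans dg0 sn).
apply: (tspan_mul (S := monos x (n - dg s) W `|` J)%classic); last first.
  by apply: IHm (cR s sn); apply: leq_trans lt _; rewrite -ltnS.
move=> t [[mu [mun [w [Ww ->]]]]|Jt]; apply: tspanS; last first.
  by right; case: hJ.1 => _ _; apply.
left; exists (fun s' => mu s' + (s' == s))%N; split.
  by move=> s'; have := mun s'; case: eqP => _; lia.
by exists w; rewrite -monoS mulrA.
Qed.

Lemma span_algebra_gens (S : finType) (y : S -> R) dg n r :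
  hom_gens R_ y dg (@zeroI R) 1 -> r \in R_ n -> tspan iota 1 (monos y n [set 1]) r.
Proof.
move=> yP Rr.
suff : tspan iota 1 (monos y n [set 1] `|` @zeroI R)%classic r.
  by apply: tspan_trans => s [ms|->]; [apply: tspanS|apply: tspan0].
apply: span_hom yP _ _ _ Rr; first exact: zeroI_hideal.
move=> j {}r; rewrite ltnS leqn0 => /eqP-> /R0k[a ->].
by rewrite -[iota a]mulr1 -[iota a]expr1; apply: tspanZ; apply: tspanS; left.
Qed.

Lemma span_params (S : finType) (x : S -> R) dg J M : hideal R_ J ->
  hom_gens R_ x dg J M -> exists (V : finType) (w : V -> R), forall n r,
    r \in R_ n -> tspan iota 1 (monos x n (range w) `|` J)%classic r.
Proof.
move=> hJ xP; have [Sy [y [dy yP]]] := exists_algebra_gens gr noethR graded0_unit.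
exists {ffun Sy -> 'I_M.+1}, (fun mu : {ffun Sy -> 'I_M.+1} => mono y (fun s => mu s)) => n r Rr.
apply: (span_hom hJ xP) Rr => j {}r jM Rr.
apply: tspan_trans (span_algebra_gens yP Rr) => s [mu [muj [w [-> ->]]]].
apply: tspanS; left; have muM t : (mu t < M.+1)%N by rewrite ltnS (leq_trans (muj t)) // ltnW.
exists [ffun t => Ordinal (muM t)] => //; rewrite mulr1.
by apply: eq_bigr => t _; rewrite ffunE.
Qed.

Definition Rle (n : nat) (r : R) : Prop := forall i, (n < i)%N -> hc i r = 0.

Lemma Rle_sum n r : Rle n r -> r = \sum_(i < n.+1) hc i r.
Proof.
move=> rn; have [N /(_ (maxn N n.+1) (leq_maxl _ _))[rE _]] := hc_bound gr r.
rewrite {1}rE; apply/esym/(sum_wide (c := fun i => hc i r)); first exact: leq_maxr.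
by move=> i; apply: rn.
Qed.

Lemma exists_Rle r : exists n, Rle n r.
Proof.
have [N /(_ N (leqnn _))[_ r0]] := hc_bound gr r; exists N => i /ltnW; exact: r0.
Qed.

Lemma Rle_mono m n r : (m <= n)%N -> Rle m r -> Rle n r.
Proof. by move=> mn rm i ni; apply: rm; apply: leq_ltn_trans ni. Qed.

Lemma RleM m n r s : Rle m r -> Rle n s -> Rle (m + n) (r * s).
Proof.
move=> rm sn i imn; rewrite (hcM gr) big1 // => j _.
have [mj|jm] := ltnP m j; first by rewrite rm // mul0r.
by rewrite sn ?mulr0 //; lia.
Qed.

Lemma Rle1 : Rle 0 1.
Proof. by move=> i i0; rewrite (hc_hom gr _ (graded1 gr)) gtn_eqF. Qed.

Lemma RleX m r n : Rle m r -> Rle (m * n) (r ^+ n).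
Proof.
move=> rm; elim: n => [|n IHn]; first by rewrite muln0 expr0; apply: Rle1.
by rewrite exprS mulnS; apply: RleM.
Qed.

Lemma exists_Rle_family (T : finType) (g : T -> R) : exists n, forall t, Rle n (g t).
Proof.
exists (\max_t sval (cid (exists_Rle (g t)))) => t.
by apply: Rle_mono (svalP (cid (exists_Rle (g t)))); apply: (leq_bigmax t).
Qed.

Definition growth (d C : nat) : Prop := forall n, exists (T : finType) (g : T -> R),
  (#|T| <= C * n.+1 ^ d)%N /\ forall r, Rle n r -> tspan iota 1 (range g) r.

Lemma growth_gens (S : finType) (x : S -> R) dg M :
  hom_gens R_ x dg (@zeroI R) M -> exists C, growth #|S| C.
Proof.
move=> xP; have [V [w wP]] := span_params (zeroI_hideal gr) xP; exists #|V| => n.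
exists ({ffun S -> 'I_n.+1} * V)%type.
exists (fun mv : {ffun S -> 'I_n.+1} * V => mono x (fun s => mv.1 s) * w mv.2); split.
  by rewrite card_prod card_ffun card_ord mulnC.
move=> r /Rle_sum->; apply: tspan_sum => i _.
apply: tspan_trans (wP i _ (hc_in gr i r)) => s [Ms|->]; last exact: tspan0.
apply: tspanS; apply: monos_range; apply: monos_mono Ms => //.
by rewrite -ltnS.
Qed.

Lemma growth_params d : ~ hchain R_ (@zeroI R) d.+2 -> exists C, growth d C.
Proof.
move=> /(exists_params gr noethR graded0_unit (zeroI_hideal gr))[x [dg [M /growth_gens]]].
by rewrite card_ord.
Qed.

Lemma growth_finite : exists d C, growth d C.
Proof.
have [S [y [dg /growth_gens yP]]] := exists_algebra_gens gr noethR graded0_unit.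
by exists #|S|.
Qed.

(** The chain condition gives d - 1 parameters modulo J, and modulo q-th powers of the irrelevant
    ideal only exponents below q survive: O(q^(d - 1)) elements. Multiplying the count by q covers d
    = 0 as well, where J is the whole ring. The family g is chosen before I. *)
Lemma span_mod_powers d J : hideal R_ J -> ~ hchain R_ J d.+1 -> exists C,
  forall q, (0 < q)%N -> exists (T : finType) (g : T -> R),
    (#|T| * q <= C * q ^ d)%N /\
    forall I : set R, is_ideal I -> (J `<=` I)%classic ->
      (forall z, irr z -> I (z ^+ q)) -> forall r, tspan iota 1 (range g `|` I)%classic r.
Proof.
case: d => [|d] hJ nch.
  exists 0%N => q q0; exists void, (fun=> 0); split; first by rewrite card_void.
  move=> I _ JI _ r; apply: tspanS; right; apply: JI.
  exact: (no_hchain1 gr noethR hJ nch).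
have [x [dg [M xP]]] := exists_params gr noethR graded0_unit hJ nch.
have [V [w wP]] := span_params hJ xP; exists #|V| => q q0.
exists ({ffun 'I_d -> 'I_q.-1.+1} * V)%type.
exists (fun mv : {ffun 'I_d -> 'I_q.-1.+1} * V => mono x (fun s => mv.1 s) * w mv.2).
split.
  by rewrite card_prod card_ffun !card_ord prednK // expnSr mulnC mulnCA mulnA mulnC mulnA.
move=> I idI JI Iq r; have [n /Rle_sum->] := exists_Rle r; apply: tspan_sum => i _.
apply: tspan_trans (wP i _ (hc_in gr i r)) => s [[mu [_ [v [Wv ->]]]]|/JI Is]; last first.
  by apply: tspanS; right.
apply: tspanS; have [muq|nmuq] := EM (forall t, (mu t <= q.-1)%N).
  left; apply: monos_range; exists mu; split=> //; by exists v.
have [t tq] : exists t, (q <= mu t)%N.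
  apply: contrapT => /forallNP H; apply: nmuq => t.
  by rewrite -ltnS prednK // ltnNge; apply/negP/H.
right; rewrite /mono (bigD1 t) //= -mulrA; apply: is_idealMr => //.
rewrite -(subnKC tq) exprD; apply: is_idealMr => //; apply: Iq.
by have [dg0 xt] := xP.1 t; apply: irr_hom xt.
Qed.

(** * Counting elements independent over powers or modulo primes *)

Section Independence.
Variables (p : nat) (chk : p \in [pchar k]).

(* Iterating the products [g u * h ^+ p] gives [#|U| ^ j] elements of degree
   [O(p ^ j)] which are independent over the [p ^ j]-th powers. *)
Lemma card_indep_pth_powers d C (P : set R) (U T : finType) (b : T -> k) (g : U -> R) :
  growth d C -> is_prime P ->
  (forall x : k, exists c : T -> k, x = \sum_t c t ^+ p * b t) ->
  (forall a : U -> R, P (\sum_u a u ^+ p * g u) -> forall u, P (a u)) ->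
  (#|U| <= #|T| * p ^ d)%N.
Proof.
move=> gC pP bP gP; have [c gc] := exists_Rle_family g.
have p1 : (1 < p)%N by apply/prime_gt1/(pcharf_prime chk).
have p0 : (0 < p)%N by apply: ltnW.
have chR : p \in [pchar R] by apply: (rmorph_pchar iota chk).
have frobR j (V : finType) (F : V -> R) :
    (\sum_v F v) ^+ (p ^ j) = \sum_v F v ^+ (p ^ j).
  apply: (big_morph (fun a => a ^+ (p ^ j))) => [x y|].
    by rewrite exprDn_pchar // pnatX (pnatE _ (pcharf_prime chk)); apply/orP; left.
  by rewrite expr0n expn_eq0 eqn0Ngt p0.
have ex j : exists (V : finType) (h : V -> R), [/\ #|V| = (#|U| ^ j)%N,
    forall v, Rle (c * (p ^ j).-1) (h v) &
    forall a : V -> R, P (\sum_v a v ^+ (p ^ j) * h v) -> forall v, P (a v)].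
  elim: j => [|j [V [h [Vj hR hP]]]].
    exists unit, (fun=> 1); split; first by rewrite card_unit.
      by rewrite muln0 => _; exact: Rle1.
    by move=> a; rewrite (bigD1 tt) //= big1 => [+ []|[]//]; rewrite addr0 mulr1.
  exists (U * V)%type, (fun uv => g uv.1 * h uv.2 ^+ p); split.
  - by rewrite card_prod Vj expnS.
  (* The bound propagates since c + p c (p^j - 1) <= c (p^(j+1) - 1), as p is at least 2. *)
  - move=> uv /=; apply: Rle_mono (RleM (gc uv.1) (RleX (n := p) (hR uv.2))).
    have : (0 < p ^ j)%N by rewrite expn_gt0 p0.
    by rewrite expnS; move: (p ^ j)%N => [//|y] _ /=; nia.
  - move=> a; rewrite sum_pair /=.
    have -> : \sum_u \sum_v a (u, v) ^+ (p ^ j.+1) * (g u * h v ^+ p) =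
        \sum_u (\sum_v a (u, v) ^+ (p ^ j) * h v) ^+ p * g u.
      apply: eq_bigr => u _; rewrite -{4}(expn1 p) frobR mulr_suml.
      apply: eq_bigr => v _; rewrite expn1 exprMn -exprM -expnSr -!mulrA.
      by congr (_ * _); rewrite mulrC.
    by move=> /gP aP [u v]; apply: (hP (fun v => a (u, v)) (aP u)).
(* Degrees below c p^j span O(p^(j d)) dimensions over k, hence [#|T| ^ j] times as many over p^j-th
   powers; so [#|U| ^ j] is at most a constant times [(#|T| * p ^ d) ^ j]. *)
apply: (@leq_of_expn_bound (C * c.+1 ^ d)) => j.
have [V [h [<- hR hP]]] := ex j.
have [W [y [Wc yP]]] := gC (c * (p ^ j).-1)%N.
have [T' [b' [T'm b'P]]] := frob_basis_iter chk j bP.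
have bound : (#|{: T' * W}| <= C * c.+1 ^ d * (#|T| * p ^ d) ^ j)%N.
  rewrite card_prod T'm expnMn mulnCA leq_mul2l; apply/orP; right.
  have -> : ((p ^ d) ^ j = (p ^ j) ^ d)%N by rewrite -!expnM mulnC.
  apply: leq_trans Wc _; rewrite -mulnA -expnMn leq_mul2l; apply/orP; right.
  have [->|d0] := posnP d; first by rewrite !expn0.
  rewrite leq_exp2r //; have : (0 < p ^ j)%N by rewrite expn_gt0 p0.
  by case: (p ^ j)%N => [//|x] _ /=; nia.
apply: leq_trans bound; rewrite leqNgt; apply/negP => lt.
have idP : is_ideal P by case: pP.
have [|a [[v av] Pa]] := tspan_dependency (iota := iota) chk (e := j) (h := h)
    (g := fun tw : T' * W => iota (b' tw.1) * y tw.2) idP lt.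
  move=> v; have := tspan_refine b'P (yP _ (hR v)); apply: tspan_mono => z.
  by move=> [t [s [[w _ <-] ->]]]; left; exists (t, w).
have := hP _ Pa v; case: pP => _ P1 _ Piv; apply: P1.
rewrite -(rmorph1 iota) -(mulVf av) rmorphM; case: idP => _ _; exact.
Qed.

(* Elements of [P i.+1] outside [P i] are algebraically independent modulo
   [P 0]. *)
Lemma prime_chain_bound d C (L : nat) (P : nat -> set R) : growth d C ->
  (forall i, (i <= L)%N -> is_prime (P i)) ->
  (forall i, (i < L)%N -> (P i `<=` P i.+1)%classic /\ ~ (P i.+1 `<=` P i)%classic) ->
  (L <= d)%N.
Proof.
move=> gC pP PS.
have [D DP] : exists D, forall n, exists (T : finType) (h : T -> R),
    [/\ #|T| = (n ^ L)%N, forall t, Rle (D * n) (h t)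
      & forall c : T -> k, P 0%N (\sum_t iota (c t) * h t) -> forall t, c t = 0].
  elim: L P pP PS => [|L IHL] P pP PS.
    exists 0%N => n; exists unit, (fun=> 1); split; first by rewrite card_unit.
      by rewrite mul0n => _; exact: Rle1.
    move=> c; rewrite (bigD1 tt) //= big1 => [|[]//]; rewrite addr0 mulr1 => Pc [].
    apply/eqP; apply: contraPT Pc => c0 Pc; have [idP P1 _] := pP 0%N isT; apply: P1.
    by rewrite -(rmorph1 iota) -(mulVf c0) rmorphM; case: idP => _ _; exact.
  have [|i iL|D DP] := IHL (fun i => P i.+1); [by move=> i iL; apply: pP|exact: PS|].
  (* Powers of z with coefficients independent modulo [P 1] are independent modulo [P 0]: reducing
     modulo [P 1] kills the constant coefficient, and then z can be cancelled modulo [P 0]. *)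
  have [P01 /nonsubset[z [P1z P0z]]] := PS 0%N isT.
  have [a za] := exists_Rle z; exists (a + D)%N => n.
  have [T [h [Tn hR hP]]] := DP n.
  exists ('I_n * T)%type, (fun it : 'I_n * T => z ^+ it.1 * h it.2); split.
  - by rewrite card_prod card_ord Tn expnS.
  - move=> it; rewrite mulnDl; apply: RleM => //.
    by apply: Rle_mono (RleX (n := it.1) za); rewrite leq_mul2l ltnW ?orbT.
  - move=> c; rewrite sum_pair /=.
    pose cc i t := if insub i is Some i' then c (i', t) else 0.
    have -> : \sum_(i < n) \sum_t iota (c (i, t)) * (z ^+ i * h t) =
        \sum_(i < n) z ^+ i * \sum_t iota (cc i t) * h t.
      apply: eq_bigr => i _; rewrite mulr_sumr; apply: eq_bigr => t _.
      by rewrite /cc valK mulrCA.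
    move=> Pc; suff cc0 i : (i < n)%N -> forall t, cc i t = 0.
      by move=> [i t]; have := cc0 i (ltn_ord i) t; rewrite /cc valK.
    move: cc i Pc => {c} cc; have [id0 _ PM0] := pP 0%N isT.
    have [id1 _ _] := pP 1%N isT.
    elim: n cc {Tn hR DP} => // n IHn cc i; rewrite big_ord_recl expr0 mul1r.
    rewrite [X in P 0%N (_ + X)](_ : _ =
      z * \sum_(i < n) z ^+ i * \sum_t iota (cc i.+1 t) * h t) => [Pc|]; last first.
      by rewrite mulr_sumr; apply: eq_bigr => j _; rewrite /= exprS mulrA.
    have c0 : forall t, cc 0%N t = 0.
      apply: hP; rewrite -[X in P 1%N X](addrK (z * (\sum_(i < n) z ^+ i * \sum_t iota (cc i.+1 t) * h t))).
      by apply: is_idealB => //; [exact: P01|apply: is_idealMr].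
    case: i => [|i] //; rewrite ltnS; apply: (IHn (fun i => cc i.+1)).
    move: Pc; rewrite big1 ?add0r => [/PM0[]//|t _].
    by rewrite c0 rmorph0 mul0r.
apply: (@leq_of_poly_bound C D) => n; have [T [h [<- hR hP]]] := DP n.
have [W [y [Wc yP]]] := gC (D * n)%N; apply: leq_trans Wc.
rewrite leqNgt; apply/negP => lt; have [idP P1 _] := pP 0%N isT.
have [|a [[v av] Pa]] := tspan_dependency (iota := iota) chk (e := 0)
  (g := y) (h := h) idP lt.
  by move=> t; apply: tspan_mono (yP _ (hR t)) => s; left.
move/eqP: av; apply; by apply: hP; move: Pa; congr P.
Qed.

End Independence.
End Growth.

(** * Generic generators over the p-th powers *)

Section GenericRank.
Variables (k : fieldType) (R : comNzRingType) (R_ : nat -> {pred R}).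
Variable iota : {rmorphism k -> R}.
Hypotheses (gr : graded_ring R_) (noethR : noetherian R).
Hypothesis R0k : forall x, x \in R_ 0%N <-> exists a, x = iota a.
Hypothesis redR : reduced R.
Variables (p : nat) (chk : p \in [pchar k]).
Variables (T : finType) (b : T -> k).
Hypothesis bP : forall x : k, exists c : T -> k, x = \sum_t c t ^+ p * b t.

Local Notation hc := (hc R_).

(** Since R is reduced, an element of all the primes of a product decomposition of zero is zero. In
    a minimal subfamily with zero intersection, dropping [Q i] leaves a nonzero common element, and
    [e i] is one of its components outside [Q i]. *)
Lemma irredundant_hprimes : exists (I : finType) (Q : I -> set R) (e : I -> R),
  [/\ forall i, hprime R_ (Q i), forall x, (forall i, Q i x) -> x = 0
    & forall i, [/\ exists n, e i \in R_ n, ~ Q i (e i)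
                  & forall j, j != i -> Q j (e i)]].
Proof.
have [I [Q [hQ Q0]]] := hprime_decomposition gr noethR (zeroI_hideal gr).
pose pr (A : {set I}) := `[< forall x, (forall i, i \in A -> Q i x) -> x = 0 >].
have prT : exists A, pr A.
  exists finset.setT; apply/asboolP => x Qx; apply: (redR (n := #|I|)).
  by rewrite -prodr_const; apply: Q0 => i; apply: Qx.
have [A /minsetP[/asboolP prA minA]] := ex_minset prT.
have ex (i : {i | i \in A}) : exists e, [/\ exists n, e \in R_ n, ~ Q (val i) e
    & forall j, j \in A -> j != val i -> Q j e].
  case: i => i iA /=; have npr : ~~ pr (A :\ i)%SET.
    apply/negP => /minA E; move: iA; rewrite -E ?finset.subD1set //.
    by rewrite !inE eqxx.
  have [x [Qx x0]] : exists x, (forall j, j \in (A :\ i)%SET -> Q j x) /\ x <> 0.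
    apply: contrapT => /forallNP H; case/negP: npr; apply/asboolP => x Qx.
    by apply: contrapT => x0; apply: (H x).
  have nQx : ~ Q i x.
    move=> Qix; apply: x0; apply: prA => j jA; have [->//|ji] := eqVneq j i.
    by apply: Qx; rewrite !inE ji.
  have [|n nQ] := hideal_notin gr _ nQx; first by case: (hQ i).1 => -[].
  exists (hc n x); split=> //; first by exists n; apply: hc_in.
  by move=> j jA ji; apply: (hQ j).1.2; apply: Qx; rewrite !inE ji.
exists {i | i \in A}, (fun i => Q (val i)), (fun i => sval (cid (ex i))); split.
- by move=> i; case: (hQ (val i)).
- by move=> x Qx; apply: prA => i iA; apply: (Qx (exist _ i iA)).
- move=> i; case: (svalP (cid (ex i))) => h1 h2 h3; split=> // j ji.
  by apply: h3; [exact: valP|].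
Qed.

Let p_gt0 : (0 < p)%N. Proof. exact/prime_gt0/(pcharf_prime chk). Qed.

Lemma exprpD (x y : R) : (x + y) ^+ p = x ^+ p + y ^+ p.
Proof.
rewrite exprDn_pchar // (pnatE _ (pcharf_prime chk)).
exact: (rmorph_pchar iota chk).
Qed.

Lemma exprp_sum (V : Type) (s : seq V) (P : pred V) (F : V -> R) :
  (\sum_(v <- s | P v) F v) ^+ p = \sum_(v <- s | P v) F v ^+ p.
Proof.
apply: (big_morph (fun x => x ^+ p)) => [x y|]; first exact: exprpD.
by rewrite expr0n eqn0Ngt p_gt0.
Qed.

Lemma hc_exprp n x : exists a, hc n (x ^+ p) = a ^+ p.
Proof.
have [N /(_ N (leqnn _))[xE _]] := hc_bound gr x.
exists (\sum_(i < N | (n == i * p)%N) hc i x).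
rewrite {1}xE !exprp_sum (hc_sum gr) [RHS]big_mkcond.
by apply: eq_bigr => i _; rewrite (hc_hom gr _ (gradedX gr p (hc_in gr i x))).
Qed.

Lemma hc_exprp_mul n x : hc (n * p) (x ^+ p) = hc n x ^+ p.
Proof.
have [N /(_ (maxn N n.+1) (leq_maxl _ _))[xE _]] := hc_bound gr x.
have nN : (n < maxn N n.+1)%N by rewrite leq_max leqnn orbT.
rewrite {1}xE exprp_sum (hc_sum gr) (bigD1 (Ordinal nN)) //=.
rewrite (hc_hom gr _ (gradedX gr p (hc_in gr n x))) eqxx big1 ?addr0 // => i neq.
rewrite (hc_hom gr _ (gradedX gr p (hc_in gr i x))) eqn_pmul2r // eq_sym.
by move: neq; rewrite -val_eqE /= => /negbTE->.
Qed.

(** Dividing the exponents of a monomial by p leaves remainders below p; these monomials, times the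
    elements spanning k over its p-th powers, generate R over R^p. *)
Lemma frobenius_gens : exists (L : finType) (f : L -> R) (df : L -> nat),
  (forall l, f l \in R_ (df l)) /\
  forall r, exists a : L -> R, r = \sum_l a l ^+ p * f l.
Proof.
have [S [y [dg yP]]] := exists_algebra_gens gr noethR (graded0_unit R0k).
exists (T * {ffun S -> 'I_p})%type.
exists (fun tm : T * {ffun S -> 'I_p} => iota (b tm.1) * mono y (fun s => tm.2 s)).
exists (fun tm : T * {ffun S -> 'I_p} => (\sum_s dg s * tm.2 s)%N).
split=> [[t m] /=|r].
  rewrite -[X in R_ X]add0n; apply: gradedM => //; first by apply/R0k; exists (b t).
  rewrite /mono; apply: (big_rec2 (fun n x => x \in R_ n)); first exact: graded1.
  by move=> s n x _ Rx; apply: gradedM => //; apply: gradedX => //; exact: (yP.1 s).2.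
have [n /(Rle_sum gr)->] := exists_Rle gr r.
pose Y : set R := fun x => exists a : T * {ffun S -> 'I_p} -> R,
  x = \sum_l a l ^+ p * (iota (b l.1) * mono y (fun s => l.2 s)).
have Y0 : Y 0.
  exists (fun=> 0); rewrite big1 // => l _; by rewrite expr0n eqn0Ngt p_gt0 mul0r.
have YD x z : Y x -> Y z -> Y (x + z).
  move=> [a ->] [a' ->]; exists (fun l => a l + a' l).
  by rewrite -big_split; apply: eq_bigr => l _; rewrite exprpD mulrDl.
have YM c x : Y x -> Y (c ^+ p * x).
  move=> [a ->]; exists (fun l => c * a l); rewrite mulr_sumr.
  by apply: eq_bigr => l _; rewrite exprMn mulrA.
apply: (big_ind Y) => // i _.
have := tspan_refine bP (span_algebra_gens gr R0k yP (hc_in gr i r)); apply: tspan_closed => //.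
  by move=> a x; apply: YM.
move=> _ [t [_ [[mu [_ [_ [-> ->]]]] ->]]].
pose m := [ffun s => Ordinal (ltn_pmod (mu s) p_gt0)] : {ffun S -> 'I_p}.
exists (fun l => if l == (t, m) then mono y (fun s => mu s %/ p)%N else 0).
rewrite (bigD1 (t, m)) //= eqxx big1 ?addr0 => [|l /negbTE->]; last first.
  by rewrite expr0n eqn0Ngt p_gt0 mul0r.
rewrite mulr1 mulrCA; congr (_ * _); rewrite /mono -prodrXl -big_split.
by apply: eq_bigr => s _ /=; rewrite ffunE /= -exprM -exprD -divn_eq.
Qed.

(** A maximal subset B of the [f l] independent over p-th powers modulo Q is small by
    [card_indep_pth_powers]. Each other [f l] depends on B after multiplication by some [c ^+ p]
    with c outside Q, and a common c is the product of homogeneous ones. *)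
Lemma generic_gens_mod_prime d (L : finType) (f : L -> R) (df : L -> nat) (Q : set R) :
  ~ hchain R_ (@zeroI R) d.+2 -> hprime R_ Q -> (forall l, f l \in R_ (df l)) ->
  exists (g : 'I_(#|T| * p ^ d) -> R) (c : R), [/\ exists n, c \in R_ n, ~ Q c
    & forall l, exists a : 'I_(#|T| * p ^ d) -> R,
        Q (c ^+ p * f l - \sum_j a j ^+ p * g j)].
Proof.
move=> nch hQ fR; have pQ := hQ.1; have idQ : is_ideal Q by case: pQ.
have [C gC] := growth_params gr noethR R0k nch.
pose ind (B : {set L}) := `[< forall a : L -> R,
  Q (\sum_(l in B) a l ^+ p * f l) -> forall l, l \in B -> Q (a l) >].
have [|B /maxsetP[/asboolP indB maxB]] := @ex_maxset _ ind.
  by exists finset.set0; apply/asboolP => a _ l; rewrite inE.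
have cB : (#|B| <= #|T| * p ^ d)%N.
  rewrite -[#|B|]card_ord.
  apply: (card_indep_pth_powers gr chk (g := fun i => f (enum_val i)) gC pQ bP) => a Qa i.
  pose a' l := if insub (index l (enum B)) is Some i then a i else 0.
  have a'E j : a' (enum_val j) = a j.
    by rewrite /a' (enum_val_nth (enum_val j)) index_uniq ?enum_uniq -?cardE ?valK.
  rewrite -a'E; apply: indB (enum_valP i); move: Qa; congr Q.
  by rewrite [RHS]big_enum_val; apply: eq_bigr => j _; rewrite a'E.
have dep l : exists c, ~ Q c /\ exists a : L -> R, Q (c ^+ p * f l - \sum_(l' in B) a l' ^+ p * f l').
  have [lB|lB] := boolP (l \in B).
    exists 1; split; first by case: pQ.
    exists (fun l' => (l' == l)%:R); rewrite (bigD1 l) //= eqxx expr1n big1 => [|l' /andP[_ /negbTE->]].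
      by rewrite addr0 subrr; case: idQ.
    by rewrite expr0n eqn0Ngt p_gt0 mul0r.
  have : ~~ ind (l |: B)%SET.
    apply/negP => /maxB E; move: lB; rewrite -E ?finset.subsetU1 // !inE eqxx //.
  move=> /asboolPn/existsNP[a /not_implyP[Qa /existsNP[l' /not_implyP[l'B Qal']]]].
  move: Qa; rewrite big_setU1 //= => Qa; exists (a l); split.
    move=> Qal; apply: Qal'; move: l'B; rewrite !inE => /orP[/eqP->//|].
    apply: indB; rewrite -[X in Q X](addKr (a l ^+ p * f l)) addrC; apply: is_idealB => //.
    by rewrite -(prednK p_gt0) exprS -mulrA; apply: is_idealMr.
  exists (fun l => - a l); move: Qa; congr (Q (_ + _)); rewrite -sumrN.
  apply: eq_bigr => i _; rewrite -mulNr; congr (_ * _).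
  apply/eqP; rewrite -subr_eq0 opprK -exprpD subrr expr0n eqn0Ngt p_gt0 //.
have hdep l : exists c, [/\ exists n, c \in R_ n, ~ Q c &
    exists a : L -> R, Q (c ^+ p * f l - \sum_(l' in B) a l' ^+ p * f l')].
  have [c [Qc [a Qa]]] := dep l; have [n nQ] := hideal_notin gr idQ Qc.
  exists (hc n c); split=> //; first by exists n; apply: hc_in.
  (* Components of [x ^+ p * f l'] keep this shape, so the relation may be cut down to the single
     degree of [hc n c ^+ p * f l]. *)
  have hca D x l' : exists a', hc D (x ^+ p * f l') = a' ^+ p * f l'.
    rewrite (hc_Mr gr _ _ (fR l')); case: ifP => _.
      by have [a' ->] := hc_exprp (D - df l') x; exists a'.
    by exists 0; rewrite expr0n eqn0Ngt p_gt0 mul0r.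
  pose a' l' := sval (cid (hca (n * p + df l)%N (a l') l')).
  exists a'; have := hQ.2 _ (n * p + df l)%N Qa; congr Q.
  rewrite (hcB gr) (hc_Mr gr _ _ (fR l)) leq_addl addnK hc_exprp_mul; congr (_ - _).
  rewrite (hc_sum gr); apply: eq_bigr => l' _; exact: (svalP (cid (hca _ _ _))).
pose cl l := sval (cid (hdep l)).
have clP l : [/\ exists n, cl l \in R_ n, ~ Q (cl l) &
    exists a : L -> R, Q (cl l ^+ p * f l - \sum_(l' in B) a l' ^+ p * f l')].
  exact: (svalP (cid (hdep l))).
have clR l : exists n, cl l \in R_ n by case: (clP l).
pose nl l := sval (cid (clR l)).
(* Families indexed by B are padded with zeros to a length that does not depend on Q, as the gluing
   over all the primes requires. *)
pose nz (a : L -> R) j := nth 0 [seq a l | l <- enum B] j.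
have nzE (a : L -> R) : \sum_(j < #|T| * p ^ d) nz a j ^+ p * nz f j = \sum_(l in B) a l ^+ p * f l.
  rewrite -(sum_wide (c := fun j => nz a j ^+ p * nz f j) cB); last first.
    by move=> i Bi; rewrite /nz [X in _ * X]nth_default ?mulr0 // size_map -cardE.
  rewrite [RHS]big_enum_val; apply: eq_bigr => i _; rewrite /nz.
  by rewrite !(nth_map (enum_val i)) -?cardE // -!enum_val_nth.
exists (fun j => nz f j), (\prod_l cl l); split.
- exists (\sum_l nl l)%N; apply: (big_rec2 (fun n x => x \in R_ n)); first exact: graded1.
  by move=> l n x _ Rx; apply: gradedM => //; exact: (svalP (cid (clR l))).
- by apply: is_prime_prod => // l; case: (clP l).
- move=> l; case: (clP l) => _ _ [a Qa].
  exists (fun j => nz (fun l' => (\prod_(i | i != l) cl i) * a l') j); rewrite nzE.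
  set w := \prod_(i | i != l) cl i.
  have -> : (\prod_i cl i) ^+ p * f l - \sum_(l' in B) (w * a l') ^+ p * f l' =
      w ^+ p * (cl l ^+ p * f l - \sum_(l' in B) a l' ^+ p * f l').
    rewrite (bigD1 l) //= -/w mulrBr exprMn mulr_sumr -mulrA mulrCA; congr (_ - _).
    by apply: eq_bigr => l' _; rewrite exprMn mulrA.
  by case: idQ => _ _; apply.
Qed.

(* The generators modulo the [Q i] are glued with weights [e i] that vanish modulo
   all the other primes. *)
Lemma exists_generic_gens d : ~ hchain R_ (@zeroI R) d.+2 ->
  exists (g : 'I_(#|T| * p ^ d) -> R) (J : set R), [/\ hideal R_ J, ~ hchain R_ J d.+1
    & forall c, J c -> forall r, exists a : 'I_(#|T| * p ^ d) -> R,
        c ^+ p * r = \sum_j a j ^+ p * g j].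
Proof.
move=> nch; have [I [Q [e [hQ Q0 eP]]]] := irredundant_hprimes.
have [L [f [df [fR fP]]]] := frobenius_gens.
have ex i := generic_gens_mod_prime nch (hQ i) fR.
pose g i := sval (cid (ex i)); pose c i := sval (cid (svalP (cid (ex i)))).
have cP i : [/\ exists n, c i \in R_ n, ~ Q i (c i)
    & forall l, exists a : 'I_(#|T| * p ^ d) -> R,
        Q i (c i ^+ p * f l - \sum_j a j ^+ p * g i j)].
  exact: (svalP (cid (svalP (cid (ex i))))).
have idQ i : is_ideal (Q i) by case: (hQ i) => -[].
have eQ0 i x : Q i x -> e i * x = 0.
  move=> Qx; apply: Q0 => j; have [->|ji] := eqVneq j i.
    by case: (idQ i) => _ _; apply.
  by apply: is_idealMr => //; case: (eP i) => _ _; apply.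
(* The two factors [e i] play different parts: after raising to the p, one kills the error, which
   lies in [Q i], and turns [g i j] into [G j], while the other is absorbed in the coefficients. *)
pose G j := \sum_i e i ^+ p * g i j; pose c' i := e i ^+ 2 * c i.
pose J : set R := fun r => exists a : I -> R, r = \sum_i a i * c' i.
have Jc i : J (c' i).
  exists (fun j => (j == i)%:R); rewrite (bigD1 i) //= eqxx mul1r big1 ?addr0 // => j /negbTE->.
  by rewrite mul0r.
exists G, J; split.
- split; first split.
  + by exists (fun=> 0); rewrite big1 // => i _; rewrite mul0r.
  + move=> _ _ [a ->] [a' ->]; exists (fun i => a i + a' i).
    by rewrite -big_split; apply: eq_bigr => i _; rewrite mulrDl.
  + move=> x _ [a ->]; exists (fun i => x * a i); rewrite mulr_sumr.
    by apply: eq_bigr => i _; rewrite mulrA.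
  + have c'R i : exists n, c' i \in R_ n.
      case: (eP i) => -[n en] _ _; case: (cP i) => -[m cm] _ _; exists (n * 2 + m)%N.
      by apply: gradedM => //; apply: gradedX.
    move=> _ n [a ->].
    exists (fun i => if (sval (cid (c'R i)) <= n)%N then hc (n - sval (cid (c'R i))) (a i) else 0).
    rewrite (hc_sum gr); apply: eq_bigr => i _.
    by rewrite (hc_Mr gr _ _ (svalP (cid (c'R i)))); case: ifP; rewrite ?mul0r.
(* A homogeneous prime over J contains some [Q i], strictly since it contains [c' i]; hence a chain
   over J lengthens downwards by [Q i]. *)
- move=> [Q' [hQ' Q'S]]; have [i Qi] : exists i, (Q i `<=` Q' 0%N)%classic.
    apply: (prime_over_decomposition (J := @zeroI R)).
    + move=> x Qx; apply: Q0 => i; rewrite (bigD1 i) //=; exact: is_idealMr.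
    + by case: (hQ' 0%N isT) => -[].
    + by move=> x ->; case: (hQ' 0%N isT) => -[[[]]].
  apply: nch; apply: (hchain_cons (J := J)) (hQ i) _ _ => //.
    by move=> x ->; case: (idQ i).
  exists Q'; split=> // _; split=> // Q'i.
  have [_ nQe _] := eP i; have [_ nQc _] := cP i.
  suff : ~ Q i (c' i) by apply; apply: Q'i; apply: (hQ' 0%N isT).2.
  have pQ := (hQ i).1; apply: is_primeNM => //.
  by rewrite expr2; apply: is_primeNM.
- have c'P i r : exists a : 'I_(#|T| * p ^ d) -> R, c' i ^+ p * r = \sum_j a j ^+ p * G j.
    have [rr ->] := fP r; case: (cP i) => _ _ aP.
    pose a l := sval (cid (aP l)).
    exists (fun j => \sum_l rr l * a l j * e i).
    have eG j : e i ^+ p * (e i ^+ p * g i j) = e i ^+ p * G j.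
      rewrite /G (bigD1 i) //= mulrDr mulr_sumr big1 ?addr0 // => s si.
      rewrite mulrA -exprMn eQ0; first by rewrite expr0n eqn0Ngt p_gt0 mul0r.
      by case: (eP s) => _ _; apply; rewrite eq_sym.
    under [RHS]eq_bigr do rewrite exprp_sum mulr_suml.
    rewrite exchange_big mulr_sumr; apply: eq_bigr => l _ /=.
    have /eQ0 : Q i (c i ^+ p * f l - \sum_j a l j ^+ p * g i j) := svalP (cid (aP l)).
    move/eqP; rewrite mulrBr subr_eq0 => /eqP E.
    have eE x : e i ^+ p.-1 * (e i * x) = e i ^+ p * x by rewrite mulrA -exprSr prednK.
    have -> : c' i ^+ p * (rr l ^+ p * f l) =
        rr l ^+ p * (e i ^+ p * (e i ^+ p.-1 * (e i * (c i ^+ p * f l)))).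
      by rewrite eE /c' exprMn -exprM mulnC exprM; ring.
    rewrite E !mulr_sumr; apply: eq_bigr => j _.
    by rewrite eE !exprMn -[RHS]mulrA -eG; ring.
  move=> _ [x ->] r.
  pose a i := sval (cid (c'P i r)).
  have aE i : c' i ^+ p * r = \sum_j a i j ^+ p * G j := svalP (cid (c'P i r)).
  exists (fun j => \sum_i x i * a i j); rewrite exprp_sum mulr_suml.
  under [RHS]eq_bigr do rewrite exprp_sum mulr_suml.
  rewrite exchange_big; apply: eq_bigr => i _ /=.
  rewrite exprMn -mulrA aE mulr_sumr; apply: eq_bigr => j _.
  by rewrite exprMn mulrA.
Qed.

End GenericRank.

Lemma ideal_is_ideal (A : comNzRingType) (P : ideal A) :
  is_ideal [set x : A | (x : A^o) \in P].
Proof.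
have [P0 PL] := submodP P; split=> //=.
- by move=> x y Px Py; have := PL 1 _ _ Px Py; rewrite scale1r.
- by move=> a x Px; have := PL a _ _ Px P0; rewrite addr0.
Qed.

(** * Localization at the irrelevant ideal *)

Section PBasis.
Variables (p : nat) (k : fieldType) (chk : p \in [pchar k]).

Lemma frobkB (a b : k) : (a - b) ^+ p = a ^+ p - b ^+ p.
Proof.
have frbD (u v : k) : (u + v) ^+ p = u ^+ p + v ^+ p by have := frobD chk 1 u v; rewrite expn1.
by apply: (addIr (b ^+ p)); rewrite -frbD !subrK.
Qed.

(** A spanning family of least size is independent: a relation with [d i0] nonzero can be solved for
    [g i0], because p-th powers can be divided. *)
Lemma exists_p_basis : F_finite chk -> exists (m : nat) (g : 'I_m -> k),
  [/\ (0 < m)%N, forall x, exists c : 'I_m -> k, x = \sum_i c i ^+ p * g i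
    & forall c : 'I_m -> k, \sum_i c i ^+ p * g i = 0 -> forall i, c i = 0].
Proof.
move=> [n0 [g0 gP0]].
pose sp n := `[< exists g : 'I_n -> k, forall x, exists c : 'I_n -> k, x = \sum_i c i ^+ p * g i >].
have exsp : exists n, sp n.
  exists n0; apply/asboolP; exists (fun i => g0 i : k) => x.
  by have [c cP] := gP0 x; exists c; rewrite {1}cP; apply: eq_bigr => i _; exact: (congr1 (fun e => c i ^+ e * (g0 i : k)) (expn1 p)).
have [m /asboolP[g gP] minm] := ex_minnP exsp.
have p0 : (0 < p)%N by exact/prime_gt0/(pcharf_prime chk).
have m0 : (0 < m)%N.
  case: m g gP {minm} => [|//] g gP; have [c] := gP 1; rewrite big_ord0 => /eqP.
  by rewrite oner_eq0.
exists m, g; split=> // d dg i0; apply/eqP/negP => /negP di0.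
case: m g gP minm m0 d i0 dg di0 => [//|m] g gP minm _ d i0 dg di0.
suff /minm : sp m by rewrite ltnn.
apply/asboolP; exists (fun i => g (lift i0 i)) => x; have [c ->] := gP x.
exists (fun i => c (lift i0 i) - c i0 / d i0 * d (lift i0 i)).
under [RHS]eq_bigr do rewrite frobkB mulrBl exprMn -mulrA.
rewrite sumrB -mulr_sumr (bigD1_ord i0) //= addrC; congr (_ + _).
move: dg; rewrite (bigD1_ord i0) //= => /eqP; rewrite addrC addr_eq0 => /eqP->.
by rewrite mulrN opprK mulrA -exprMn divfK.
Qed.

End PBasis.

Section Localization.
Variables (k : fieldType) (R : comNzRingType) (R_ : nat -> {pred R}).
Variable iota : {rmorphism k -> R}.
Hypotheses (gr : graded_ring R_) (noethR : noetherian R).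
Hypothesis R0k : forall x, x \in R_ 0%N <-> exists a, x = iota a.
Variables (Rm : localRing) (f : {rmorphism R -> Rm}).
Hypothesis locf : is_localization_at (irrelevant R_) f.

Local Notation hc := (hc R_).

Lemma irrelevantE x : irrelevant R_ x <-> irr R_ x.
Proof.
rewrite /irr /=; split=> [[n [c [Rc ->]]]|x0].
  by rewrite (hc_sum gr) big1 // => i _; rewrite (hc_hom gr _ (Rc i)).
have [N /(_ N.+1 (leqnSn _))[xE _]] := hc_bound gr x.
exists N, (fun i => hc i.+1 x); split; first by move=> i; apply: hc_in.
by rewrite {1}xE big_ord_recl x0 add0r.
Qed.

(** The constant term of a denominator is a nonzero scalar. Normalized to 1, it puts 1 - s in the
    irrelevant ideal, as the geometric series of [loc_approx] requires. *)
Lemma loc_frac b : exists a s, hc 0 s = 1 /\ b * f s = f a.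
Proof.
case: locf => _ /(_ b)[a [s [ns bs]]] _.
have s0 : hc 0 s != 0 by apply: contra_notN ns => /eqP s0; apply/irrelevantE.
have [c sc] := (R0k _).1 (hc_in gr 0 s).
exists (a * iota c^-1), (s * iota c^-1); split; last by rewrite !rmorphM mulrA bs.
have cR : iota c^-1 \in R_ 0%N by apply/R0k; exists c^-1.
rewrite (hc0M gr) sc (hc_hom gr _ cR) eqxx -rmorphM mulfV ?rmorph1 //.
by apply: contraNneq s0 => c0; rewrite sc c0 rmorph0.
Qed.

Lemma loc_ker a : f a = 0 -> exists s, hc 0 s != 0 /\ s * a = 0.
Proof.
case: locf => _ _ + fa0; move/(_ a fa0) => [s ns sa]; exists s; split=> //.
by apply: contra_notN ns => /eqP s0; apply/irrelevantE.
Qed.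

Lemma loc_eq a b : f a = f b -> exists s, hc 0 s != 0 /\ s * a = s * b.
Proof.
move=> /eqP; rewrite -subr_eq0 -rmorphB => /eqP/loc_ker[s [s0 sab]].
by exists s; split=> //; apply/eqP; rewrite -subr_eq0 -mulrBr sab.
Qed.

Lemma loc_unit s : hc 0 s != 0 -> exists y, f s * y = 1.
Proof.
by move=> s0; case: locf => + _ _; apply; move/irrelevantE => s0'; rewrite s0' eqxx in s0.
Qed.

Lemma hc0_mul_neq0 x y : hc 0 x != 0 -> hc 0 y != 0 -> hc 0 (x * y) != 0.
Proof.
have [[_ _ H] _] := irr_hprime gr (graded0_unit R0k).
move=> x0 y0; apply/negP => /eqP /H; rewrite /irr /= => -[] E.
  by rewrite E eqxx in x0.
by rewrite E eqxx in y0.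
Qed.

Lemma res_loc0 s : res Rm (f s) = 0 <-> irr R_ s.
Proof.
rewrite /irr /=; split=> [fs0|s0].
  apply/eqP/negP => /negP/loc_unit[y /(congr1 (res Rm))/eqP].
  by rewrite rmorphM fs0 mul0r rmorph1 eq_sym oner_eq0.
apply/eqP/negP => /negP/res_local[y fsy].
have [a [t [t1 yt]]] := loc_frac y.
have : f (s * a) = f t by rewrite rmorphM -yt mulrA fsy mul1r.
move=> /loc_eq[w [w0 /(congr1 (hc 0))]]; rewrite !(hc0M gr) s0 t1 mul0r mulr0 mulr1 => /esym/eqP.
by rewrite (negbTE w0).
Qed.

Definition residue_emb : {rmorphism k -> residue Rm} := res Rm \o (f \o iota).

Lemma res_hc0 a : res Rm (f a) = res Rm (f (hc 0 a)).
Proof.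
apply/eqP; rewrite -subr_eq0 -!rmorphB; apply/eqP/res_loc0.
by rewrite /irr /= (hcB gr) (hc_hom gr _ (hc_in gr 0 a)) eqxx subrr.
Qed.

Lemma residue_emb_surj y : exists c, residue_emb c = y.
Proof.
have [b <-] := @res_surj Rm y; have [a [s [s1 bs]]] := loc_frac b.
have [c ac] := (R0k _).1 (hc_in gr 0 a); exists c.
rewrite /residue_emb /= -ac -res_hc0 -bs rmorphM [X in _ * X]res_hc0 s1 !rmorph1.
by rewrite mulr1.
Qed.

(* Geometric series: [1 / (1 - z)] is a polynomial in [z] up to a multiple of
   [z ^+ n]. *)
Lemma loc_approx b n : exists a z, irr R_ z /\ b = f a + b * f z ^+ n.
Proof.
have [a [s [s1 bs]]] := loc_frac b; pose z := 1 - s.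
have zi : irr R_ z by rewrite /irr /= (hcB gr) (hc01 gr) s1 subrr.
exists (a * \sum_(i < n) z ^+ i), z; split=> //.
rewrite rmorphM -bs -mulrA -rmorphM -rmorphXn -mulrDr -rmorphD.
have sz : s = 1 - z by rewrite /z subKr.
have E : (1 - z) * \sum_(i < n) z ^+ i = 1 - z ^+ n.
  by clearbody z; apply: oppr_inj; rewrite -mulNr !opprB subrX1.
by rewrite [X in f (X * _ + _)]sz E subrK rmorph1 mulr1.
Qed.

Lemma is_prime_preim (P : ideal Rm) : prime_ideal P ->
  is_prime [set x : R | (f x : Rm^o) \in P].
Proof.
move=> [P1 PM]; have [P0 PD PZ] := ideal_is_ideal P; split; first split=> /=.
- by rewrite rmorph0.
- by move=> x y Px Py; rewrite rmorphD; apply: PD.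
- by move=> a x Px; rewrite rmorphM; apply: PZ.
- by rewrite /= rmorph1; apply/negP.
- by move=> x y; rewrite /= rmorphM; apply: PM.
Qed.

Lemma prime_chain_preim d (P : nat -> ideal Rm) : prime_chain d P ->
  (forall i, (i <= d)%N -> is_prime [set x : R | (f x : Rm^o) \in P i]) /\
  forall i, (i < d)%N ->
    ([set x : R | (f x : Rm^o) \in P i] `<=` [set x : R | (f x : Rm^o) \in P i.+1])%classic /\
    ~ ([set x : R | (f x : Rm^o) \in P i.+1] `<=` [set x : R | (f x : Rm^o) \in P i])%classic.
Proof.
move=> [pP PS]; split=> [i id|i id]; first by apply: is_prime_preim; apply: pP.
have [sub ne] := PS i id; split=> [x /=|sub']; first exact: sub.
apply: ne => b; apply/idP/idP; first exact: sub.
move=> Pb; have [a [s [s1 bs]]] := loc_frac b.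
have [|y sy] := @loc_unit s; first by rewrite s1 oner_eq0.
have PM j x : (x : Rm^o) \in P j -> forall y, (x * y : Rm^o) \in P j.
  by move=> Px c; have [_ _ PZ] := ideal_is_ideal (P j); rewrite mulrC; apply: PZ.
have -> : b = f a * y by rewrite -bs -mulrA sy mulr1.
by apply: (PM); apply: sub'; rewrite /= -bs; apply: (PM).
Qed.

Variables (p : nat) (chk : p \in [pchar k]).

(** Chains of primes of the localization pull back to strict chains in R, whose length is bounded by
    the polynomial growth of R. *)
Lemma exists_krull_dim : exists d, krull_dim Rm d.
Proof.
have [s [C gC]] := growth_finite gr noethR R0k.
have bound d P : @prime_chain Rm d P -> (d <= s)%N.
  move=> /prime_chain_preim[pP PS].
  exact: (prime_chain_bound gr chk (P := fun i => [set x : R | (f x : Rm^o) \in P i]%classic) gC pP PS).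
pose pc d := `[< exists P, @prime_chain Rm d P >].
have ex0 : exists d, pc d.
  exists 0%N; apply/asboolP.
  have idm : is_ideal [set x : Rm | res Rm x = 0].
    split=> /=; first by rewrite rmorph0.
    - by move=> x y x0 y0; rewrite rmorphD x0 y0 addr0.
    - by move=> a x x0; rewrite rmorphM x0 mulr0.
  exists (fun=> ideal_of idm); split=> // i _; split.
    by apply/negP => /ideal_ofE /=; rewrite rmorph1; apply/eqP; rewrite oner_eq0.
  move=> x y /ideal_ofE /= /eqP; rewrite rmorphM mulf_eq0 => /orP[]/eqP H; [left|right];
    exact/ideal_ofE.
have [|d /asboolP dP maxd] := ex_maxnP ex0 (m := s).
  by move=> d /asboolP[P /bound].
exists d; split=> // d' P dP'; apply: maxd; apply/asboolP; by exists P.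
Qed.

Definition loc_ext (P : set R) : set Rm :=
  [set b | exists a s, [/\ P a, hc 0 s != 0 & b * f s = f a]].

Lemma loc_ext_ideal P : is_ideal P -> is_ideal (loc_ext P).
Proof.
move=> idP; case: (idP) => P0 PD PM; split.
- exists 0, 1; split=> //; last by rewrite mul0r rmorph0.
  by rewrite (hc01 gr) oner_eq0.
- move=> x y [a [s [Pa s0 xs]]] [a' [s' [Pa' s0' ys]]].
  exists (s' * a + s * a'), (s * s'); split.
  + by apply: PD; apply: PM.
  + exact: hc0_mul_neq0.
  + rewrite !rmorphD !rmorphM -xs -ys; ring.
- move=> b x [a [s [Pa s0 xs]]]; have [c [t [t1 bt]]] := loc_frac b.
  exists (c * a), (t * s); split; first exact: PM.
    by apply: hc0_mul_neq0; rewrite ?t1 ?oner_eq0.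
  rewrite !rmorphM -xs -bt; ring.
Qed.

Lemma loc_ext_prime P x : is_prime P -> (P `<=` irr R_)%classic -> loc_ext P (f x) <-> P x.
Proof.
move=> pP Pirr; have [idP P1 PM] := pP; split=> [[a [s [Pa s0]]]|Px]; last first.
  by exists x, 1; split; rewrite ?(hc01 gr) ?oner_eq0 // rmorph1 mulr1.
have nP t : hc 0 t != 0 -> ~ P t by move=> t0 /Pirr; rewrite /irr /= => E; rewrite E eqxx in t0.
rewrite -rmorphM => /loc_eq[w [w0 E]]; have Pw : P (w * (x * s)) by rewrite E; case: idP => _ _; apply.
by case: (PM _ _ Pw) => [/(nP _ w0)//|/PM[//|/(nP _ s0)]].
Qed.

Lemma hchain_prime_chain l : hchain R_ (@zeroI R) l.+1 -> exists P, @prime_chain Rm l P.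
Proof.
move=> [Q [hQ QS]].
have idQ i : (i <= l)%N -> is_ideal (Q i) by move=> il; case: (hQ i il) => -[[]].
have Qirr i : (i <= l)%N -> (Q i `<=` irr R_)%classic.
  move=> il; apply: (hprime_sub_irr gr (graded0_unit R0k)); by case: (hQ i il).
(* [P] has to be defined at every index; beyond l the set [loc_ext (Q i)] may fail to be an ideal,
   and the extension of [Q 0] stands in. *)
pose P i := match pselect (is_ideal (loc_ext (Q i))) with
  | left h => ideal_of h | right _ => ideal_of (loc_ext_ideal (idQ 0%N isT)) end.
have PE i b : (i <= l)%N -> ((b : Rm^o) \in P i) <-> loc_ext (Q i) b.
  move=> il; rewrite /P; case: pselect => h; first exact: ideal_ofE.
  by case: h; apply: loc_ext_ideal; apply: (idQ).
exists P; split=> [i il|i il].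
- have pQ : is_prime (Q i) by case: (hQ i il) => -[].
  have [_ Q1 QM] := pQ; split.
    apply/negP => /(PE _ _ il); rewrite -[X in loc_ext _ X](rmorph1 f).
    by move/(loc_ext_prime _ pQ (Qirr i il)).
  move=> x y /(PE _ _ il) Qxy.
  have [a [s [s1 xs]]] := loc_frac x; have [b [t [t1 yt]]] := loc_frac y.
  have [|u us] := @loc_unit s; first by rewrite s1 oner_eq0.
  have [|v vt] := @loc_unit t; first by rewrite t1 oner_eq0.
  have [_ _ LM] := loc_ext_ideal (idQ i il).
  have : loc_ext (Q i) (f (a * b)).
    have -> : f (a * b) = (f s * f t) * (x * y) by rewrite rmorphM -xs -yt; ring.
    exact: LM.
  move=> /(loc_ext_prime _ pQ (Qirr i il))/QM[Qa|Qb]; [left|right]; apply/(PE _ _ il).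
    have -> : x = u * f a by rewrite -xs mulrCA mulrC [u * _]mulrC us mul1r.
    by apply: LM; apply/loc_ext_prime => //; apply: Qirr.
  have -> : y = v * f b by rewrite -yt mulrCA mulrC [v * _]mulrC vt mul1r.
  by apply: LM; apply/loc_ext_prime => //; apply: Qirr.
- have [sub nsub] := QS i il; have il' := ltnW il; split.
    move=> b /(PE _ _ il')[a [s [Qa s0 bs]]]; apply/(PE _ _ il).
    by exists a, s; split=> //; apply: sub.
  move=> E; apply: nsub => x Qx.
  have pQ : is_prime (Q i) by case: (hQ i il') => -[].
  have pQ' : is_prime (Q i.+1) by case: (hQ i.+1 il) => -[].
  apply/(loc_ext_prime _ pQ (Qirr i il')); apply/(PE _ _ il'); rewrite E.
  by apply/(PE _ _ il); apply/loc_ext_prime => //; apply: Qirr.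
Qed.

Lemma krull_dim_no_hchain d : krull_dim Rm d -> ~ hchain R_ (@zeroI R) d.+2.
Proof. by move=> [_ dmax] /hchain_prime_chain[P /dmax]; rewrite ltnn. Qed.

Lemma residue_degree (m : nat) (g : 'I_m -> k) :
  (forall x, exists c : 'I_m -> k, x = \sum_i c i ^+ p * g i) ->
  (forall c : 'I_m -> k, \sum_i c i ^+ p * g i = 0 -> forall i, c i = 0) ->
  degree_over_pth_powers p (residue Rm) m.
Proof.
move=> gP gfree; exists (fun i => residue_emb (g i)) => y.
have [x <-] := residue_emb_surj y; have [c ->] := gP x.
exists [ffun i => residue_emb (c i) ^+ p]; split.
  split; first by move=> i; rewrite ffunE; exists (residue_emb (c i)).
  by rewrite rmorph_sum; apply: eq_bigr => i _; rewrite rmorphM rmorphXn ffunE.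
move=> c' [c'P]; rewrite rmorph_sum => E; apply/ffunP => i; rewrite ffunE.
have ex j : exists d, c' j = residue_emb d ^+ p.
  have [z ->] := c'P j; have [d <-] := residue_emb_surj z; by exists d.
pose d j := sval (cid (ex j)).
have dE j : c' j = residue_emb (d j) ^+ p := svalP (cid (ex j)).
rewrite dE; congr (residue_emb _ ^+ p); apply/eqP; rewrite -subr_eq0; apply/eqP.
apply: (gfree (fun i => c i - d i)); apply: (fmorph_inj residue_emb); rewrite rmorph0.
under eq_bigr do rewrite (frobkB chk) mulrBl.
rewrite sumrB rmorphB !rmorph_sum E; apply/eqP; rewrite subr_eq0; apply/eqP.
by apply: eq_bigr => j _; rewrite dE rmorphM rmorphXn.
Qed.

End Localization.

(** * Free ranks of Frobenius pushforwards *)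

Definition linear_of (A : comNzRingType) (M N : lmodType A) (F : M -> N)
    (H : linear F) : {linear M -> N} :=
  HB.pack F (GRing.isLinear.Build A M N *:%R F H).

Lemma linear_ofE (A : comNzRingType) (M N : lmodType A) (F : M -> N)
  (H : linear F) x : linear_of H x = F x.
Proof. by []. Qed.

Lemma linear_inv (A : comNzRingType) (M N : lmodType A) (h : {linear M -> N})
  (g : N -> M) : cancel h g -> cancel g h -> linear g.
Proof.
by move=> hK gK a x y; rewrite -[RHS]hK linearP !gK.
Qed.

Section Isomorphic.
Variable A : comNzRingType.

Lemma isomorphic_of (M N : lmodType A) (F : M -> N) (G : N -> M) :
  linear F -> cancel F G -> cancel G F -> isomorphic M N.
Proof. by move=> H FK GK; exists (linear_of H); exists G. Qed.

Lemma isomorphic_trans (M N P : lmodType A) :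
  isomorphic M N -> isomorphic N P -> isomorphic M P.
Proof.
by move=> [f fb] [g gb]; exists (g \o f : {linear M -> P}); apply: bij_comp.
Qed.

Lemma isomorphic_prod (M N P : lmodType A) :
  isomorphic N P -> isomorphic (M * N)%type (M * P)%type.
Proof.
move=> [f [g fK gK]].
apply: (@isomorphic_of _ _ (fun x : M * N => (x.1, f x.2)) (fun x : M * P => (x.1, g x.2))).
- by move=> a x y; congr (_, _); rewrite /= linearP.
- by case=> x y; rewrite /= fK.
- by case=> x y; rewrite /= gK.
Qed.

Lemma isomorphic_row_assoc a n (N : lmodType A) :
  isomorphic ('rV[A]_a * ('rV[A]_n * N))%type ('rV[A]_(a + n) * N)%type.
Proof.
apply: (@isomorphic_of _ _ (fun x : 'rV[A]_a * ('rV[A]_n * N) => (row_mx x.1 x.2.1, x.2.2))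
  (fun x : 'rV[A]_(a + n) * N => (lsubmx x.1, (rsubmx x.1, x.2)))).
- by move=> c x y; congr (_, _); rewrite /= scale_row_mx add_row_mx.
- by case=> x [y z]; rewrite /= row_mxKl row_mxKr.
- by case=> x y; rewrite /= hsubmxK.
Qed.

Lemma isomorphic_row0 (N : lmodType A) : isomorphic N ('rV[A]_0 * N)%type.
Proof.
apply: (@isomorphic_of _ _ (fun x : N => (0 : 'rV[A]_0, x)) (fun x => x.2)) => //.
- by move=> a x y; congr (_, _); apply/rowP => -[].
- by case=> x y; congr (_, _); apply/rowP => -[].
Qed.

Lemma isomorphic_split (N : lmodType A) (phi : {linear N -> A^o}) (n1 : N) :
  phi n1 = 1 -> isomorphic N ('rV[A]_1 * submod_type (ker_submod phi))%type.
Proof.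
move=> phi1.
have kerP x : x - phi x *: n1 \in ker_submod phi.
  by rewrite inE linearB linearZ /= phi1 [_ *: _]mulr1 subrr.
pose F x : 'rV[A]_1 * submod_type (ker_submod phi) :=
  (const_mx (phi x), exist _ (x - phi x *: n1) (kerP x)).
pose G (y : 'rV[A]_1 * submod_type (ker_submod phi)) := y.1 0 0 *: n1 + val y.2.
apply: (@isomorphic_of _ _ F G).
- move=> a x y; congr (_, _); first by apply/rowP => i; rewrite !mxE linearP.
  apply: val_inj; rewrite /= linearP scalerDl scalerBr scalerA opprD addrACA.
  by congr (_ + _).
- by move=> x; rewrite /G /F /= mxE addrC subrK.
- case=> r [x xk]; have phix : phi x = 0 by move: xk; rewrite inE => /eqP.
  have phiG : phi (G (r, exist _ x xk)) = r 0 0.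
    by rewrite /G linearD linearZ /= phi1 phix addr0 [_ *: _]mulr1.
  congr (_, _); first by apply/rowP => i; rewrite mxE phiG ord1.
  by apply: val_inj; rewrite /= phiG /G /= addrAC subrr add0r.
Qed.

End Isomorphic.

Section FrobeniusSplitting.
Variables (S : localRing) (p : nat) (chS : p \in [pchar S]).

Definition frob_linear (e : nat) (phi : S -> S) : Prop :=
  (forall x y, phi (x + y) = phi x + phi y) /\
  forall a x, phi (a ^+ (p ^ e) * x) = a * phi x.

(* The e-th splitting ideal: the elements whose p^e-th root generates no free
   summand of S^(1/p^e). *)
Definition split_ideal (e : nat) : set S :=
  [set r | forall phi, frob_linear e phi -> res S (phi r) = 0].

Lemma frob_linear0 e phi : frob_linear e phi -> phi 0 = 0.
Proof. by move=> [phiD _]; apply: (addrI (phi 0)); rewrite -phiD !addr0. Qed.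

Lemma split_ideal_ideal e : is_ideal (split_ideal e).
Proof.
split=> [phi Hphi|x y Ix Iy phi Hphi|a x Ix phi [phiD phiM]].
- by rewrite (frob_linear0 Hphi) rmorph0.
- by rewrite Hphi.1 rmorphD Ix // Iy // addr0.
- apply: (Ix (fun z => phi (a * z))); split=> [z w|b z]; first by rewrite mulrDr.
  by rewrite mulrCA phiM.
Qed.

Lemma split_ideal_frob e c r : res S c = 0 -> split_ideal e (c ^+ (p ^ e) * r).
Proof. by move=> c0 phi [_ phiM]; rewrite phiM rmorphM c0 mul0r. Qed.

Lemma split_idealX e r : split_ideal e r -> split_ideal e.+1 (r ^+ p).
Proof.
move=> Ir phi [phiD phiM]; apply: (Ir (fun z => phi (z ^+ p))); split=> [x y|a x].
  by rewrite exprDn_pchar ?phiD // (pnatE _ (pcharf_prime chS)).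
by rewrite exprMn -exprM -expnSr phiM.
Qed.

(** Such a family is a basis of a free direct summand of rank a of S^(1/p^e), with the [pi i] as
    dual coordinates. *)
Definition split_family (e a : nat) (v : 'I_a -> S) : Prop :=
  exists pi : 'I_a -> S -> S, (forall i, frob_linear e (pi i)) /\
    forall i j, pi i (v j) = (i == j)%:R.

(** The complement N of the free part lies in the splitting ideal: a functional with unit value at
    an element of N would split a free summand off N. *)
Lemma free_rank_spans e a : free_rank (frob_push chS e) a ->
  exists v : 'I_a -> S, split_family e v /\
    forall r, exists c : 'I_a -> S, split_ideal e (r - \sum_i c i ^+ (p ^ e) * v i).
Proof.
move=> [N [h [g hK gK]] nfN].
have gL : linear g by apply: linear_inv hK gK.
pose gl := linear_of gL.
pose v j : S := g (delta_mx 0 j, 0).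
pose pi i (x : S) : S := (h (x : frob_push chS e)).1 0 i.
have piL i : frob_linear e (pi i).
  split=> [x y|b x]; rewrite /pi.
    by have := linearD h (x : frob_push chS e) y => ->; rewrite /= mxE.
  by have := linearZ_LR h b (x : frob_push chS e) => ->; rewrite /= mxE.
exists v; split.
  exists pi; split=> // i j; rewrite /pi /v gK /= mxE eqxx /=.
  by rewrite eq_sym.
move=> r; exists (fun i => pi i r).
have rE : r - \sum_i pi i r ^+ (p ^ e) * v i = g (0, (h (r : frob_push chS e)).2).
  have -> : \sum_i pi i r ^+ (p ^ e) * v i = gl ((h (r : frob_push chS e)).1, 0).
    transitivity (\sum_i gl (pi i r *: (delta_mx 0 i, 0 : N))).
      by apply: eq_bigr => i _; rewrite linearZ.
    rewrite -linear_sum; congr (gl _).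
    have -> : forall (s : seq 'I_a), \sum_(i <- s) pi i r *: ((delta_mx 0 i : 'rV[S]_a), 0 : N) =
        (\sum_(i <- s) pi i r *: (delta_mx 0 i : 'rV[S]_a), 0 : N).
      elim=> [|i s IHs]; first by rewrite !big_nil.
      by rewrite !big_cons IHs; congr (_, _); rewrite /= scaler0 add0r.
    by rewrite -row_sum_delta.
  rewrite -[X in X - _](hK (r : frob_push chS e)) -[g _]/(gl _) -(linearB gl).
  by congr (gl _); rewrite [h _]surjective_pairing; congr (_, _); rewrite /= ?subrr ?subr0.
rewrite rE; move: (h _).2 => n phi Hphi; apply/eqP/negP => /negP phi0.
have [u phiu] := res_local phi0.
have psiL : linear (fun x : N => u * phi (g (0, x)) : S^o).
  move=> b x y; have -> : (0 : 'rV[S]_a, b *: x + y) = b *: (0, x) + (0, y).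
    by congr (_, _); rewrite /= scaler0 addr0.
  have -> : g (b *: (0, x) + (0, y)) = b ^+ (p ^ e) * (g (0, x) : S) + (g (0, y) : S) :> S.
    exact: gL.
  by rewrite Hphi.1 (Hphi.2 b) mulrDr mulrCA.
have /isomorphic_split/nfN // : linear_of psiL n = 1 by rewrite linear_ofE mulrC.
Qed.

(** With a maximal, the complement has no free summand, since one could be moved to the free
    part. *)
Lemma free_rank_exists e (B : nat) :
  (forall a (v : 'I_a -> S), split_family e v -> (a <= B)%N) ->
  exists a, free_rank (frob_push chS e) a.
Proof.
move=> bound.
pose P a := `[< exists N : lmodType S, isomorphic (frob_push chS e) ('rV[S]_a * N)%type >].
have ex0 : exists a, P a.
  by exists 0%N; apply/asboolP; exists (frob_push chS e : lmodType S); apply: isomorphic_row0.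
have leB a : P a -> (a <= B)%N.
  move=> /asboolP[N [h [g hK gK]]].
  apply: (bound a (fun j => g (delta_mx 0 j, 0))).
  exists (fun i (x : S) => (h (x : frob_push chS e)).1 0 i); split.
    move=> i; split=> [x y|b x].
      by have := linearD h (x : frob_push chS e) y => ->; rewrite /= mxE.
    by have := linearZ_LR h b (x : frob_push chS e) => ->; rewrite /= mxE.
  by move=> i j; rewrite gK /= mxE eqxx /= eq_sym.
have [a /asboolP[N isoN] maxa] := ex_maxnP ex0 leB.
exists a; exists N => // n N' isoN'.
have : P (a + n)%N.
  apply/asboolP; exists N'; apply: isomorphic_trans (isomorphic_row_assoc a n N').
  by apply: isomorphic_trans isoN _; apply: isomorphic_prod.
by move/maxa; rewrite -[X in (_ <= X)%N]addn0 leq_add2l leqn0 => /eqP.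
Qed.

Section Bound.
Variables (k : fieldType) (kappa : {rmorphism k -> S}) (chk : p \in [pchar k]).

(** The [v i] are independent over k modulo the splitting ideal: [pi i] reads off from a relation a
    nonzero scalar, which is a unit. With [free_rank_spans] and [span_of_family] this makes the free
    rank the twisted dimension modulo that ideal. *)
Lemma split_family_le e a (v : 'I_a -> S) (T : finType) (g : T -> S) :
  split_family e v ->
  (forall r, tspan kappa (p ^ e) (range g `|` split_ideal e)%classic r) -> (a <= #|T|)%N.
Proof.
move=> [pi [piL piv]] gP; rewrite leqNgt; apply/negP; rewrite -[X in (_ < X)%N]card_ord => lt.
have [c [[i ci] Ic]] := tspan_dependency chk (e := e) (g := g) (h := v)
  (split_ideal_ideal e) lt (fun t => gP (v t)).
have := Ic (pi i) (piL i).
have piS (s : seq 'I_a) : pi i (\sum_(j <- s) kappa (c j) ^+ (p ^ e) * v j) =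
    \sum_(j <- s) kappa (c j) * (i == j)%:R.
  elim: s => [|j s IHs]; first by rewrite !big_nil (frob_linear0 (piL i)).
  by rewrite !big_cons (piL i).1 IHs (piL i).2 piv.
rewrite piS (bigD1 i) //= eqxx mulr1 big1 ?addr0 => [|j ji]; last first.
  by rewrite eq_sym (negbTE ji) mulr0.
move=> resc; have := congr1 (fun x => x * res S (kappa (c i)^-1)) resc => /eqP.
by rewrite mul0r -!rmorphM mulfV // !rmorph1 oner_eq0.
Qed.

End Bound.
End FrobeniusSplitting.

(** * The recursive inequality for the free ranks *)

Section RankGrowth.
Variables (k : fieldType) (R : comNzRingType) (R_ : nat -> {pred R}).
Variable iota : {rmorphism k -> R}.
Hypotheses (gr : graded_ring R_) (noethR : noetherian R).
Hypothesis R0k : forall x, x \in R_ 0%N <-> exists a, x = iota a.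
Hypothesis redR : reduced R.
Variables (Rm : localRing) (f : {rmorphism R -> Rm}).
Hypothesis locf : is_localization_at (irrelevant R_) f.
Variables (p : nat) (chk : p \in [pchar k]) (chS : p \in [pchar Rm]).
Variables (m : nat) (b : 'I_m -> k).
Hypothesis bP : forall x : k, exists c : 'I_m -> k, x = \sum_i c i ^+ p * b i.
Variable d : nat.
Hypothesis dimR : ~ hchain R_ (@zeroI R) d.+2.

Let kappa : {rmorphism k -> Rm} := f \o iota.

Lemma tspan_loc q (S : set R) (Y : set Rm) w x : Y 0 -> (forall u v, Y u -> Y v -> Y (u + v)) ->
  (forall a u, Y u -> Y (kappa a ^+ q * u)) ->
  (forall s, S s -> Y (f (s * w))) -> tspan iota q S x -> Y (f (x * w)).
Proof.
move=> Y0 YD YZ SY; apply: (tspan_closed (Y := fun z => Y (f (z * w)))) => [|u v Yu Yv|a u Yu|s /SY//].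
- by rewrite mul0r rmorph0.
- by rewrite mulrDl rmorphD; apply: YD.
- by rewrite -mulrA rmorphM rmorphXn; apply: YZ.
Qed.

(** The splitting ideal contains the p^e-th powers of the maximal ideal, so [loc_approx] reduces to
    elements of R, which [span_mod_powers] handles. *)
Lemma split_ideal_loc_span e : exists (T : finType) (g : T -> Rm),
  forall r, tspan kappa (p ^ e) (range g `|` split_ideal p e)%classic r.
Proof.
have p0 : (0 < p)%N by exact/prime_gt0/(pcharf_prime chk).
have nch : ~ hchain R_ (@zeroI R) d.+1.+1 by [].
have [C HC] := span_mod_powers gr noethR R0k (zeroI_hideal gr) nch.
have [|T [y [_ yP]]] := HC (p ^ e)%N; first by rewrite expn_gt0 p0.
have [T' [b' [_ b'P]]] := frob_basis_iter chk e bP.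
exists (T' * T)%type, (fun ts => f (iota (b' ts.1) * y ts.2)) => r.
have [a [z [zi ->]]] := loc_approx gr R0k locf r (p ^ e).
have z0 := (res_loc0 gr R0k locf z).2 zi.
apply: tspanD; last by apply: tspanS; right; rewrite mulrC; apply: split_ideal_frob.
have [I0 ID IM] := split_ideal_ideal Rm p e.
have := yP [set r | split_ideal p e (f r)]%classic _ _ _ a.
move=> /(_ _ _ _)/(tspan_refine b'P) H.
rewrite -[a]mulr1; apply: tspan_loc (H _ _ _).
- exact: tspan0.
- by move=> u v; apply: tspanD.
- by move=> c u; apply: tspanZ.
- move=> _ [t [s [[[j _ <-]|Is] ->]]]; rewrite mulr1; apply: tspanS; first by left; exists (t, j).
  by right; rewrite rmorphM; apply: IM.
- split=> /=; first by rewrite rmorph0.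
    by move=> u v Iu Iv; rewrite rmorphD; apply: ID.
  by move=> c u Iu; rewrite rmorphM; apply: IM.
- by move=> _ -> /=; rewrite rmorph0.
- move=> w wi /=; rewrite rmorphXn -[_ ^+ _]mulr1; apply: split_ideal_frob.
  exact: (res_loc0 gr R0k locf w).2.
Qed.

Lemma exists_free_rank e : exists a, free_rank (frob_push chS e) a.
Proof.
have [T [g gP]] := split_ideal_loc_span e.
by apply: (@free_rank_exists _ _ chS e #|T|) => a v /(split_family_le chk)/(_ gP).
Qed.

(** The residue field is k, so a coefficient differs from a scalar by an element of the maximal
    ideal, and multiples of its p^e-th power lie in the splitting ideal. *)
Lemma span_of_family e a (v : 'I_a -> Rm) :
  (forall r, exists c : 'I_a -> Rm, split_ideal p e (r - \sum_i c i ^+ (p ^ e) * v i)) ->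
  forall r, tspan kappa (p ^ e) (range v `|` split_ideal p e)%classic r.
Proof.
move=> vP r; have [c Ic] := vP r.
rewrite -[r](subrK (\sum_i c i ^+ (p ^ e) * v i)); apply: tspanD; first by apply: tspanS; right.
apply: tspan_sum => i _; have [a0 ac] := residue_emb_surj gr R0k locf (res Rm (c i)).
have -> : c i = kappa a0 + (c i - kappa a0) by rewrite addrC subrK.
rewrite exprDn_pchar; last first.
  by rewrite pnatX (pnatE _ (pcharf_prime chS)); apply/orP; left.
rewrite mulrDl; apply: tspanD; first by apply: tspanZ; apply: tspanS; left; exists i.
apply: tspanS; right; apply: split_ideal_frob; rewrite rmorphB -ac.
by rewrite /residue_emb /= subrr.
Qed.

(** Two families span R_m modulo the next splitting ideal. The products of p-th powers of the [v i]
    with the generic generators [g j] account for all multiples of [c ^+ p] with c in J. The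
    remainder comes from R modulo J and the p^e-th powers of the irrelevant ideal, spread by the
    [#|L|] generators of R over R^p. *)
Lemma rank_recursion (a : nat -> nat) : (forall e, free_rank (frob_push chS e) (a e)) ->
  exists K, forall e,
    (a e.+1 * p ^ e <= m * p ^ d * a e * p ^ e + K * (m * p ^ d) ^ e)%N.
Proof.
move=> aP; have p0 : (0 < p)%N by exact/prime_gt0/(pcharf_prime chk).
have [g [J [hJ nchJ gJ]]] := exists_generic_gens gr noethR R0k redR chk bP dimR.
have [C HC] := span_mod_powers gr noethR R0k hJ nchJ.
have [L [fl [df [_ flP]]]] := frobenius_gens gr noethR R0k chk bP.
exists (#|L| * C)%N => e.
have [|T [y [Tq yP]]] := HC (p ^ e)%N; first by rewrite expn_gt0 p0.
have [T' [b' [T'm b'P]]] := frob_basis_iter chk e bP.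
have [v [_ vP]] := free_rank_spans (aP e).
have [v' [v'P _]] := free_rank_spans (aP e.+1).
pose gX (x : 'I_(a e) * 'I_(#|'I_m| * p ^ d) + T' * T * L) : Rm := match x with
  | inl ij => v ij.1 ^+ p * f (g ij.2)
  | inr tsl => f ((iota (b' tsl.1.1) * y tsl.1.2) ^+ p * fl tsl.2) end.
pose Y : set Rm := tspan kappa (p ^ e.+1) (range gX `|` split_ideal p e.+1)%classic.
have [I0 ID IM] := split_ideal_ideal Rm p e.+1.
have YI x : split_ideal p e.+1 x -> Y x by move=> Ix; apply: tspanS; right.
have YD x z : Y x -> Y z -> Y (x + z) by apply: tspanD.
have YZ c x : Y x -> Y (kappa c ^+ (p ^ e.+1) * x) by apply: tspanZ.
have Y0 : Y 0 by apply: tspan0.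
have Ysum (V : finType) (F : V -> Rm) : (forall u, Y (F u)) -> Y (\sum_u F u).
  by move=> YF; apply: tspan_sum => u _; apply: YF.
have YW c j : Y (f (g j) * c ^+ p).
  have := tspan_exp chS (span_of_family vP c); rewrite -expnS; apply: tspan_mul.
  move=> _ [s [[i _ <-]|Is] <-]; apply: tspanS; first by left; exists (inl (i, j)) => //; rewrite mulrC.
  by right; apply: IM; apply: split_idealX.
(* The elements whose p-th power has only multiples already spanned. This is the ideal fed to
   [span_mod_powers]: it contains J and the p^e-th powers of the irrelevant ideal. *)
pose I1 : set R := fun r => forall c, Y (f (r ^+ p * c)).
have idI1 : is_ideal I1.
  split=> [c|x z Ix Iz c|r x Ix c] /=.
  - by rewrite expr0n eqn0Ngt p0 mul0r rmorph0.
  - by rewrite (exprpD iota chk) mulrDl rmorphD; apply: YD.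
  - by rewrite exprMn [r ^+ p * _]mulrC -mulrA; apply: Ix.
have JI1 : (J `<=` I1)%classic.
  move=> c Jc r /=; have [u ->] := gJ c Jc r; rewrite rmorph_sum; apply: Ysum => j.
  by rewrite rmorphM rmorphXn mulrC; apply: YW.
have I1z z : irr R_ z -> I1 (z ^+ (p ^ e)).
  move=> zi c /=; apply: YI; rewrite -exprM -expnSr rmorphM rmorphXn.
  by apply: split_ideal_frob; apply: (res_loc0 gr R0k locf z).2.
have YR r : Y (f r).
  have [c ->] := flP r; rewrite rmorph_sum; apply: Ysum => l.
  have chR := rmorph_pchar iota chk.
  have := tspan_exp chR (tspan_refine b'P (yP I1 idI1 JI1 I1z (c l))); rewrite -expnS.
  apply: tspan_loc => //.
  move=> _ [_ [t [s [[[j _ <-]|Is] ->]]] <-].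
    by apply: tspanS; left; exists (inr (t, j, l)).
  by rewrite exprMn [iota _ ^+ p * _]mulrC -mulrA; apply: Is.
have YA r : Y r.
  have [u [z [zi ->]]] := loc_approx gr R0k locf r (p ^ e.+1).
  apply: YD => //; apply: YI; rewrite mulrC; apply: split_ideal_frob.
  exact: (res_loc0 gr R0k locf z).2.
have := split_family_le chk v'P YA.
rewrite card_sum !card_prod T'm !card_ord => le.
apply: leq_trans (leq_mul le (leqnn _)) _; rewrite mulnDl; apply: leq_add.
  by rewrite [(a e * _)%N]mulnC.
have -> : (m ^ e * #|T| * #|L| * p ^ e = m ^ e * #|L| * (#|T| * p ^ e))%N.
  by rewrite [(_ * #|L|)%N]mulnAC -mulnA.
have -> : (#|L| * C * (m * p ^ d) ^ e = m ^ e * #|L| * (C * (p ^ e) ^ d))%N.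
  by rewrite expnMn -(expnM p d) -(expnM p e) [(d * e)%N]mulnC; ring.
by rewrite leq_mul2l Tq orbT.
Qed.

End RankGrowth.

(** * The F-signature *)

Section Limit.
Import numFieldNormedType.Exports.
Variable RR : realType.

(* [a e / N ^ e] plus a suitable multiple of [p ^ (- e)] is nonincreasing. *)
Lemma almost_nonincreasing_cvg (a : nat -> nat) (N p K : nat) :
  (1 < p)%N -> (0 < N)%N ->
  (forall e, (a e.+1 * p ^ e <= N * a e * p ^ e + K * N ^ e)%N) ->
  exists s : RR, ((fun e => (a e)%:R / (N ^ e)%:R) @ \oo --> s)%classic.
Proof.
move=> p1 N0 aP.
have Np : 0 < N%:R :> RR by rewrite ltr0n.
have pp : 0 < p%:R :> RR by rewrite ltr0n; apply: ltnW.
(* Divided by N^(e+1) p^e, the recursion has error (K / N) p^(-e). The correction c p^(-e) absorbs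
   it because c / p + K / N <= c, which for p >= 2 holds with c = 2 K / N. *)
pose c : RR := 2 * K%:R / N%:R.
pose g e : RR := c * p%:R^-1 ^+ e.
pose u e : RR := (a e)%:R / (N ^ e)%:R + g e.
have g0 : (g @ \oo --> (0 : RR))%classic.
  rewrite -(mulr0 c); apply: cvgM; first exact: cvg_cst.
  apply: cvg_expr; rewrite ger0_norm ?invr_ge0 ?ltW // invf_lt1 //.
  by rewrite ltr1n.
have c0 : 0 <= c by rewrite /c divr_ge0 ?mulr_ge0 ?ler0n.
have uS : nonincreasing_seq u.
  apply/nonincreasing_seqP => e; rewrite /u /g !natrX !exprS.
  have H : (a e.+1)%:R * p%:R ^+ e <= N%:R * (a e)%:R * p%:R ^+ e + K%:R * N%:R ^+ e :> RR.
    by rewrite -!natrX -!natrM -natrD ler_nat.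
  have Ne : 0 < N%:R ^+ e :> RR by rewrite exprn_gt0.
  have pe : 0 < p%:R ^+ e :> RR by rewrite exprn_gt0.
  have H1 : (a e.+1)%:R / (N%:R * N%:R ^+ e) <= (a e)%:R / N%:R ^+ e + K%:R / N%:R * p%:R^-1 ^+ e :> RR.
    rewrite ler_pdivrMr ?mulr_gt0 // exprVn -(ler_pM2r pe); apply: le_trans H _.
    rewrite le_eqVlt; apply/orP; left; apply/eqP; field.
    by rewrite !gt_eqF.
  have H2 : c * (p%:R^-1 * p%:R^-1 ^+ e) <= K%:R / N%:R * p%:R^-1 ^+ e.
    rewrite mulrA ler_wpM2r //.
    have -> : c * p%:R^-1 = K%:R / N%:R * (2 / p%:R) by rewrite /c; ring.
    by rewrite ler_piMr ?divr_ge0 ?ler0n // ler_pdivrMr // mul1r ler_nat.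
  apply: le_trans (lerD H1 H2) _; rewrite -addrA lerD2l /c.
  by rewrite le_eqVlt; apply/orP; left; apply/eqP; ring.
have ucvg : cvgn u.
  apply: nonincreasing_is_cvgn => //; exists 0 => _ [e _ <-].
  by rewrite addr_ge0 ?divr_ge0 ?ler0n // mulr_ge0 // exprn_ge0 // invr_ge0 ltW.
exists (limn u).
have -> : (fun e => (a e)%:R / (N ^ e)%:R) = (fun e => u e - g e) :> (nat -> RR).
  by apply: funext => e; rewrite /u addrK.
rewrite -[limn u]subr0; exact: cvgB.
Qed.

(** As p^alpha = m, the normalizing factor of the F-signature is the integer N^e of the recursion, N
    = m p^d. *)
Lemma powR_log_degree (p m d e : nat) : (1 < p)%N -> (0 < m)%N ->
  (p ^ e)%:R `^ (d%:R + ln m%:R / ln p%:R) = ((m * p ^ d) ^ e)%:R :> RR.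
Proof.
move=> p1 m0; have pp : 0 < p%:R :> RR by rewrite ltr0n; apply: ltnW.
have mp : 0 < m%:R :> RR by rewrite ltr0n.
have lp : ln p%:R != 0 :> RR by rewrite gt_eqF // ln_gt0 // ltr1n.
have pe : 0 < p%:R ^+ e :> RR by rewrite exprn_gt0.
rewrite natrX powRD; last by apply/implyP => _; rewrite gt_eqF.
rewrite powR_mulrn ?ltW // [X in _ * X]/powR gt_eqF // lnXn //.
have -> : ln m%:R / ln p%:R * (ln p%:R *+ e) = ln m%:R *+ e :> RR.
  by rewrite mulrnAr divfK.
rewrite -lnXn // lnK ?posrE ?exprn_gt0 //.
by rewrite expnMn natrM !natrX -!exprM mulrC [(d * e)%N]mulnC.
Qed.

End Limit.

Section FSignature.
Variables (RR : realType) (p : nat) (k : fieldType) (chk : p \in [pchar k]).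
Hypothesis Fk : F_finite chk.
Variables (R : comNzRingType) (R_ : nat -> {pred R}) (iota : {rmorphism k -> R}).
Hypotheses (gr : graded_ring R_) (noethR : noetherian R) (redR : reduced R).
Hypothesis R0k : forall x, x \in R_ 0%N <-> exists a, x = iota a.
Variables (Rm : localRing) (f : {rmorphism R -> Rm}).
Hypothesis locf : is_localization_at (irrelevant R_) f.

Lemma exists_F_signature : exists s : RR, is_F_signature p Rm s.
Proof.
have p1 : (1 < p)%N by exact/prime_gt1/(pcharf_prime chk).
have chS : p \in [pchar Rm] by exact: (rmorph_pchar (f \o iota) chk).
have [m [b [m0 bP bfree]]] := exists_p_basis Fk.
have [d dimd] := exists_krull_dim gr noethR R0k locf chk.
have nch := krull_dim_no_hchain gr R0k locf dimd.
pose a e := sval (cid (exists_free_rank gr noethR R0k locf chk chS bP nch e)).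
have aP e : free_rank (frob_push chS e) (a e) := svalP (cid (exists_free_rank _ _ _ _ _ _ _ _ e)).
have [K aK] := rank_recursion gr noethR R0k redR locf chk bP nch aP.
have N0 : (0 < m * p ^ d)%N by rewrite muln_gt0 m0 expn_gt0 ltnW.
have [s as_] := almost_nonincreasing_cvg RR p1 N0 aK.
exists s, chS, d, m, a; split=> //; first exact: (residue_degree gr R0k locf chk bP bfree).
move=> alpha; move: as_; rewrite (_ : (fun e => _) = (fun e => (a e)%:R / (p ^ e)%:R `^ (d%:R + alpha))) //.
by apply: funext => e; rewrite powR_log_degree.
Qed.

End FSignature.

(** * Frobenius tensor products *)

Section TensorElements.
Variables (A : comNzRingType) (q : nat) (M : lmodType A).

Definition elem (r : A) (x : M) : frob_tensor q M := tens q [:: (r, x)].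

Lemma elemDl r r' x : elem (r + r') x = elem r x + elem r' x.
Proof. by rewrite /elem -tensD; apply/tensP/frob_addl. Qed.

Lemma elemDr r x x' : elem r (x + x') = elem r x + elem r x'.
Proof. by rewrite /elem -tensD; apply/tensP/frob_addr. Qed.

Lemma elem_bal r b x : elem (r * b ^+ q) x = elem r (b *: x).
Proof. exact/tensP/frob_bal. Qed.

Lemma elemZ a r x : a *: elem r x = elem (a * r) x.
Proof. by rewrite /elem tensZ. Qed.

Lemma elem0 r : elem r 0 = 0.
Proof. by apply: (addrI (elem r 0)); rewrite -elemDr !addr0. Qed.

Lemma elemN r x : elem r (- x) = - elem r x.
Proof. by apply: (addrI (elem r x)); rewrite -elemDr !subrr elem0. Qed.

Lemma elemB r x x' : elem r (x - x') = elem r x - elem r x'.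
Proof. by rewrite elemDr elemN. Qed.

Lemma tens_elem s : tens q s = \sum_(rx <- s) elem rx.1 rx.2.
Proof.
elim: s => [|[r x] s IHs]; first by rewrite big_nil.
by rewrite -cat1s tensD IHs big_cons.
Qed.

Section Lift.
Variables (V : zmodType) (F : A -> M -> V).
Hypothesis FDl : forall r r' x, F (r + r') x = F r x + F r' x.
Hypothesis FDr : forall r x x', F r (x + x') = F r x + F r x'.
Hypothesis Fbal : forall r b x, F (r * b ^+ q) x = F r (b *: x).

(** The universal property of the tensor product; [tens_lift_tens] shows independence of the chosen
    representative. *)
Definition tens_lift (t : frob_tensor q M) : V :=
  \sum_(rx <- tens_repr t) F rx.1 rx.2.

Lemma tens_lift_tens s : tens_lift (tens q s) = \sum_(rx <- s) F rx.1 rx.2.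
Proof.
have : frob_rel q (tens_repr (tens q s)) s by apply/tensP; rewrite tens_reprK.
rewrite /tens_lift; move: (tens_repr _) => s0; elim=> {s0 s} [s|s t _ ->|s t u _ -> _ ->|s s' t t' _ IH _ IH'|s t|x|r r' x|r x x'|r b x] //.
- by rewrite !big_cat /= IH IH'.
- by rewrite !big_cat /= addrC.
- rewrite big_seq1 big_nil /=; apply: (addrI (F 0 x)).
  by rewrite -FDl !addr0.
- by rewrite !big_cons !big_nil !addr0 /= FDl.
- by rewrite !big_cons !big_nil !addr0 /= FDr.
- by rewrite !big_seq1 /= Fbal.
Qed.

Lemma tens_lift_elem r x : tens_lift (elem r x) = F r x.
Proof. by rewrite tens_lift_tens big_seq1. Qed.

Lemma tens_liftD t t' : tens_lift (t + t') = tens_lift t + tens_lift t'.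
Proof.
rewrite -[t]tens_reprK -[t']tens_reprK -tensD !tens_lift_tens.
by rewrite big_cat.
Qed.

Lemma tens_lift0 : tens_lift 0 = 0.
Proof. by apply: (addrI (tens_lift 0)); rewrite -tens_liftD !addr0. Qed.

End Lift.
End TensorElements.

Lemma frob_tensor_map_elem (A : comNzRingType) (q : nat) (M M' : lmodType A)
  (h : {linear M -> M'}) r x :
  frob_tensor_map q h (elem q r x) = elem q r (h x).
Proof. by rewrite /elem frob_tensor_mapE. Qed.

Section KernelOfProjection.
Variables (A : comNzRingType) (q : nat) (M : lmodType A) (N : submodule M) (u : M).
Hypothesis NE : forall x, x \in N <-> exists a : A, x = a *: u.

(** Right exactness: lifting representatives defines a map from the tensor product with M / N back
    to the tensor product with M modulo the multiples of 1 (x) u, and it undoes the projection. The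
    submodule N is kept abstract to serve for both kernels of Condition (B). *)
Lemma ker_frob_proj t :
  t \in ker_submod (frob_tensor_map q (quot_proj N)) <-> exists a, t = elem q a u.
Proof.
split=> [|[a ->]]; last first.
  rewrite inE /= frob_tensor_map_elem.
  have E : quot_proj N u = 0.
    rewrite -(linear0 (quot_proj N)); apply/quot_projP; rewrite subr0; apply/NE.
    by exists 1; rewrite scale1r.
  by apply/eqP/(etrans (congr1 (elem q a) E)); rewrite elem0.
rewrite inE => /eqP t0.
pose L := line (elem q 1 u).
have LN r x : x \in N -> elem q r x \in L.
  move=> /NE[a ->]; apply/asboolP; exists (r * a ^+ q).
  by rewrite elemZ mulr1 elem_bal.
pose F r (y : quot_module N) : quot_module L := quot_proj L (elem q r (quot_repr y)).
have FN r x y : x - y \in N -> quot_proj L (elem q r x) = quot_proj L (elem q r y).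
  by move=> /LN H; apply/quot_projP; rewrite -elemB; apply: H.
have FDl r r' y : F (r + r') y = F r y + F r' y by rewrite /F elemDl linearD.
have FDr r y y' : F r (y + y') = F r y + F r y'.
  rewrite /F -linearD -elemDr; apply: FN; apply/quot_projP.
  by rewrite quot_reprK quot_projD !quot_reprK.
have Fbal r b y : F (r * b ^+ q) y = F r (b *: y).
  rewrite /F elem_bal; apply: FN; apply/quot_projP.
  by rewrite quot_reprK linearZ /= quot_reprK.
have liftE s : tens_lift F (frob_tensor_map q (quot_proj N) s) = quot_proj L s.
  rewrite -[s]tens_reprK frob_tensor_mapE (tens_lift_tens FDl FDr Fbal) big_map.
  rewrite [X in quot_proj L X]tens_elem linear_sum; apply: eq_bigr => rx _ /=.
  by apply: FN; apply/quot_projP; rewrite quot_reprK.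
have : quot_proj L t = 0.
  by rewrite -liftE t0; apply: tens_lift0.
rewrite -(linear0 (quot_proj L)) => /quot_projP; rewrite subr0 => /asboolP[a ->].
by exists a; rewrite elemZ mulr1.
Qed.

End KernelOfProjection.

(** * Invariance of length and comparison of the two kernels *)

Section Length.
Variable A : comNzRingType.

Lemma has_length_iso (M N : lmodType A) n : isomorphic M N -> has_length M n -> has_length N n.
Proof.
move=> [h [g hK gK]] [C [C0 Cn CS]].
have gL : linear g by apply: linear_inv hK gK.
pose gl := linear_of gL.
exists (fun i => preim_submod gl (C i)); split.
- move=> x; rewrite inE C0; apply/eqP/eqP => [gx|->]; last exact: (linear0 gl).
  by rewrite -[x]gK [g x]gx linear0.
- by move=> x; rewrite inE.
- move=> i ni; have [sub ne max] := CS i ni; split.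
  + by move=> x; rewrite !inE; apply: sub.
  + by move=> E; apply: ne => x; have := E (h x); rewrite !inE /= hK.
  + move=> B CB BC; have [||EB|EB] := max (preim_submod h B).
    * by move=> x Cx; rewrite inE; apply: CB; rewrite inE /= hK.
    * by move=> x; rewrite inE => /BC; rewrite inE /= hK.
    * by left=> x; have := EB (g x); rewrite !inE gK.
    * by right=> x; have := EB (g x); rewrite !inE gK.
Qed.

Lemma isomorphic_sym (M N : lmodType A) : isomorphic M N -> isomorphic N M.
Proof.
move=> [h [g hK gK]]; exists (linear_of (linear_inv hK gK)).
by exists h.
Qed.

(** [module_length] chooses a value from the predicate [has_length], so equality of the two
    predicates forces equality of the choices. *)
Lemma module_length_iso (M N : lmodType A) :
  isomorphic M N -> module_length M = module_length N.
Proof.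
move=> MN; rewrite /module_length /finite_length.
have -> : has_length M = has_length N; last by [].
apply: funext => n; apply: propext; split; apply: has_length_iso => //.
exact: isomorphic_sym.
Qed.

Lemma isomorphic_bij (M N : lmodType A) (F : M -> N) : linear F -> injective F ->
  (forall y, exists x, F x = y) -> isomorphic M N.
Proof.
move=> FL Finj Fsurj.
apply: (@isomorphic_of _ _ _ F (fun y => sval (cid (Fsurj y)))) => //.
  by move=> x; apply: Finj; exact: (svalP (cid (Fsurj (F x)))).
by move=> y; exact: (svalP (cid (Fsurj y))).
Qed.

End Length.

Section KernelLengths.
Variables (S : localRing) (q : nat) (E : lmodType S) (u : E) (E' : submodule E).
Variable uE' : u \in E'.

Let u' : submod_type E' := exist _ u uE'.

Hypothesis elem_inj : forall s : S, elem q s u = 0 -> elem q s u' = 0.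

Lemma kernel_lengths :
  module_length (submod_type (ker_submod (phi_map q u))) =
  module_length (submod_type (ker_submod (psi_map q u E'))).
Proof.
pose N' := preim_submod (submod_incl (N := E')) (line u).
have NE x : x \in line u <-> exists a : S, x = a *: u by split=> /asboolP.
have NE' x : x \in N' <-> exists a : S, x = a *: u'.
  split=> [/asboolP[a xa]|[a ->]]; last by apply/asboolP; exists a.
  by exists a; apply: val_inj; exact: xa.
have kphi t : t \in ker_submod (phi_map q u) <-> exists a, t = elem q a u.
  exact: ker_frob_proj.
have kpsi t : t \in ker_submod (psi_map q u E') <-> exists a, t = elem q a u'.
  exact: ker_frob_proj.
apply/esym/module_length_iso.
pose theta := frob_tensor_map q (submod_incl (N := E')).
have thetaE a : theta (elem q a u') = elem q a u by rewrite /theta frob_tensor_map_elem.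
have thetaP (x : submod_type (ker_submod (psi_map q u E'))) :
    theta (val x) \in ker_submod (phi_map q u).
  by apply/kphi; have /kpsi[a ->] := valP x; exists a.
pose F (x : submod_type (ker_submod (psi_map q u E'))) :
  submod_type (ker_submod (phi_map q u)) := exist _ (theta (val x)) (thetaP x).
have FL : linear F.
  by move=> a x y; apply: val_inj; exact: (linearP theta a (val x) (val y)).
apply: (isomorphic_bij FL).
- move=> x y /(congr1 val) Fxy; have {Fxy} : theta (val x) = theta (val y) := Fxy.
  have /kpsi[a xa] := valP x; have /kpsi[b yb] := valP y.
  rewrite xa yb !thetaE => ab; apply: val_inj; rewrite xa yb.
  have elB (M : lmodType S) (w : M) : elem q (a - b) w = elem q a w - elem q b w.
    by apply/eqP; rewrite eq_sym subr_eq -elemDl subrK.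
  by apply/eqP; rewrite -subr_eq0 -elB elem_inj // elB ab subrr.
- move=> [t tk]; have /kphi[a ta] := tk.
  have ak : elem q a u' \in ker_submod (psi_map q u E') by apply/kpsi; exists a.
  exists (exist (fun t => t \in ker_submod (psi_map q u E')) _ ak).
  by apply: val_inj; rewrite [RHS]ta; exact: thetaE.
Qed.

End KernelLengths.

Lemma submodD (A : comNzRingType) (M : lmodType A) (N : submodule M) x y :
  x \in N -> y \in N -> x + y \in N.
Proof. by move=> Nx Ny; have := (submodP N).2 1 x y Nx Ny; rewrite scale1r. Qed.

Lemma submodZ (A : comNzRingType) (M : lmodType A) (N : submodule M) a x :
  x \in N -> a *: x \in N.
Proof. by move=> Nx; have := (submodP N).2 a x 0 Nx (submodP N).1; rewrite addr0. Qed.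

(** * Annihilators in the injective hull *)

Section FiniteLengthSubmodules.
Variables (A : comNzRingType) (M : lmodType A).

(** A composition series of D made of submodules of M, so that it can be prolonged to a larger
    submodule within the same type. *)
Definition fl_submod (D : submodule M) : Prop :=
  exists (n : nat) (C : nat -> submodule M),
  [/\ forall x, (x \in C 0%N) = (x == 0), forall x, (x \in C n) = (x \in D)
    & forall i, (i < n)%N -> [/\ {subset C i <= C i.+1}, ~ C i =i C i.+1
          & forall B : submodule M, {subset C i <= B} -> {subset B <= C i.+1} ->
              B =i C i \/ B =i C i.+1]].

Lemma fl_submod0 (D : submodule M) : (forall x, x \in D -> x = 0) -> fl_submod D.
Proof.
move=> D0; exists 0%N, (fun=> D); split=> // x; apply/idP/eqP => [/D0//|->].
exact: (submodP D).1.
Qed.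

Lemma fl_submod_step (D D' : submodule M) : fl_submod D -> {subset D <= D'} ->
  (forall B : submodule M, {subset D <= B} -> {subset B <= D'} -> B =i D \/ B =i D') ->
  fl_submod D'.
Proof.
move=> [n [C [C0 Cn CS]]] DD' simple; have [E|ne] := EM (D =i D').
  by exists n, C; split=> // x; rewrite Cn E.
exists n.+1, (fun i => if (i <= n)%N then C i else D'); split=> //.
  by rewrite ltnn.
move=> i ile; have /orP[/eqP->|ni] : (i == n) || (i < n)%N by rewrite -leq_eqVlt -ltnS.
  rewrite /= leqnn ltnn; split.
  - by move=> x; rewrite Cn; apply: DD'.
  - by move=> E; apply: ne => x; rewrite -Cn E.
  - move=> B CB BD; case: (simple B) => //; first by move=> x Dx; apply: CB; rewrite Cn.
      by move=> E; left=> x; rewrite E Cn.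
    by right.
by rewrite /= (ltnW ni) ni; apply: CS.
Qed.

Lemma finite_length_submod D : fl_submod D -> finite_length (submod_type D).
Proof.
move=> [n [C [C0 Cn CS]]]; exists n.
have CD i : (i <= n)%N -> {subset C i <= D}.
  move=> ni x Cx; rewrite -Cn; elim: n ni {Cn} CS => [|n IHn]; first by rewrite leqn0 => /eqP<-.
  rewrite leq_eqVlt => /orP[/eqP<-//|ni] CS; have [sub _ _] := CS n (ltnSn n).
  by apply: sub; apply: IHn => // m mn; apply: CS; apply: ltnW.
exists (fun i => preim_submod (submod_incl (N := D)) (C i)); split.
- by move=> x; rewrite inE C0 -(inj_eq val_inj).
- by move=> x; rewrite inE Cn; exact: valP.
- move=> i ni; have [sub ne max] := CS i ni; split.
  + by move=> x; rewrite !inE; apply: sub.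
  + move=> E; apply: ne => x; apply/idP/idP => [/sub//|Cx].
    have Dx := CD _ ni x Cx.
    by have := E (exist _ x Dx); rewrite !inE /submod_incl /= Cx.
  + move=> B CB BC.
    have imB : submod_closed (fun x : M => `[< exists2 y : submod_type D, y \in B & val y = x >]).
      split=> [|a x y]; first by apply/asboolP; exists 0 => //; exact: (submodP B).1.
      move=> /asboolP[x' Bx <-] /asboolP[y' By <-]; apply/asboolP; exists (a *: x' + y') => //.
      exact: (submodP B).2.
    have BE x (Dx : x \in D) : (x \in Submodule imB) = (exist _ x Dx \in B).
      apply/asboolP/idP => [[y By yx]|Bx]; last by exists (exist _ x Dx).
      by rewrite (_ : exist _ x Dx = y) //; apply: val_inj.
    case: (max (Submodule imB)) => [x Cx|x /asboolP[y By <-]|E|E].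
    * have Dx := CD _ (ltnW ni) x Cx; rewrite BE; apply: CB; by rewrite inE.
    * by have := BC y By; rewrite inE.
    * by left=> -[x Dx]; rewrite -BE E inE.
    * by right=> -[x Dx]; rewrite -BE E inE.
Qed.

End FiniteLengthSubmodules.

Section Annihilators.
Variables (k : fieldType) (R : comNzRingType) (R_ : nat -> {pred R}).
Variable iota : {rmorphism k -> R}.
Hypotheses (gr : graded_ring R_) (noethR : noetherian R).
Hypothesis R0k : forall x, x \in R_ 0%N <-> exists a, x = iota a.
Variables (Rm : localRing) (f : {rmorphism R -> Rm}).
Hypothesis locf : is_localization_at (irrelevant R_) f.
Variables (E : lmodType Rm) (j : {linear residue_module Rm -> E}) (u : E).
Hypotheses (hull : injective_hull j).
Hypothesis socE : forall x, socle E x <-> x \in line u.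

Local Notation hc := (hc R_).

Definition Rgt (N : nat) : set R := [set r | forall i, (i <= N)%N -> hc i r = 0].

Lemma Rgt_ideal N : is_ideal (Rgt N).
Proof.
split=> [i _|x y Nx Ny i iN|a x Nx i iN] /=.
- exact: hc0.
- by rewrite (hcD gr) Nx // Ny // addr0.
- rewrite (hcM gr) big1 // => l _; rewrite Nx ?mulr0 //.
  by apply: leq_trans iN; apply: leq_subr.
Qed.

(* Below the irrelevant ideal, a homogeneous [z] of maximal degree outside [J]
   is killed by the irrelevant ideal modulo [J]. *)
Lemma annihilator_ind (Pr : set R -> Prop) N :
  (forall J, is_ideal J -> (irr R_ `<=` J)%classic -> Pr J) ->
  (forall J z, is_ideal J -> (forall y, irr R_ y -> J (y * z)) -> Pr (addI J z) -> Pr J) ->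
  forall J, is_ideal J -> (Rgt N `<=` J)%classic -> Pr J.
Proof.
move=> base step; apply: (noetherian_ind noethR) => J idJ IH NJ.
have [irrJ|/nonsubset[y [yi nJy]]] := EM (irr R_ `<=` J)%classic; first exact: base.
pose bad i := `[< exists2 z, z \in R_ i & ~ J z >].
have exbad : exists i, bad i.
  have [i nJi] := hideal_notin gr idJ nJy; exists i; apply/asboolP.
  by exists (hc i y) => //; apply: hc_in.
have badN i : bad i -> (i <= N)%N.
  move=> /asboolP[z Rz nJz]; rewrite leqNgt; apply/negP => Ni; apply: nJz; apply: NJ => l lN.
  by rewrite (hc_hom gr _ Rz) ltn_eqF // (leq_ltn_trans lN).
have [i /asboolP[z Rz nJz] maxi] := ex_maxnP exbad badN.
have Jyz w : irr R_ w -> J (w * z).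
  move=> w0; have [n /(_ n.+1 (leqnSn n))[-> _]] := hc_bound gr w.
  rewrite mulr_suml; apply: is_ideal_sum => // l _; case: l => -[|l] lt /=.
    by rewrite w0 mul0r; case: idJ.
  apply: contrapT => nJ; have : bad (l.+1 + i)%N.
    by apply/asboolP; exists (hc l.+1 w * z) => //; apply: gradedM => //; apply: hc_in.
  by move/maxi; rewrite addSn ltnNge leq_addl.
apply: (step J z) => //; apply: IH.
- exact: addI_ideal.
- exact: addI_sub.
- by move/(_ z (addI_gen z idJ)).
- by apply: subset_trans NJ _; apply: addI_sub.
Qed.

Lemma ann_closed (J : set R) : submod_closed [pred x : E | `[< forall r, J r -> f r *: x = 0 >]].
Proof.
split=> [|a x y]; first by apply/asboolP => r _; rewrite scaler0.
move=> /asboolP Jx /asboolP Jy; apply/asboolP => r Jr.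
by rewrite scalerDr scalerA mulrC -scalerA Jx // Jy // scaler0 addr0.
Qed.
Definition ann (J : set R) : submodule E := Submodule (ann_closed J).

Lemma annP (J : set R) x : x \in ann J <-> forall r, J r -> f r *: x = 0.
Proof. by split=> /asboolP. Qed.

Lemma res_unit c : res Rm c <> 0 -> exists d, c * d = 1.
Proof. by move=> /eqP; apply: res_local. Qed.

Lemma res0_irr c : res Rm c = 0 -> exists w y, irr R_ y /\ c = w * f y.
Proof.
move=> c0; have [y [s [s1 cs]]] := loc_frac gr R0k locf c.
have [|d sd] := loc_unit gr locf (s := s); first by rewrite s1 oner_eq0.
exists d, y; split; last by rewrite -cs mulrCA [d * _]mulrC sd mulr1.
by apply/(res_loc0 gr R0k locf); rewrite -cs rmorphM c0 mul0r.
Qed.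

Lemma lineP x : x \in line u <-> exists a : Rm, x = a *: u.
Proof. by split=> /asboolP. Qed.

Lemma socle_gen c : res Rm c = 0 -> c *: u = 0.
Proof. by have /socE := (lineP u).2 (ex_intro _ 1 (esym (scale1r u))); apply. Qed.

Lemma socle_gen_neq0 : u <> 0.
Proof.
case: hull => jinj _ _ u0.
have /socE/lineP[a ja] : socle E (j (1 : residue Rm)).
  move=> a a0; rewrite -linearZ; have -> : a *: (1 : residue_module Rm) = 0.
    by rewrite /GRing.scale /= /residue_scale a0 mul0r.
  by rewrite linear0.
have /jinj/eqP : j (1 : residue Rm) = j 0 by rewrite ja u0 scaler0 linear0.
by rewrite oner_eq0.
Qed.

Lemma scale_socle_gen0 c : c *: u = 0 -> res Rm c = 0.
Proof.
move=> cu; apply: contrapT => /res_unit[d cd]; apply: socle_gen_neq0.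
by rewrite -[u]scale1r -cd mulrC -scalerA cu scaler0.
Qed.

Lemma socle_irr x : (forall y, irr R_ y -> f y *: x = 0) -> exists a, x = a *: u.
Proof.
move=> Hx; apply/lineP/socE => c /res0_irr[w [y [yi ->]]].
by rewrite -scalerA Hx // scaler0.
Qed.

Section Step.
Variables (J : set R) (z : R).
Hypotheses (idJ : is_ideal J) (Jz : forall y, irr R_ y -> J (y * z)).

Lemma ann_addI x : x \in ann J -> f z *: x = 0 -> x \in ann (addI J z).
Proof.
move=> /annP Jx zx; apply/annP => r [t Jr].
rewrite -[r](subrK (t * z)) rmorphD scalerDl Jx // rmorphM -scalerA zx.
by rewrite scaler0 addr0.
Qed.

Lemma ann_addI_sub x : x \in ann (addI J z) -> x \in ann J.
Proof. by move=> /annP Jx; apply/annP => r Jr; apply: Jx; apply: addI_sub. Qed.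

(** Multiplication by z sends [ann J] into the socle, with kernel [ann (addI J z)]: the quotient of
    the two annihilators has length at most one. Both inductions over J below rest on this. *)
Lemma ann_mul_gen x : x \in ann J -> exists c, f z *: x = c *: u.
Proof.
move=> /annP Jx; apply: socle_irr => y yi.
by rewrite scalerA -rmorphM Jx //; apply: Jz.
Qed.

Lemma ann_socle_part c x : res Rm c = 0 -> x \in ann J -> c *: x \in ann (addI J z).
Proof.
move=> c0 Jx; apply: ann_addI; first exact: submodZ.
have [d zx] := ann_mul_gen Jx.
by rewrite scalerA mulrC -scalerA zx scalerA mulrC -scalerA socle_gen // scaler0.
Qed.

Lemma ann_gen_unit x : x \in ann J -> f z *: x <> 0 ->
  exists2 x1, f z *: x1 = u & exists c, x1 = c *: x.
Proof.
move=> Jx zx; have [t zt] := ann_mul_gen Jx.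
have [|d td] := @res_unit t.
  by move=> t0; apply: zx; rewrite zt; apply: socle_gen.
exists (d *: x); last by exists d.
by rewrite scalerA mulrC -scalerA zt scalerA mulrC td scale1r.
Qed.

End Step.

Lemma ann_finite_length N : finite_length (submod_type (ann (Rgt N))).
Proof.
apply: finite_length_submod.
apply: (annihilator_ind (Pr := fun J => fl_submod (ann J)) (N := N)) => //.
- move=> J idJ irrJ; apply: (fl_submod_step (D := ker_submod idfun)).
  + by apply: fl_submod0 => x; rewrite inE => /eqP.
  + by move=> x; rewrite inE => /eqP x0; have -> : x = 0 := x0; exact: (submodP (ann J)).1.
  + move=> B _ BJ.
    have Bline x : x \in ann J -> exists a, x = a *: u.
      by move=> /annP Jx; apply: socle_irr => y /irrJ; apply: Jx.
    have [[x Bx x0]|H] := EM (exists2 x, x \in B & x <> 0); last first.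
      left=> x; rewrite inE; apply/idP/eqP => [Bx|x0]; last first.
        by have -> : x = 0 := x0; exact: (submodP B).1.
      by apply: contrapT => x0; apply: H; exists x.
    right=> y; apply/idP/idP => [/BJ//|Jy].
    have [a xa] := Bline x (BJ x Bx); have [b yb] := Bline y Jy.
    have [|d ad] := @res_unit a; first by move=> a0; apply: x0; rewrite xa socle_gen.
    have -> : y = (b * d) *: x by rewrite xa scalerA -mulrA [d * a]mulrC ad mulr1.
    exact: submodZ.
- move=> J z idJ Jz flJz; apply: fl_submod_step flJz _ _; first by move=> x; apply: ann_addI_sub.
  move=> B DB BJ.
  have [[x Bx zx]|H] := EM (exists2 x, x \in B & f z *: x <> 0).
    right=> y; apply/idP/idP => [/BJ//|Jy].
    have [x1 zx1 [c x1E]] := ann_gen_unit Jz (BJ x Bx) zx.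
    have Bx1 : x1 \in B by rewrite x1E; apply: submodZ.
    have [b zy] := ann_mul_gen Jz Jy.
    rewrite -[y](subrK (b *: x1)); apply: submodD; last exact: submodZ.
    apply: DB; apply: ann_addI => //.
      by rewrite -scaleN1r; apply: submodD => //; do 2!apply: submodZ; apply: BJ.
    by rewrite scalerBr scalerA mulrC -scalerA zx1 zy subrr.
  left=> x; apply/idP/idP => [Bx|/DB//]; apply: ann_addI => //; first exact: BJ.
  by apply: contrapT => zx; apply: H; exists x.
- exact: Rgt_ideal.
Qed.

(* Matlis duality on modules of finite length: endomorphisms of the injective
   hull act on an annihilator by multiplication. *)
Lemma ann_endo N (h : {linear E -> E}) : exists a : Rm,
  forall x, x \in ann (Rgt N) -> h x = a *: x.
Proof.
move: h; apply: (annihilator_ind (N := N)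
  (Pr := fun J => forall h : {linear E -> E}, exists a : Rm, forall x, x \in ann J -> h x = a *: x)) => //.
- move=> J idJ irrJ h.
  have [c hu] : exists c, h u = c *: u.
    apply: socle_irr => y yi; rewrite -linearZ socle_gen ?linear0 //.
    exact/(res_loc0 gr R0k locf).
  exists c => x /annP Jx; have [|a ->] := @socle_irr x; first by move=> y /irrJ; apply: Jx.
  by rewrite linearZ /= hu !scalerA mulrC.
- move=> J z idJ Jz IH h; have [a ha] := IH h.
  have [[x0 Jx0 zx0]|H] := EM (exists2 x, x \in ann J & f z *: x <> 0); last first.
    exists a => x Jx; apply: ha; apply: ann_addI => //.
    by apply: contrapT => zx; apply: H; exists x.
  have [x1 zx1 [d x1E]] := ann_gen_unit Jz Jx0 zx0.
  have Jx1 : x1 \in ann J by rewrite x1E; apply: submodZ.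
  have [c hx1] : exists c, h x1 - a *: x1 = c *: u.
    apply: socle_irr => y yi; have fy0 := (res_loc0 gr R0k locf y).2 yi.
    rewrite scalerBr scalerA mulrC -scalerA -linearZ /= -ha ?subrr //.
    exact: ann_socle_part.
  (* Since [f z *: x1 = u], the term [c * f z] corrects the multiplier a at [x1], and it acts as
     zero on [ann (addI J z)]. *)
  exists (a + c * f z) => x Jx; have [b zx] := ann_mul_gen Jz Jx.
  have : x - b *: x1 \in ann (addI J z).
    apply: ann_addI.
      by rewrite -scaleN1r; apply: submodD => //; do 2!apply: submodZ.
    by rewrite scalerBr scalerA mulrC -scalerA zx1 zx subrr.
  move=> /ha; rewrite linearB linearZ /= => /eqP; rewrite subr_eq => /eqP->.
  rewrite scalerBr [a *: (b *: x1)]scalerA mulrC -scalerA -addrA [- _ + _]addrC -scalerBr hx1.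
  by rewrite scalerDl -!scalerA zx !scalerA [c * b]mulrC.
- exact: Rgt_ideal.
Qed.

Lemma Rgt_unit N v a : hc 0 v != 0 -> Rgt N (v * a) -> Rgt N a.
Proof.
move=> v0 Na i; have [n] := ubnP i; elim: n i => // n IHn i ni iN.
have := Na i iN; rewrite (hcM gr) big_ord_recl subn0 big1 => [|l _]; last first.
  rewrite IHn ?mulr0 //=; last by apply: leq_trans iN; apply: leq_subr.
  by move: (ltn_ord l); rewrite /bump /=; lia.
have [c vc] := graded0_unit R0k (hc_in gr 0 v) v0.
by rewrite addr0 => /(congr1 ( *%R c)); rewrite mulr0 mulrA [c * _]mulrC vc mul1r.
Qed.

(** If a is not in R_(>N), then r f(a) |-> r u is well defined on the ideal generated by f(a) and
    R_(>N), modulo the latter. Its extension to R_m sends 1 to an element killed by R_(>N) which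
    f(a) maps to u, a nonzero element. *)
Lemma ann_faithful N a : (forall x, x \in ann (Rgt N) -> f a *: x = 0) -> Rgt N a.
Proof.
move=> Ha; apply: contrapT => nNa.
have idI := loc_ext_ideal gr R0k locf (Rgt_ideal N).
case: (idI) => I0 ID IM; pose I := loc_ext R_ f (Rgt N).
have resI t : I (t * f a) -> res Rm t = 0.
  move=> It; apply: contrapT => /res_unit[d td]; apply: nNa.
  have : I (f a) by rewrite -[f a]mul1r -td -mulrA mulrCA; apply: IM.
  move=> [c [s [Nc s0]]]; rewrite -rmorphM => /(loc_eq gr locf)[w [w0 E1]].
  apply: (Rgt_unit (v := w * s)); first exact: (hc0_mul_neq0 gr R0k).
  rewrite -mulrA [s * a]mulrC E1; by case: (Rgt_ideal N) => _ _; apply.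
have clA : submod_closed (fun b : Rm^o => `[< exists r, I (b - r * f a) >]).
  split=> [|c x y]; first by apply/asboolP; exists 0; rewrite mul0r subr0.
  move=> /asboolP[r Ir] /asboolP[r' Ir']; apply/asboolP; exists (c * r + r').
  have -> : c *: x + y - (c * r + r') * f a = c * (x - r * f a) + (y - r' * f a).
    by rewrite /GRing.scale /=; ring.
  by apply: ID => //; apply: IM.
pose AA := Submodule clA.
have exr (b : submod_type AA) : exists r, I (val b - r * f a) by have /asboolP := valP b.
pose rr b := sval (cid (exr b)).
have rrP b r : I (val b - r * f a) -> rr b *: u = r *: u.
  move=> Ib; apply/eqP; rewrite -subr_eq0 -scalerBl socle_gen //; apply: resI.
  have -> : (rr b - r) * f a = (val b - r * f a) - (val b - rr b * f a) by ring.
  by apply: is_idealB => //; exact: (svalP (cid (exr b))).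
have gL : linear (fun b : submod_type AA => rr b *: u : E).
  move=> c x y; rewrite scalerA -scalerDl; apply: rrP.
  have -> : val (c *: x + y) = c * val x + val y :> Rm by [].
  have -> : c * val x + val y - (c * rr x + rr y) * f a =
      c * (val x - rr x * f a) + (val y - rr y * f a) by ring.
  by apply: ID; [apply: IM|]; exact: (svalP (cid (exr _))).
have [_ injE _] := hull.
have [|h hP] := injE _ _ (submod_incl (N := AA)) (linear_of gL); first exact: val_inj.
have hb b r (Ib : I (b - r * f a)) : h (b : Rm^o) = r *: u.
  have bA : (b : Rm^o) \in AA by apply/asboolP; exists r.
  by have := hP (exist _ (b : Rm^o) bA); rewrite linear_ofE (rrP _ r).
have hZ c : c *: h (1 : Rm^o) = h (c : Rm^o).
  by rewrite -linearZ; congr (h _); rewrite /GRing.scale /= mulr1.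
apply: socle_gen_neq0; rewrite -[u]scale1r -(hb (f a) 1) ?mul1r ?subrr //.
rewrite -hZ; apply: Ha; apply/annP => r Nr; rewrite hZ (hb _ 0) ?scale0r //.
rewrite mul0r subr0; exists r, 1; split=> //; last by rewrite rmorph1 mulr1.
by rewrite (hc01 gr) oner_eq0.
Qed.

End Annihilators.

(** * Lifting p^e-linear maps *)

Section Syzygies.
Variables (k : fieldType) (R : comNzRingType) (R_ : nat -> {pred R}).
Variable iota : {rmorphism k -> R}.
Hypotheses (gr : graded_ring R_) (noethR : noetherian R).
Hypothesis R0k : forall x, x \in R_ 0%N <-> exists a, x = iota a.
Variables (S : finType) (y : S -> R) (dg : S -> nat).
Hypothesis yP : hom_gens R_ y dg (@zeroI R) 1.

Local Notation hc := (hc R_).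

(* [homog n a r]: [r] is homogeneous of degree [n - a], and zero if [n < a]. *)
Definition homog (n a : nat) (r : R) : Prop := forall i, (i + a)%N != n -> hc i r = 0.

Lemma homog0 n a : homog n a 0.
Proof. by move=> i _; apply: hc0. Qed.

Lemma homog_sum n a (T : finType) (F : T -> R) :
  (forall t, homog n a (F t)) -> homog n a (\sum_t F t).
Proof. by move=> FP i ia; rewrite (hc_sum gr) big1 // => t _; apply: FP. Qed.

Lemma homog_hom n a r : (a <= n)%N -> r \in R_ (n - a)%N -> homog n a r.
Proof.
move=> an Rr i ia; rewrite (hc_hom gr _ Rr); case: eqP => // E.
by rewrite E subnK ?eqxx in ia.
Qed.

Lemma homog_in n a r : (a <= n)%N -> homog n a r -> r \in R_ (n - a)%N.
Proof.
move=> an hr; suff <- : hc (n - a) r = r by apply: hc_in.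
apply/eqP; rewrite -subr_eq0; apply/eqP/(hc_eq0 gr) => i.
rewrite (hcB gr) (hc_hom gr _ (hc_in gr _ r)); case: eqP => [->|ni]; first by rewrite subrr.
by rewrite sub0r hr ?oppr0 //; apply/eqP => E; apply: ni; rewrite -E addnK.
Qed.

Lemma homog_eq0 n a r : (n < a)%N -> homog n a r -> r = 0.
Proof.
move=> na hr; apply: (hc_eq0 gr) => i; apply: hr; apply/eqP => E.
by move: na; rewrite -E ltnNge leq_addl.
Qed.

(** The syzygies of y are finitely generated. In weight beyond that of the generators, their
    coefficients have positive degree and so are combinations of the [y v]. *)
Lemma syzygies_bounded : exists delta, forall n, (delta < n)%N ->
  forall g : S -> R, (forall t, homog n (dg t) (g t)) -> \sum_t y t * g t = 0 ->
  exists zeta : S -> S -> R, [/\ forall v t, homog n (dg v + dg t) (zeta v t),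
    forall v, \sum_t y t * zeta v t = 0 & forall t, g t = \sum_v y v * zeta v t].
Proof.
pose Z : set ('I_#|S| -> R) := fun v => \sum_t y t * v (enum_rank t) = 0.
have [|v w Zv Zw|a v Zv|T [z [Zz zP]]] := @noetherian_fg_submodule R noethR #|S| Z.
- by rewrite /Z big1 // => t _; rewrite mulr0.
- rewrite /Z; under eq_bigr do rewrite mulrDr.
  by rewrite big_split /= [X in X + _]Zv [X in _ + X]Zw addr0.
- rewrite /Z; under eq_bigr do rewrite mulrCA.
  by rewrite -mulr_sumr [X in _ * X]Zv mulr0.
pose z' i t := z i (enum_rank t).
have [d0 d0P] := exists_Rle_family gr (fun it : T * S => z' it.1 it.2).
(* The part of weight d of the i-th generator, again a syzygy. *)
pose zc i d t := if (dg t <= d)%N then hc (d - dg t) (z' i t) else 0.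
have zcsyz i d : \sum_t y t * zc i d t = 0.
  transitivity (hc d (\sum_t y t * z' i t)); last by rewrite [X in hc d X]Zz; apply: hc0.
  rewrite (hc_sum gr); apply: eq_bigr => t _; rewrite (hc_Ml gr _ _ (yP.1 t).2) /zc.
  by case: ifP => // _; rewrite mulr0.
(* Coordinates of generators have degree at most d0, so their part of weight n > delta vanishes, and
   with it the term where the coefficient has degree 0. *)
exists (d0 + \max_t dg t)%N => n dn g hg gsyz.
have [|a aE] := zP (fun i => g (enum_val i)).
  by rewrite /Z -[RHS]gsyz; apply: eq_bigr => t _; rewrite enum_rankK.
have gE t : g t = \sum_i a i * z' i t.
  by have := aE (enum_rank t); rewrite enum_rankK.
have gE' t : g t = \sum_i \sum_(l < n.+1) hc l (a i) * zc i (n - l)%N t.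
  have [tn|nt] := leqP (dg t) n; last first.
    rewrite (homog_eq0 nt (hg t)) big1 // => i _; rewrite big1 // => l _.
    by rewrite /zc leqNgt (leq_ltn_trans (leq_subr _ _) nt) mulr0.
  have := hc_hom gr (n - dg t) (homog_in tn (hg t)); rewrite eqxx => {1}<-.
  rewrite gE (hc_sum gr); apply: eq_bigr => i _; rewrite (hcM gr).
  rewrite (eq_bigr (fun l : 'I_(n - dg t).+1 => hc l (a i) * zc i (n - l)%N t)); last first.
    move=> l _; rewrite /zc subnAC ifT //.
    by move: (ltn_ord l) tn; lia.
  apply: (sum_wide (c := fun l => hc l (a i) * zc i (n - l)%N t)); first by rewrite ltnS leq_subr.
  by move=> l ln; rewrite /zc ifN ?mulr0 // -ltnNge; move: ln tn (yP.1 t).1; lia.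
have zc0 i t : zc i n t = 0.
  rewrite /zc; case: ifP => // tn; apply: (d0P (i, t)).
  by rewrite ltn_subRL addnC (leq_ltn_trans _ dn) // leq_add2l; apply: (leq_bigmax t).
have exc i l : exists c : S -> R, (forall v, homog l (dg v) (c v)) /\
    ((0 < l)%N -> hc l (a i) = \sum_v c v * y v).
  have [->|l0] := posnP l; first by exists (fun=> 0); split=> // v; apply: homog0.
  have [c [cR c0 cE]] := hom_gens_coef gr (zeroI_hideal gr) yP l0 (hc_in gr l (a i)).
  exists c; split=> [v|_]; last by apply/eqP; rewrite -subr_eq0; apply/eqP.
  have [vl|lv] := leqP (dg v) l; first by apply: homog_hom => //; apply: cR.
  by rewrite c0 //; apply: homog0.
pose c i l := sval (cid (exc i l)).
have cP i l : (forall v, homog l (dg v) (c i l v)) /\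
    ((0 < l)%N -> hc l (a i) = \sum_v c i l v * y v) := svalP (cid (exc i l)).
exists (fun v t => \sum_i \sum_(l < n.+1) c i l v * zc i (n - l)%N t); split.
- move=> v t; apply: homog_sum => i; apply: homog_sum => l.
  have ln : (l <= n)%N by rewrite -ltnS.
  have [vl|lv] := leqP (dg v) l; last first.
    by rewrite (homog_eq0 lv ((cP i l).1 v)) mul0r; apply: homog0.
  rewrite /zc; case: ifP => tnl; last by rewrite mulr0; apply: homog0.
  apply: homog_hom; first by move: ln vl tnl; lia.
  have -> : (n - (dg v + dg t) = (l - dg v) + (n - l - dg t))%N by move: ln vl tnl; lia.
  by apply: gradedM => //; [apply: homog_in => //; exact: (cP i l).1|apply: hc_in].
- move=> v; under eq_bigr do rewrite mulr_sumr.
  rewrite exchange_big big1 //= => i _.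
  under eq_bigr do rewrite mulr_sumr.
  rewrite exchange_big big1 //= => l _.
  under eq_bigr do rewrite mulrCA.
  by rewrite -mulr_sumr zcsyz mulr0.
- move=> t; rewrite gE'.
  under [RHS]eq_bigr do rewrite mulr_sumr.
  rewrite [RHS]exchange_big; apply: eq_bigr => i _ /=.
  under [RHS]eq_bigr do rewrite mulr_sumr.
  rewrite [RHS]exchange_big; apply: eq_bigr => l _ /=.
  have [l0|l0] := posnP l.
    by rewrite l0 subn0 zc0 mulr0 big1 // => v _; rewrite !mulr0.
  rewrite (cP i l).2 // mulr_suml; apply: eq_bigr => v _.
  by rewrite mulrA [y v * _]mulrC.
Qed.

End Syzygies.

Section Lifting.
Variables (k : fieldType) (R : comNzRingType) (R_ : nat -> {pred R}).
Variable iota : {rmorphism k -> R}.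
Hypotheses (gr : graded_ring R_) (noethR : noetherian R).
Hypothesis R0k : forall x, x \in R_ 0%N <-> exists a, x = iota a.
Variables (S : finType) (y : S -> R) (dg : S -> nat).
Hypothesis yP : hom_gens R_ y dg (@zeroI R) 1.
Variable delta : nat.
Hypothesis deltaP : forall n, (delta < n)%N ->
  forall g : S -> R, (forall t, homog R_ n (dg t) (g t)) -> \sum_t y t * g t = 0 ->
  exists zeta : S -> S -> R, [/\ forall v t, homog R_ n (dg v + dg t) (zeta v t),
    forall v, \sum_t y t * zeta v t = 0 & forall t, g t = \sum_v y v * zeta v t].
Variables (p : nat) (chk : p \in [pchar k]) (e N : nat).

Let q := (p ^ e)%N.

Hypothesis Nlarge : (\sum_t dg t + delta <= N)%N.
Variable tau : R -> R.
Hypothesis tauD : forall r s, tau (r + s) = tau r + tau s.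
Hypothesis tauM : forall i j a r, a \in R_ i -> r \in R_ j -> (j + q * i <= q * N)%N ->
  tau (a ^+ q * r) = a * tau r.

Local Notation hc := (hc R_).
Local Notation homog := (homog R_).
Local Notation ymono := (mono y).

Definition wt (mu : S -> nat) : nat := (\sum_t mu t * dg t)%N.

Lemma mono_hom mu : ymono mu \in R_ (wt mu).
Proof.
rewrite /ymono /wt; apply: (big_rec2 (fun n x => x \in R_ n)); first exact: graded1.
move=> s n x _ Rx; apply: gradedM => //; rewrite mulnC; apply: gradedX => //; exact: (yP.1 s).2.
Qed.

Lemma monoD mu nu : ymono (fun t => mu t + nu t)%N = ymono mu * ymono nu.
Proof. by rewrite /mono -big_split; apply: eq_bigr => s _; rewrite exprD. Qed.

Lemma monoX mu n : ymono (fun t => mu t * n)%N = ymono mu ^+ n.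
Proof. by rewrite /mono -prodrXl; apply: eq_bigr => s _; rewrite exprM. Qed.

Lemma scaled_mono_hom c mu : iota c * ymono mu \in R_ (wt mu).
Proof. by rewrite -[wt mu]add0n; apply: gradedM (mono_hom mu) => //; apply/R0k; exists c. Qed.

Let q_gt0 : (0 < q)%N.
Proof. by rewrite expn_gt0 prime_gt0 // (pcharf_prime chk). Qed.

Lemma tau0 : tau 0 = 0.
Proof. by apply: (addrI (tau 0)); rewrite -tauD !addr0. Qed.

Lemma wtD mu nu : wt (fun t => mu t + nu t)%N = (wt mu + wt nu)%N.
Proof. by rewrite /wt -big_split; apply: eq_bigr => t _; rewrite mulnDl. Qed.

Lemma wt_modn mu : (wt (fun t => mu t %% q) + delta <= q * N)%N.
Proof.
apply: (@leq_trans (q * (\sum_t dg t + delta))%N); last by rewrite leq_mul2l Nlarge orbT.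
rewrite mulnDr leq_add ?leq_pmull // /wt big_distrr /=; apply: leq_sum => t _.
by rewrite leq_mul2r ltnW ?orbT // ltn_mod.
Qed.

Lemma wt_divn mu : (wt (fun t => mu t %% q) + q * wt (fun t => mu t %/ q) = wt mu)%N.
Proof.
rewrite /wt big_distrr -big_split; apply: eq_bigr => t _ /=.
by rewrite mulnA -mulnDl addnC mulnC [(q * _)%N]mulnC -divn_eq mulnC.
Qed.

Lemma mono_divn mu : ymono (fun t => mu t %/ q)%N ^+ q * ymono (fun t => mu t %% q)%N = ymono mu.
Proof. by rewrite -monoX -monoD; apply: eq_bigr => t _; rewrite -divn_eq. Qed.

(* The value forced on [iota c * y ^ mu] by p^e-linearity, once the values on
   monomials with exponents below [q] are given by [tau]. *)
Definition lift_mono (c : k) (mu : S -> nat) : R :=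
  ymono (fun t => mu t %/ q)%N * tau (iota c * ymono (fun t => mu t %% q)%N).

Lemma lift_mono_low c mu : (wt mu <= q * N)%N -> lift_mono c mu = tau (iota c * ymono mu).
Proof.
move=> wmu; rewrite /lift_mono -(mono_divn mu) mulrCA.
rewrite (tauM (mono_hom _) (scaled_mono_hom c _)) //.
by rewrite wt_divn.
Qed.

Lemma lift_monoD c c' mu : lift_mono (c + c') mu = lift_mono c mu + lift_mono c' mu.
Proof. by rewrite /lift_mono rmorphD mulrDl tauD mulrDr. Qed.

Lemma lift_monoM c c' nu mu : lift_mono (c ^+ q * c') (fun t => nu t * q + mu t)%N =
  iota c * ymono nu * lift_mono c' mu.
Proof.
rewrite /lift_mono.
have -> : (fun t => (nu t * q + mu t) %/ q)%N = (fun t => nu t + mu t %/ q)%N.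
  by apply: funext => t; rewrite divnMDl.
have -> : (fun t => (nu t * q + mu t) %% q)%N = (fun t => mu t %% q)%N.
  by apply: funext => t; rewrite modnMDl.
rewrite monoD rmorphM rmorphXn -[iota c ^+ q * _ * _]mulrA.
have cR : iota c \in R_ 0%N by apply/R0k; exists c.
rewrite (tauM cR (scaled_mono_hom c' _)); first by ring.
by rewrite muln0 addn0; apply: leq_trans (wt_modn mu); apply: leq_addr.
Qed.

(* [rep n a r F]: [r] is the value of a formal combination G of monomials of
   weight [n - a] and [F lam] is the value of the lift on [Y ^ lam * G]. *)
Inductive rep (n a : nat) : R -> ((S -> nat) -> R) -> Prop :=
| rep0 : rep n a 0 (fun=> 0)
| repD r r' F F' : rep n a r F -> rep n a r' F' ->
    rep n a (r + r') (fun lam => F lam + F' lam)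
| repM c mu : (wt mu + a)%N = n ->
    rep n a (iota c * ymono mu) (fun lam => lift_mono c (fun t => lam t + mu t)%N).

Definition incr (t : S) (lam : S -> nat) : S -> nat := fun s => (lam s + (s == t))%N.

Lemma incrC t v lam : incr t (incr v lam) = incr v (incr t lam).
Proof. by apply: funext => s; rewrite /incr addnAC. Qed.

Lemma wt_incr t mu : wt (incr t mu) = (wt mu + dg t)%N.
Proof.
rewrite wtD; congr (_ + _)%N; rewrite /wt (bigD1 t) //= eqxx mul1n big1 ?addn0 //.
by move=> s /negbTE->.
Qed.

Lemma repZ n a c r F : rep n a r F -> exists F', rep n a (iota c * r) F'.
Proof.
elim=> {r F} [|r r' F F' _ [G GP] _ [G' G'P]|c' mu wmu].
- by exists (fun=> 0); rewrite mulr0; apply: rep0.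
- by exists (fun lam => G lam + G' lam); rewrite mulrDr; apply: repD.
- by eexists; rewrite mulrA -rmorphM; apply: repM.
Qed.

Lemma repN n a r F : rep n a r F -> rep n a (- r) (fun lam => - F lam).
Proof.
elim=> {r F} [|r r' F F' _ IH _ IH'|c' mu wmu].
- by rewrite oppr0; apply: rep0.
- have -> : (fun lam => - (F lam + F' lam)) = (fun lam => - F lam + - F' lam).
    by apply: funext => lam; rewrite opprD.
  by rewrite opprD; apply: repD.
- have -> : (fun lam => - lift_mono c' (fun t => lam t + mu t)%N) =
      (fun lam => lift_mono (- c') (fun t => lam t + mu t)%N).
    apply: funext => lam; apply: (addrI (lift_mono c' (fun t => lam t + mu t)%N)).
    by rewrite -lift_monoD !subrr /lift_mono rmorph0 mul0r tau0 mulr0.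
  by rewrite -mulNr -rmorphN; apply: repM.
Qed.

Lemma rep_sum n a (T : finType) (r : T -> R) (F : T -> (S -> nat) -> R) :
  (forall t, rep n a (r t) (F t)) -> rep n a (\sum_t r t) (fun lam => \sum_t F t lam).
Proof.
move=> rF; elim: (index_enum T) => [|t s IHs].
  rewrite big_nil; have -> : (fun lam => \sum_(t <- [::]) F t lam) = fun=> 0.
    by apply: funext => lam; rewrite big_nil.
  exact: rep0.
rewrite big_cons; have -> : (fun lam => \sum_(t <- t :: s) F t lam) =
    (fun lam => F t lam + \sum_(t <- s) F t lam).
  by apply: funext => lam; rewrite big_cons.
exact: repD.
Qed.

Lemma rep_shift n a t r F : rep n (a + dg t) r F ->
  rep n a (y t * r) (fun lam => F (incr t lam)).
Proof.
elim=> {r F} [|r r' F F' _ IH _ IH'|c mu wmu].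
- by rewrite mulr0; apply: rep0.
- by rewrite mulrDr; apply: repD.
- have -> : (fun lam => lift_mono c (fun s => incr t lam s + mu s)%N) =
      (fun lam => lift_mono c (fun s => lam s + incr t mu s)%N).
    by apply: funext => lam; congr lift_mono; apply: funext => s; rewrite /incr addnAC addnA.
  by rewrite mulrCA monoS; apply: repM; rewrite -/(incr t mu) wt_incr -addnA [(dg t + a)%N]addnC.
Qed.

Lemma rep_homog n a r F : rep n a r F -> homog n a r.
Proof.
elim=> {r F} [|r r' F F' _ IH _ IH'|c mu wmu] i ia.
- exact: hc0.
- by rewrite (hcD gr) IH // IH' // addr0.
- rewrite (hc_hom gr _ (scaled_mono_hom c mu)); case: eqP => // E.
  by rewrite E wmu eqxx in ia.
Qed.

Lemma rep_exists n a r : homog n a r -> exists F, rep n a r F.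
Proof.
move=> hr; have [an|na] := leqP a n; last first.
  by exists (fun=> 0); rewrite (homog_eq0 gr na hr); apply: rep0.
have Rr := homog_in gr an hr; have := span_algebra_gens gr R0k yP Rr.
have := hc_hom gr (n - a) Rr; rewrite eqxx => {2}<-.
elim=> {r hr Rr} [|x x' _ [F FP] _ [F' FP']|c x _ [F /(repZ c)[F' FP]]|_ [mu [_ [_ [-> ->]]]]].
- by exists (fun=> 0); rewrite (hc0 gr); apply: rep0.
- by exists (fun lam => F lam + F' lam); rewrite (hcD gr); apply: repD.
- exists F'; have cR : iota c \in R_ 0%N by apply/R0k; exists c.
  by rewrite expr1 (hc_Ml gr _ _ cR) subn0.
- rewrite mulr1 (hc_hom gr _ (mono_hom mu)); case: eqP => E; last by exists (fun=> 0); apply: rep0.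
  by eexists; rewrite -[ymono mu]mul1r -(rmorph1 iota); apply: repM; rewrite -E subnK.
Qed.

(** Each monomial has positive weight, hence contains a variable; an arbitrary one is split off. *)
Lemma rep_decompose n a r F : rep n a r F -> (a < n)%N ->
  exists (g : S -> R) (G : S -> (S -> nat) -> R),
  [/\ forall t, rep n (a + dg t) (g t) (G t), r = \sum_t y t * g t
    & forall lam, F lam = \sum_t G t (incr t lam)].
Proof.
move=> + an; elim=> {r F} [|r r' F F' _ [g [G [gG rE FE]]] _ [g' [G' [gG' rE' FE']]]|c mu wmu].
- exists (fun=> 0), (fun _ _ => 0); split=> [t||lam]; first exact: rep0.
    by rewrite big1 // => t _; rewrite mulr0.
  by rewrite big1.
- exists (fun t => g t + g' t), (fun t lam => G t lam + G' t lam); split=> [t||lam].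
  + exact: repD.
  + by rewrite rE rE' -big_split; apply: eq_bigr => t _; rewrite mulrDr.
  + by rewrite FE FE' -big_split.
- have [t mut] : exists t, (0 < mu t)%N.
    apply: contrapT => /forallNP H; move: an; rewrite -wmu /wt big1 ?add0n ?ltnn // => t _.
    by have /negP := H t; rewrite -eqn0Ngt => /eqP->.
  pose nu s := (mu s - (s == t))%N.
  have muE : mu = incr t nu.
    by apply: funext => s; rewrite /incr /nu; case: eqP => [->|_]; rewrite ?subn0 ?addn0 ?subnK.
  exists (fun s => if s == t then iota c * ymono nu else 0).
  exists (fun s lam => if s == t then lift_mono c (fun s => lam s + nu s)%N else 0); split.
  + move=> s; case: eqP => [->|_]; last exact: rep0.
    by apply: repM; rewrite -wmu muE wt_incr -addnA [(dg t + a)%N]addnC.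
  + rewrite (bigD1 t) //= eqxx big1 ?addr0 => [|s /negbTE->]; last by rewrite mulr0.
    by rewrite mulrCA monoS {1}muE.
  + move=> lam; rewrite (bigD1 t) //= eqxx big1 ?addr0 => [|s /negbTE->//].
    by congr lift_mono; rewrite muE; apply: funext => s; rewrite /incr addnAC addnA.
Qed.

(** Once q-th powers are extracted from Y^lam, only weights at most q N remain, by [wt_modn]. There
    the lift is tau of the value in R, so it depends on r alone. *)
Lemma rep_low n a r F : rep n a r F -> (n - a <= delta)%N -> forall lam,
  F lam = ymono (fun t => lam t %/ q)%N * tau (ymono (fun t => lam t %% q)%N * r).
Proof.
move=> + na; elim=> {r F} [|r r' F F' _ IH _ IH'|c mu wmu] lam.
- by rewrite mulr0 tau0 mulr0.
- by rewrite IH IH' mulrDr tauD mulrDr.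
- have -> : (fun t => lam t + mu t)%N =
      (fun t => lam t %/ q * q + (lam t %% q + mu t))%N.
    by apply: funext => t; rewrite addnA -divn_eq.
  have := lift_monoM 1 c (fun t => lam t %/ q)%N (fun t => lam t %% q + mu t)%N.
  rewrite expr1n mul1r rmorph1 mul1r => ->; rewrite lift_mono_low ?monoD 1?mulrCA //.
  rewrite wtD; apply: leq_trans (wt_modn lam); rewrite leq_add2l.
  by apply: leq_trans na; rewrite -wmu addnK.
Qed.

(* In high weight a relation is, by the bound on syzygies, a combination of
   variables times relations of smaller weight. *)
Lemma rep_zero n a F : rep n a 0 F -> forall lam, F lam = 0.
Proof.
have [m] := ubnP (n - a)%N; elim: m a F => // m IHm a F nam Fr lam.
have [nad|dna] := leqP (n - a) delta.
  by rewrite (rep_low Fr nad) mulr0 tau0 mulr0.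
have an : (a < n)%N by rewrite -subn_gt0; apply: leq_ltn_trans dna.
have [g [G [gG /esym gsyz FE]]] := rep_decompose Fr an.
have shiftH b r : homog (n - a) b r <-> homog n (a + b) r.
  split=> hr i ib; apply: hr; apply: contra ib => /eqP E; apply/eqP.
    by rewrite addnCA E subnKC // ltnW.
  by rewrite -E addnCA addKn.
have hg t : homog (n - a) (dg t) (g t) by apply/shiftH; apply: rep_homog (gG t).
have [zeta [hz zsyz gE]] := deltaP dna hg gsyz.
have exZ v t : exists Z, rep n (a + (dg v + dg t)) (zeta v t) Z.
  by apply: rep_exists; apply/shiftH.
pose Z v t := sval (cid (exZ v t)).
have ZP v t : rep n (a + (dg v + dg t)) (zeta v t) (Z v t) := svalP (cid (exZ v t)).
have lt t : (n - (a + dg t) < m)%N.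
  have [dt _] := yP.1 t; rewrite subnDA; apply: leq_trans (_ : (n - a <= m)%N); last by rewrite -ltnS.
  by rewrite ltn_subrL dt subn_gt0.
(* [G t] and this sum are lifts of two formal expressions of smaller weight with the same value
   [g t], so the induction hypothesis identifies them. *)
have GE t mu : G t mu = \sum_v Z v t (incr v mu).
  have H1 : rep n (a + dg t) (\sum_v y v * zeta v t) (fun lam => \sum_v Z v t (incr v lam)).
    apply: rep_sum => v; apply: rep_shift; rewrite -addnA [(dg t + _)%N]addnC; exact: ZP.
  have := repD (gG t) (repN H1); rewrite -gE subrr => /(IHm _ _ (lt t))/(_ mu)/eqP.
  by rewrite subr_eq0 => /eqP.
have KE v mu : \sum_t Z v t (incr t mu) = 0.
  have H1 : rep n (a + dg v) (\sum_t y t * zeta v t) (fun lam => \sum_t Z v t (incr t lam)).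
    apply: rep_sum => t; apply: rep_shift; rewrite -addnA; exact: ZP.
  by move: H1; rewrite zsyz => /(IHm _ _ (lt v)).
rewrite FE; under eq_bigr do rewrite GE.
rewrite exchange_big big1 //= => v _; rewrite -[RHS](KE v (incr v lam)).
by apply: eq_bigr => t _; rewrite incrC.
Qed.

(** The graph of the lift, without restriction on weights: total because monomials span R,
    single-valued by [rep_zero] applied in each degree. *)
Inductive Rep : R -> R -> Prop :=
| Rep0 : Rep 0 0
| RepD r r' v v' : Rep r v -> Rep r' v' -> Rep (r + r') (v + v')
| RepM c mu : Rep (iota c * ymono mu) (lift_mono c mu).

Lemma Rep_rep r v : Rep r v -> exists (B : nat) (F : nat -> (S -> nat) -> R),
  [/\ forall i, rep i 0 (hc i r) (F i), forall i, (B <= i)%N -> F i (fun=> 0%N) = 0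
    & v = \sum_(i < B) F i (fun=> 0%N)].
Proof.
elim=> {r v} [|r r' v v' _ [B [F [FP F0 vE]]] _ [B' [F' [FP' F0' vE']]]|c mu].
- exists 0%N, (fun _ _ => 0); split=> [i|//|]; last by rewrite big_ord0.
  by rewrite (hc0 gr); apply: rep0.
- exists (maxn B B'), (fun i lam => F i lam + F' i lam); split.
  + by move=> i; rewrite (hcD gr); apply: repD.
  + by move=> i; rewrite geq_max => /andP[Bi B'i]; rewrite F0 // F0' // addr0.
  + rewrite big_split /= vE vE'; congr (_ + _).
      by apply: (sum_wide (c := fun i => F i (fun=> 0%N))); rewrite ?leq_maxl.
    by apply: (sum_wide (c := fun i => F' i (fun=> 0%N))); rewrite ?leq_maxr.
- exists (wt mu).+1.
  exists (fun i lam => if i == wt mu then lift_mono c (fun t => lam t + mu t)%N else 0); split.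
  + move=> i; rewrite (hc_hom gr _ (scaled_mono_hom c mu)).
    by case: eqP => [->|_]; [apply: repM; rewrite addn0|apply: rep0].
  + by move=> i wi; rewrite gtn_eqF.
  + rewrite big_ord_recr /= eqxx big1 ?add0r => [|i _]; last by rewrite ltn_eqF.
    by congr lift_mono.
Qed.

Lemma RepN r v : Rep r v -> Rep (- r) (- v).
Proof.
elim=> {r v} [|r r' v v' _ IH _ IH'|c mu].
- by rewrite !oppr0; apply: Rep0.
- by rewrite !opprD; apply: RepD.
- have -> : - lift_mono c mu = lift_mono (- c) mu.
    apply: (addrI (lift_mono c mu)).
    by rewrite -lift_monoD !subrr /lift_mono rmorph0 mul0r tau0 mulr0.
  by rewrite -mulNr -rmorphN; apply: RepM.
Qed.

Lemma Rep_uniq r v v' : Rep r v -> Rep r v' -> v = v'.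
Proof.
move=> rv rv'; apply/eqP; rewrite -subr_eq0; apply/eqP.
have := RepD rv (RepN rv'); rewrite subrr => /Rep_rep[B [F [FP _ ->]]].
by rewrite big1 // => i _; have := FP i; rewrite (hc0 gr) => /rep_zero.
Qed.

Lemma RepZ c r v : Rep r v -> exists v', Rep (iota c * r) v'.
Proof.
elim=> {r v} [|r r' v v' _ [w rw] _ [w' rw']|c' mu].
- by exists 0; rewrite mulr0; apply: Rep0.
- by exists (w + w'); rewrite mulrDr; apply: RepD.
- by eexists; rewrite mulrA -rmorphM; apply: RepM.
Qed.

Lemma Rep_exists r : exists v, Rep r v.
Proof.
have [n /(Rle_sum gr)->] := exists_Rle gr r.
elim/big_rec: _ => [|i x _ [v xv]]; first by exists 0; apply: Rep0.
suff [w hw] : exists w, Rep (hc i r) w by exists (w + v); apply: RepD.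
have := span_algebra_gens gr R0k yP (hc_in gr i r).
elim=> {x v xv} [|x x' _ [w xw] _ [w' xw']|c x _ [w /(RepZ c)]|_ [mu [_ [_ [-> ->]]]]].
- by exists 0; apply: Rep0.
- by exists (w + w'); apply: RepD.
- by rewrite expr1.
- by exists (lift_mono 1 mu); rewrite mulr1 -[ymono mu]mul1r -(rmorph1 iota); apply: RepM.
Qed.

Lemma exists_lift : exists phi : R -> R,
  [/\ forall r s, phi (r + s) = phi r + phi s, forall b r, phi (b ^+ q * r) = b * phi r
    & forall c mu, phi (iota c * ymono mu) = lift_mono c mu].
Proof.
pose phi r := sval (cid (Rep_exists r)).
have phiP r : Rep r (phi r) := svalP (cid (Rep_exists r)).
have phiE r v : Rep r v -> phi r = v by move/(Rep_uniq (phiP r)).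
have phiD r s : phi (r + s) = phi r + phi s by apply: phiE; apply: RepD.
exists phi; split=> // [b r|c mu]; last by apply: phiE; apply: RepM.
have exprqD (x z : R) : (x + z) ^+ q = x ^+ q + z ^+ q.
  rewrite exprDn_pchar // pnatX (pnatE _ (pcharf_prime chk)); apply/orP; left.
  exact: (rmorph_pchar iota chk).
elim: (phiP b) => {b} [|b b' v v' _ IH _ IH'|c nu].
- by rewrite expr0n eqn0Ngt q_gt0 !mul0r (phiE _ _ Rep0).
- by rewrite exprqD mulrDl phiD IH IH' mulrDl.
- apply: phiE; elim: (phiP r) => {r} [|r r' v v' _ IH _ IH'|c' mu].
  + by rewrite !mulr0; apply: Rep0.
  + by rewrite !mulrDr; apply: RepD.
  + rewrite -lift_monoM.
    have -> : (iota c * ymono nu) ^+ q * (iota c' * ymono mu) =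
        iota (c ^+ q * c') * ymono (fun t => nu t * q + mu t)%N.
      rewrite monoD monoX rmorphM rmorphXn exprMn; ring.
    exact: RepM.
Qed.

End Lifting.

(** * Homogeneous parts of truncated p^e-linear maps *)

Section Homogenize.
Variables (k : fieldType) (R : comNzRingType) (R_ : nat -> {pred R}).
Variable iota : {rmorphism k -> R}.
Hypotheses (gr : graded_ring R_) (noethR : noetherian R).
Hypothesis R0k : forall x, x \in R_ 0%N <-> exists a, x = iota a.
Variables (p : nat) (chk : p \in [pchar k]).

Local Notation hc := (hc R_).
Local Notation Rgt := (Rgt R_).

Lemma lift_functional : exists N0, forall N e (psi : R -> R), (N0 <= N)%N ->
  (forall r s, Rgt N (psi (r + s) - (psi r + psi s))) ->
  (forall b r, Rgt N (psi (b ^+ (p ^ e) * r) - b * psi r)) ->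
  forall s, hc 0 (psi s) != 0 ->
  exists phi : R -> R, [/\ forall r s, phi (r + s) = phi r + phi s,
    forall b r, phi (b ^+ (p ^ e) * r) = b * phi r & hc 0 (phi s) != 0].
Proof.
have [S [y [dg yP]]] := exists_algebra_gens gr noethR (graded0_unit R0k).
have [delta deltaP] := syzygies_bounded gr noethR yP.
exists (\sum_t dg t + delta)%N => N e psi NL psiD psiM s psis.
pose q := (p ^ e)%N.
have p0 : (0 < p)%N by exact/prime_gt0/(pcharf_prime chk).
have q0 : (0 < q)%N by rewrite expn_gt0 p0.
have hpsiD l r r' : (l <= N)%N -> hc l (psi (r + r')) = hc l (psi r) + hc l (psi r').
  move=> lN; apply/eqP; rewrite -subr_eq0 -(hcD gr) -(hcB gr); apply/eqP; exact: psiD.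
have hpsiM l b r : (l <= N)%N -> hc l (psi (b ^+ q * r)) = hc l (b * psi r).
  by move=> lN; apply/eqP; rewrite -subr_eq0 -(hcB gr); apply/eqP; exact: psiM.
have hpsi0 l : (l <= N)%N -> hc l (psi 0) = 0.
  by move=> lN; apply: (addrI (hc l (psi 0))); rewrite -hpsiD // !addr0.
have [n psin] : exists n, hc 0 (psi (hc n s)) != 0.
  apply: contrapT => /forallNP H; case/negP: psis; apply/eqP.
  have [B /(_ B (leqnn _))[-> _]] := hc_bound gr s.
  elim/big_rec: _ => [|i x _ IH]; first by rewrite hpsi0.
  by rewrite hpsiD // IH addr0; apply/eqP/negPn/negP/H.
(* The part of psi sending degree n + q l to degree l. Stopping at l = N discards the errors of psi,
   which lie in R_(>N), and q-linearity becomes exact as long as degrees do not exceed q N. *)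
pose tau r := \sum_(l < N.+1) hc l (psi (hc (n + q * l) r)).
have tauD r r' : tau (r + r') = tau r + tau r'.
  rewrite /tau -big_split; apply: eq_bigr => l _ /=.
  by rewrite (hcD gr) hpsiD // -ltnS.
have tau_hom j r l : (l <= N)%N -> (j = n + q * l)%N -> r \in R_ j -> tau r = hc l (psi r).
  move=> lN jE Rr; have lN' : (l < N.+1)%N by [].
  rewrite /tau (bigD1 (Ordinal lN')) //= (hc_hom gr _ Rr) jE eqxx big1 ?addr0 // => i il.
  rewrite (hc_hom gr _ Rr) jE eqn_add2l eqn_pmul2l // ifN ?hpsi0 //.
  by rewrite -ltnS.
have tau_hom0 j r : (forall l, (j != n + q * l)%N) -> r \in R_ j -> tau r = 0.
  move=> jn Rr; rewrite /tau big1 // => l _.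
  by rewrite (hc_hom gr _ Rr) eq_sym (negbTE (jn l)) hpsi0 // -ltnS.
have tauM i j a r : a \in R_ i -> r \in R_ j -> (j + q * i <= q * N)%N ->
    tau (a ^+ q * r) = a * tau r.
  move=> Ra Rr jN.
  have Rar : a ^+ q * r \in R_ (q * i + j)%N by rewrite mulnC; apply: gradedM => //; apply: gradedX.
  have [[l lE]|nl] := EM (exists l, (q * i + j = n + q * l)%N); last first.
    rewrite (tau_hom0 _ _ _ Rar) => [|l]; last by apply/eqP => E; apply: nl; exists l.
    rewrite (tau_hom0 _ _ _ Rr) ?mulr0 // => l; apply/eqP => E; apply: nl; exists (l + i)%N.
    by rewrite E mulnDr; lia.
  have lN : (l <= N)%N by rewrite -(leq_pmul2l q0); move: lE jN; lia.
  rewrite (tau_hom _ _ l lN lE Rar) hpsiM // (hc_Ml gr _ _ Ra); case: leqP => il.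
    rewrite (tau_hom j _ (l - i)%N) //; first by apply: leq_trans (leq_subr _ _) lN.
    by rewrite mulnBr; have := leq_mul (leqnn q) il; move: lE; lia.
  rewrite (tau_hom0 j) ?mulr0 // => l'; apply/eqP => E.
  have : (q * l < q * i)%N by rewrite ltn_pmul2l.
  by move: lE E; lia.
have [phi [phiD phiM phiE]] := exists_lift gr R0k yP deltaP chk (e := e) NL tauD tauM.
exists phi; split=> //.
have phi0 : phi 0 = 0 by apply: (addrI (phi 0)); rewrite -phiD !addr0.
(* On a monomial with an exponent at least q both sides vanish, because a factor from the irrelevant
   ideal comes out. On the others phi is tau, whose constant term is the summand l = 0. *)
suff H r : hc 0 (phi r) = hc 0 (psi (hc n r)) by rewrite H.
have [v] := Rep_exists gr R0k yP p e tau r.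
elim=> {v r} [|r r' v v' _ IH _ IH'|c mu].
- by rewrite phi0 (hc0 gr) (hc0 gr) hpsi0.
- by rewrite phiD (hcD gr) IH IH' (hcD gr) hpsiD.
- rewrite phiE /lift_mono (hc0M gr); set x := iota c * mono y mu.
  have Rx := scaled_mono_hom gr R0k yP c mu.
  have [mu0|/existsNP[t /negP]] := EM (forall t, mu t < q)%N.
    have -> : (fun t => mu t %/ q)%N = fun=> 0%N by apply: funext => t; rewrite divn_small.
    have -> : (fun t => mu t %% q)%N = mu by apply: funext => t; rewrite modn_small.
    rewrite mono0 (hc01 gr) mul1r /tau (hc_sum gr) big_ord_recl /= muln0 addn0.
    rewrite (hc_hom gr _ (hc_in gr 0 _)) eqxx big1 ?addr0 // => l _.
    by rewrite (hc_hom gr _ (hc_in gr _ _)).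
  rewrite -leqNgt => qmu.
  have mirr : irr R_ (mono y (fun t => mu t %/ q)%N).
    apply: (irr_hom gr) (mono_hom gr yP _); rewrite /wt (bigD1 t) //= addn_gt0 muln_gt0.
    by rewrite divn_gt0 // qmu (yP.1 t).1.
  rewrite [X in X * _]mirr mul0r (hc_hom gr _ Rx); case: eqP => _; last by rewrite hpsi0.
  rewrite /x -(mono_divn y p e) mulrCA hpsiM // (hc0M gr) [X in X * _]mirr mul0r //.
Qed.

End Homogenize.

(** * Condition (B) *)

Section ConditionB.
Variables (k : fieldType) (R : comNzRingType) (R_ : nat -> {pred R}).
Variable iota : {rmorphism k -> R}.
Hypotheses (gr : graded_ring R_) (noethR : noetherian R).
Hypothesis R0k : forall x, x \in R_ 0%N <-> exists a, x = iota a.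
Variables (Rm : localRing) (f : {rmorphism R -> Rm}).
Hypothesis locf : is_localization_at (irrelevant R_) f.
Variables (p : nat) (chk : p \in [pchar k]).

Local Notation hc := (hc R_).

(** Writing a / s as (a s^(q-1)) / s^q forces the value phi(a s^(q-1)) / s; the proof checks that it
    does not depend on the fraction. *)
Lemma localize_functional e (phi : R -> R) :
  (forall r s, phi (r + s) = phi r + phi s) ->
  (forall b r, phi (b ^+ (p ^ e) * r) = b * phi r) ->
  exists phim : Rm -> Rm, frob_linear p e phim /\ forall r, phim (f r) = f (phi r).
Proof.
move=> phiD phiM; pose q := (p ^ e)%N.
have q0 : (0 < q)%N by rewrite expn_gt0 prime_gt0 // (pcharf_prime chk).
have qE (s : R) : s * s ^+ q.-1 = s ^+ q by rewrite -exprS prednK.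
have uniq a s a' s' b : hc 0 s != 0 -> hc 0 s' != 0 -> b * f s = f a -> b * f s' = f a' ->
    f (phi (a * s ^+ q.-1)) * f s' = f (phi (a' * s' ^+ q.-1)) * f s.
  move=> s0 s0' bs bs'.
  have : f (a * s') = f (a' * s) by rewrite !rmorphM -bs -bs'; ring.
  move=> /(loc_eq gr locf)[w [w0 wE]].
  have [v wv] := loc_unit gr locf w0.
  have E : w * (s' * phi (a * s ^+ q.-1)) = w * (s * phi (a' * s' ^+ q.-1)).
    rewrite -!phiM -/q; congr phi.
    have -> : s' ^+ q * (a * s ^+ q.-1) = (a * s') * (s ^+ q.-1 * s' ^+ q.-1) by rewrite -qE; ring.
    have -> : s ^+ q * (a' * s' ^+ q.-1) = (a' * s) * (s ^+ q.-1 * s' ^+ q.-1) by rewrite -qE; ring.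
    by rewrite -[w ^+ q]qE; have -> : forall x y z : R, x * y * (z * (s ^+ q.-1 * s' ^+ q.-1)) =
      y * (x * z) * (s ^+ q.-1 * s' ^+ q.-1) by [move=> x y z; ring]; rewrite wE; ring.
  move/(congr1 (fun x => v * f x)): E; rewrite !rmorphM.
  have vw x : v * (f w * x) = x by rewrite mulrA [v * _]mulrC wv mul1r.
  by rewrite !vw mulrC => ->; rewrite mulrC.
have ex b : exists c, forall a s, hc 0 s != 0 -> b * f s = f a -> c * f s = f (phi (a * s ^+ q.-1)).
  have [a [s [s1 bs]]] := loc_frac gr R0k locf b.
  have s0 : hc 0 s != 0 by rewrite s1 oner_eq0.
  have [v sv] := loc_unit gr locf s0.
  exists (f (phi (a * s ^+ q.-1)) * v) => a' s' s0' bs'.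
  by rewrite mulrAC (uniq a s a' s' b) // -mulrA sv mulr1.
pose phim b := sval (cid (ex b)).
have phimP b a s : hc 0 s != 0 -> b * f s = f a -> phim b * f s = f (phi (a * s ^+ q.-1)).
  exact: (svalP (cid (ex b))).
have cancel s x x' : hc 0 s != 0 -> x * f s = x' * f s -> x = x'.
  move=> /(loc_unit gr locf)[v sv] /(congr1 (fun z => z * v)).
  by rewrite -!mulrA sv !mulr1.
have hc1 : hc 0 1 != 0 by rewrite (hc01 gr) oner_eq0.
exists phim; split; last first.
  move=> r; apply: (cancel 1) => //; rewrite (phimP _ r) ?rmorph1 ?mulr1 //.
  by rewrite expr1n mulr1.
split=> [x x'|b x].
- have [a [s [s1 xs]]] := loc_frac gr R0k locf x; have [a' [s' [s1' xs']]] := loc_frac gr R0k locf x'.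
  have s0 : hc 0 s != 0 by rewrite s1 oner_eq0.
  have s0' : hc 0 s' != 0 by rewrite s1' oner_eq0.
  have ss0 := hc0_mul_neq0 gr R0k s0 s0'.
  apply: (cancel (s * s')) => //; rewrite mulrDl.
  rewrite (phimP x (a * s')) ?(phimP x' (a' * s)) // ?(phimP (x + x') (a * s' + a' * s)) //.
  + by rewrite mulrDl phiD rmorphD.
  + by rewrite rmorphD !rmorphM -xs -xs'; ring.
  + by rewrite !rmorphM -xs'; ring.
  + by rewrite !rmorphM -xs; ring.
- have [a [s [s1 xs]]] := loc_frac gr R0k locf x; have [a' [s' [s1' bs']]] := loc_frac gr R0k locf b.
  have s0 : hc 0 s != 0 by rewrite s1 oner_eq0.
  have s0' : hc 0 s' != 0 by rewrite s1' oner_eq0.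
  have ss0 : hc 0 (s' ^+ q * s) != 0.
    by apply: (hc0_mul_neq0 gr R0k) => //; rewrite (hc0X gr) s1' expr1n oner_eq0.
  apply: (cancel (s' ^+ q * s)) => //.
  rewrite (phimP _ (a' ^+ q * a)) //; last first.
    by rewrite !rmorphM !rmorphXn -bs' exprMn -xs -/q; ring.
  have -> : a' ^+ q * a * (s' ^+ q * s) ^+ q.-1 = (a' * s' ^+ q.-1) ^+ q * (a * s ^+ q.-1).
    by rewrite !exprMn -!exprM [(q * _)%N]mulnC; ring.
  rewrite phiM rmorphM -(phimP x a s s0 xs) rmorphM -bs' -qE !rmorphM.
  by rewrite rmorphXn; ring.
Qed.

(** M with scalars acting through their p^e-th powers. On a Frobenius tensor product this makes x
    |-> r (x) x linear, so that injectivity of E applies to it. *)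
Definition frob_restrict (e : nat) (M : lmodType Rm) : Type := M.

Section FrobeniusRestriction.
Variables (chS : p \in [pchar Rm]) (e : nat) (M : lmodType Rm).
Local Notation FM := (frob_restrict e M).
HB.instance Definition _ := GRing.Zmodule.on FM.

Definition frob_restrict_scale (a : Rm) (x : FM) : FM := (a ^+ (p ^ e) *: (x : M)).

Fact frob_restrict_scaleA a b x :
  frob_restrict_scale a (frob_restrict_scale b x) = frob_restrict_scale (a * b) x.
Proof. by rewrite /frob_restrict_scale scalerA exprMn. Qed.
Fact frob_restrict_scale1 : left_id 1 frob_restrict_scale.
Proof. by move=> x; rewrite /frob_restrict_scale expr1n scale1r. Qed.
Fact frob_restrict_scaleDr : right_distributive frob_restrict_scale +%R.
Proof. by move=> a x y; apply: scalerDr. Qed.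
Fact frob_restrict_scaleDl x : {morph frob_restrict_scale^~ x : a b / a + b}.
Proof.
move=> a b; rewrite /frob_restrict_scale exprDn_pchar ?scalerDl //.
by rewrite pnatX (pnatE _ (pcharf_prime chS)); apply/orP; left.
Qed.

Definition frob_restrict_lmod : lmodType Rm :=
  HB.pack FM (GRing.Zmodule_isLmodule.Build Rm FM frob_restrict_scaleA
    frob_restrict_scale1 frob_restrict_scaleDr frob_restrict_scaleDl).
End FrobeniusRestriction.

End ConditionB.

Section Assembly.
Variables (k : fieldType) (R : comNzRingType) (R_ : nat -> {pred R}).
Variable iota : {rmorphism k -> R}.
Hypotheses (gr : graded_ring R_) (noethR : noetherian R).
Hypothesis R0k : forall x, x \in R_ 0%N <-> exists a, x = iota a.
Variables (Rm : localRing) (f : {rmorphism R -> Rm}).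
Hypothesis locf : is_localization_at (irrelevant R_) f.
Variables (p : nat) (chk : p \in [pchar k]).

Local Notation hc := (hc R_).
Local Notation Rgt := (Rgt R_).

Lemma irrX_Rgt N z : irr R_ z -> Rgt N (z ^+ N.+1).
Proof.
move=> z0 i; rewrite -ltnS; elim: N.+1 i => // n IHn i ni.
rewrite exprS (hcM gr) big1 // => l _; have [->|l0] := posnP l; first by rewrite z0 mul0r.
by rewrite IHn ?mulr0 //; move: ni l0 (ltn_ord l); lia.
Qed.

Variables (E : lmodType Rm) (j : {linear residue_module Rm -> E}) (u : E).
Hypotheses (hull : injective_hull j).
Hypothesis socE : forall x, socle E x <-> x \in line u.

Lemma socle_gen_in_ann N : u \in ann f E (Rgt N).
Proof.
apply/annP => r Nr; apply: (socle_gen socE); apply/(res_loc0 gr R0k locf).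
exact: Nr.
Qed.

Section Injectivity.
Variables (N e : nat).
Local Notation E' := (ann f E (Rgt N)).
Local Notation q := (p ^ e)%N.
Let u' : submod_type E' := exist (fun x => x \in E') u (socle_gen_in_ann N).

Hypothesis liftP : forall psi : R -> R,
  (forall r s, Rgt N (psi (r + s) - (psi r + psi s))) ->
  (forall b r, Rgt N (psi (b ^+ q * r) - b * psi r)) ->
  forall s, hc 0 (psi s) != 0 ->
  exists phi : R -> R, [/\ forall r s, phi (r + s) = phi r + phi s,
    forall b r, phi (b ^+ q * r) = b * phi r & hc 0 (phi s) != 0].

Let chS : p \in [pchar Rm].
Proof. exact: (rmorph_pchar (f \o iota) chk). Qed.

Let W : lmodType Rm := frob_tensor q (submod_type E').
Let FW : lmodType Rm := frob_restrict_lmod chS e W.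

Lemma elem_socle c r : res Rm c = 0 -> elem q (r * c ^+ q) u' = 0.
Proof.
move=> c0; rewrite elem_bal (_ : c *: u' = 0) ?elem0 //.
by apply: val_inj; apply: (socle_gen socE).
Qed.

(* A nonzero [s (x) u] spans a copy of the residue field in the Frobenius
   restriction of [F^e(E')], so that injectivity of E detects it. *)
Lemma exists_detecting_map s : elem q s u' <> 0 ->
  exists Phi : {linear FW -> E}, Phi (elem q s u' : W) = j (1 : residue Rm).
Proof.
set w := elem q s u' => w0.
have expB (a b : Rm) : a ^+ q = (a - b) ^+ q + b ^+ q.
  rewrite -exprDn_pchar ?subrK // pnatX (pnatE _ (pcharf_prime chS)); apply/orP; left.
  exact: chS.
have wE a b : res Rm a = res Rm b -> a ^+ q *: w = b ^+ q *: w.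
  move=> ab; rewrite (expB a b) scalerDl [X in X + _]elemZ mulrC elem_socle ?add0r //.
  by rewrite rmorphB ab subrr.
pose lift (y : residue_module Rm) := sval (cid (@res_surj Rm (y : residue Rm))).
have liftK y : res Rm (lift y) = y := svalP (cid (@res_surj Rm (y : residue Rm))).
pose i (y : residue_module Rm) : FW := lift y ^+ q *: w.
have iL : linear i.
  move=> c x y; rewrite /i.
  rewrite (wE _ (c * lift x + lift y)); last first.
    by rewrite rmorphD rmorphM !liftK.
  rewrite exprDn_pchar ?exprMn ?scalerDl -?scalerA //.
  by rewrite pnatX (pnatE _ (pcharf_prime chS)); apply/orP; left; exact: chS.
have iinj : injective (linear_of iL).
  move=> x y /eqP; rewrite -subr_eq0 -linearB linear_ofE => /eqP ixy.
  apply/eqP; rewrite -subr_eq0; apply/negP => /negP xy0.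
  have [|d cd] := @res_unit Rm (lift (x - y)).
    by rewrite liftK; apply/eqP.
  apply: w0; rewrite -[w]scale1r -(expr1n _ q) -cd exprMn mulrC -scalerA.
  by rewrite [X in _ *: X]ixy scaler0.
case: hull => _ injE _.
have [Phi PhiP] := injE _ _ (linear_of iL) j iinj.
exists Phi; rewrite -PhiP linear_ofE /i (wE _ 1) ?expr1n ?scale1r //.
by rewrite liftK rmorph1.
Qed.

(** The linear map x |-> Phi(r (x) x) from E' to E extends to E by injectivity, hence is a
    multiplication by [ann_endo]; the multiplier may be taken in R because elements z^(N+1) with z
    irrelevant kill E'. *)
Lemma exists_multiplier (Phi : {linear FW -> E}) (r : Rm) : exists a : R,
  forall x : submod_type E', Phi (elem q r x : W) = f a *: val x.
Proof.
have gL : linear (fun x : submod_type E' => Phi (elem q r x : W)).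
  move=> c x y; have -> : elem q r (c *: x + y) = c ^+ q *: elem q r x + elem q r y.
    by rewrite elemDr elemZ mulrC elem_bal.
  exact: (linearP Phi c (elem q r x : W) (elem q r y : W)).
case: (hull) => _ injE _.
have [|h hP] := injE _ _ (submod_incl (N := E')) (linear_of gL); first exact: val_inj.
have [b bP] := ann_endo gr noethR R0k locf socE N h.
have [a [z [zi bE]]] := loc_approx gr R0k locf b N.+1.
exists a => x; have := hP x; rewrite linear_ofE => <-.
rewrite bP; last exact: valP.
rewrite bE scalerDl -scalerA -rmorphXn.
have -> : f (z ^+ N.+1) *: (submod_incl x : E) = 0.
  by have /annP := valP x; apply; apply: irrX_Rgt.
by rewrite scaler0 addr0.
Qed.

Lemma elem_socle_injective s : elem q s u = 0 -> elem q s u' = 0.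
Proof.
move=> su0; apply: contrapT => /[dup] w0 /exists_detecting_map[Phi Phiw].
(* Replacing s by [f s1] changes s (x) u by a multiple of 1 (x) z u = 0, and psi is only defined on
   R. *)
have [s1 [z [zi sE]]] := loc_approx gr R0k locf s q.
have z0 := (res_loc0 gr R0k locf z).2 zi.
pose psi r := sval (cid (exists_multiplier Phi (f r))).
have psiP r (x : submod_type E') : Phi (elem q (f r) x : W) = f (psi r) *: val x.
  exact: (svalP (cid (exists_multiplier Phi (f r)))).
have faithful a : (forall x : submod_type E', f a *: val x = 0) -> Rgt N a.
  move=> H; apply: (ann_faithful gr R0k locf hull socE) => x xE.
  exact: (H (exist (fun x => x \in E') x xE)).
have [|||phi [phiD phiM phis]] := liftP (psi := psi) _ _ (s := s1).
- move=> r r'; apply: faithful => x.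
  rewrite rmorphB rmorphD scalerBl scalerDl -!psiP rmorphD elemDl.
  by rewrite [Phi _](linearD Phi (elem q (f r) x : W) (elem q (f r') x : W)) subrr.
- move=> b r; apply: faithful => x.
  rewrite rmorphB rmorphM scalerBl -scalerA -!psiP !rmorphM rmorphXn.
  by rewrite -(linearZ_LR Phi) /= -elemZ subrr.
- apply/eqP => psi0; case: (hull) => jinj _ _.
  have /jinj/eqP : j (1 : residue Rm) = j 0; last by rewrite oner_eq0.
  rewrite -Phiw linear0 sE elemDl elem_socle // addr0 psiP.
  exact/(socle_gen socE)/(res_loc0 gr R0k locf).
have [phim [[phimD phimM] phimE]] := localize_functional gr R0k locf chk phiD phiM.
(* The additive map r (x) x |-> phim(r) x on F^e(E) sends s (x) u to phi(s1) u. As s (x) u = 0, this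
   contradicts the nonzero constant term of phi(s1). *)
pose F (r : Rm) (x : E) : E := phim r *: x.
have FDl r r' x : F (r + r') x = F r x + F r' x by rewrite /F phimD scalerDl.
have FDr r x x' : F r (x + x') = F r x + F r x' by rewrite /F scalerDr.
have Fbal r b x : F (r * b ^+ q) x = F r (b *: x).
  by rewrite /F mulrC phimM mulrC scalerA.
have : tens_lift F (elem q s u) = 0 by rewrite su0 (tens_lift0 FDl FDr Fbal).
rewrite (tens_lift_elem FDl FDr Fbal) /F sE [s * _]mulrC phimD phimM phimE.
rewrite scalerDl [f z * _]mulrC -scalerA (socle_gen socE z0) scaler0 addr0.
move=> /(scale_socle_gen0 hull socE)/(res_loc0 gr R0k locf) phis0.
by move/eqP: phis; apply.
Qed.

End Injectivity.
End Assembly.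

Lemma condition_B_localization (k : fieldType) (R : comNzRingType) (R_ : nat -> {pred R})
    (iota : {rmorphism k -> R}) (p : nat) (Rm : localRing) (f : {rmorphism R -> Rm}) :
  p \in [pchar k] -> graded_ring R_ -> noetherian R ->
  (forall x, x \in R_ 0%N <-> exists a, x = iota a) ->
  is_localization_at (irrelevant R_) f -> condition_B p Rm.
Proof.
move=> chk gr noethR R0k locf E j u hull socE.
have [N liftP] := lift_functional gr noethR R0k chk.
exists (ann f E (Rgt R_ N)); split.
- exact: (ann_finite_length gr noethR R0k locf socE).
- exact: (socle_gen_in_ann gr R0k locf socE).
- move=> e; refine (@kernel_lengths Rm (p ^ e) E u _ (socle_gen_in_ann gr R0k locf socE N) _) => s.
  apply: (elem_socle_injective gr noethR R0k locf chk hull) => psi.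
  exact: liftP.
Qed.

Theorem theorem2p2 (RR : realType) (p : nat) (k : fieldType)
    (chk : p \in [pchar k]) (Fk : F_finite chk)
    (R : comAlgType k) (R_ : nat -> {pred R})
    (gradedR : graded_ring R_)
    (R0k : forall x : R, x \in R_ 0%N <-> exists a : k, x = a%:A)
    (reducedR : reduced R) (noetherianR : noetherian R)
    (Rm : localRing) (f : {rmorphism R -> Rm})
    (locf : is_localization_at (irrelevant R_) f) :
  condition_B p Rm /\ exists s : RR, is_F_signature p Rm s.
Proof.
split.
  exact: (condition_B_localization (iota := in_alg R) chk gradedR noetherianR R0k locf).
exact: (exists_F_signature RR Fk (iota := in_alg R) gradedR noetherianR reducedR R0k locf).
Qed.
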